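(* Let $\Theta$ be a theta curve with oriented cycles $C_1,C_2,C_3$ such that $[C_1]+[C_2]+[C_3]=0$ in $H_1(\Theta)$. Let $n\geq 3$, and suppose that $\Theta$ and $K_n$ are disjointly embedded, weakly linked graphs in $\mathbb{R}^3$. Then exactly one of the following cases holds: (A1) There is a vertex $p$ of $K_n$ common to all triangles of $K_n$ linking a cycle in $\Theta$. Then there are pairwise disjoint sets $I_1,I_2,I_3$ (at most one empty) such that $I_1\cup I_2\cup I_3$ is the vertex set of $K_n-\{p\}$, and, after reversing the orientation of $\Theta$ (that is, replacing $C_i$ by $-C_i$ for all $i$) if necessary, each $C_i$ links $K_n$ in the star $pO_iI_i$, where $O_1=I_2\cup I_3$, $O_2=I_1\cup I_3$, $O_3=I_1\cup I_2$. (A2) There is no vertex of $K_n$ common to all triangles of $K_n$ linking a cycle in $\Theta$. Then $n\geq 5$ and there are distinct vertices $p_1,p_2,p_3$ of $K_n$ such that, after reversing the orientation of $\Theta$ if necessary, each $C_i$ links $K_n$ in the star $p_iO_iI$, where $O_1=\{p_2,p_3\}$, $O_2=\{p_1,p_3\}$, $O_3=\{p_1,p_2\}$, and $I=K_n-\{p_1,p_2,p_3\}$.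
   Context: A theta curve is a graph with two vertices joined by three edges; it contains exactly three cycles, $C_1,C_2,C_3$. A complete graph and its vertex set are denoted by the same symbol, so $K_n-S$ denotes the set of vertices not in $S$. An embedded graph is identified with its image in $\mathbb{R}^3$. $\operatorname{Lk}(C,D)$ denotes the linking number of disjoint oriented simple closed curves; $C,D$ are linked if $\operatorname{Lk}(C,D)\neq 0$ and strongly linked if $|\operatorname{Lk}(C,D)|\geq 2$. Disjointly embedded graphs are weakly linked if some cycle in one links a cycle in the other, but no cycle in one strongly links a cycle in the other. For distinct vertices $p,q,r$, $pqr$ denotes the oriented triangle $p\to q\to r\to p$, and $-T$ is $T$ reversed. Star: given an ordered partition $(\{p\},O,I)$ of the vertices of $K_n$, the star $pOI$ consists of all oriented triangles $pqr$ with $q\in O$, $r\in I$. ''$C$ links $K_n$ in the star $pOI$'' means that for all oriented triangles $T$ of $K_n$: $\operatorname{Lk}(C,T)=+1$ if $T\in pOI$, $-1$ if $-T\in pOI$, and $0$ otherwise. Here $O$ or $I$ is allowed to be empty, in which case the star $pOI$ contains no triangles and the condition says that $C$ does not link any triangle of $K_n$. *)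

(* Defs.v *)
From HB Require Import structures.
From mathcomp Require Export all_boot all_order all_algebra.
From mathcomp Require Export all_classical all_reals all_analysis.
Set Implicit Arguments.
Unset Strict Implicit.
Unset Printing Implicit Defensive.
Import Order.TTheory GRing.Theory Num.Theory.
Import numFieldNormedType.Exports.
Local Open Scope ring_scope.

(** Curves in [R^3].  A path is a function [R -> 'rV[R]_3], of which only the
    restriction to [[0, 1]] matters. *)

Definition unit_itv (R : realType) : set R := `[0, 1]%classic.
Arguments unit_itv {R}.

Definition rev_path (R : realType) (f : R -> 'rV[R]_3) : R -> 'rV[R]_3 :=
  fun t => f (1 - t).

(* With m = size s, the k-th path of s is run over [k/m, (k+1)/m]. *)
Definition concat_paths (R : realType) (s : seq (R -> 'rV[R]_3)) :
    R -> 'rV[R]_3 :=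
  fun t =>
    let x := t * (size s)%:R in
    let k := minn (Num.truncn x) (size s).-1 in
    nth (fun=> 0) s k (x - k%:R).

Definition cyclic_pairs (T : Type) (s : seq T) : seq (T * T) := zip s (rot 1 s).

(** Closed polygons, given by the cyclic sequence of their vertices. *)

Definition segment (R : realType) (e : 'rV[R]_3 * 'rV[R]_3) : R -> 'rV[R]_3 :=
  fun t => (1 - t) *: e.1 + t *: e.2.

Definition polygon (R : realType) (P : seq 'rV[R]_3) : R -> 'rV[R]_3 :=
  concat_paths [seq segment e | e <- cyclic_pairs P].

(* Equality of the projections to the plane of the first two coordinates. *)
Definition same_shadow (R : realType) (x y : 'rV[R]_3) : Prop :=
  x 0 0 = y 0 0 /\ x 0 1 = y 0 1.

(* Orientation of the plane basis formed by the projected directions of the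
   oriented segments e and f. *)
Definition shadow_det (R : realType) (e f : 'rV[R]_3 * 'rV[R]_3) : R :=
  let u := e.2 - e.1 in let v := f.2 - f.1 in u 0 0 * v 0 1 - u 0 1 * v 0 0.

(* The projections of P and Q meet only in transverse crossings of interior
   points of edges.  Self-crossings of P or Q are not restricted, since they
   do not contribute to the linking number. *)
Definition general_position (R : realType) (P Q : seq 'rV[R]_3) : Prop :=
  forall e f, e \in cyclic_pairs P -> f \in cyclic_pairs Q ->
  forall s t : R, unit_itv s -> unit_itv t ->
  same_shadow (segment e s) (segment f t) ->
  [/\ 0 < s < 1, 0 < t < 1 & shadow_det e f != 0].

Definition crosses_over (R : realType) (e f : 'rV[R]_3 * 'rV[R]_3) : Prop :=
  exists s t : R, [/\ unit_itv s, unit_itv t,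
    same_shadow (segment e s) (segment f t) &
    segment f t 0 2 < segment e s 0 2].

(* The sum of the (right-handed) signs of the crossings at which P passes over
   Q: the linking number of disjoint polygons in general position. *)
Definition polygon_lk (R : realType) (P Q : seq 'rV[R]_3) : int :=
  \sum_(e <- cyclic_pairs P) \sum_(f <- cyclic_pairs Q)
    (if `[< crosses_over e f >] then sgz (shadow_det e f) else 0).

(** The linking number of disjoint closed curves that are only continuous is the
    common linking number of all sufficiently close pairs of polygons in general
    position.  (Such polygons exist at every distance, and by homotopy invariance
    they all have the same linking number once the distance is less than half
    the distance between the curves; so [is_lk c d] holds of exactly one integer.) *)

Definition uniformly_close (R : realType) (eps : R) (c d : R -> 'rV[R]_3) : Prop :=
  forall t, unit_itv t -> `|c t - d t| < eps.

Definition is_lk (R : realType) (c d : R -> 'rV[R]_3) (k : int) : Prop :=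
  exists2 eps : R, 0 < eps &
    forall P Q : seq 'rV[R]_3, P != [::] -> Q != [::] ->
      uniformly_close eps (polygon P) c -> uniformly_close eps (polygon Q) d ->
      general_position P Q -> polygon_lk P Q = k.

Definition Lk (R : realType) (c d : R -> 'rV[R]_3) : int :=
  xget 0 [set k : int | is_lk c d k]%classic.

(** Theta curves.  The edges are three arcs [e i], all directed from the first
    vertex to the second one.  Injectivity and continuity on a compact set make
    the map an embedding. *)

Record theta_embedding (R : realType) (e : 'I_3 -> R -> 'rV[R]_3) : Prop := {
  theta_cont : forall i, {within unit_itv, continuous (e i)}%classic ;
  theta_src : forall i j, e i 0 = e j 0 ;
  theta_tgt : forall i j, e i 1 = e j 1 ;
  theta_inj : forall i j s t, unit_itv s -> unit_itv t -> e i s = e j t ->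
    s = t /\ [\/ i = j, s = 0 | s = 1]
}.

(** An oriented cycle of a theta curve is a pair [(i, j)] with [i != j]: it runs
    along the i-th edge and returns along the j-th one. *)

Definition is_theta_cycle (c : 'I_3 * 'I_3) : bool := c.1 != c.2.

Definition theta_curve (R : realType) (e : 'I_3 -> R -> 'rV[R]_3)
    (c : 'I_3 * 'I_3) : R -> 'rV[R]_3 :=
  concat_paths [:: e c.1; rev_path (e c.2)].

(* As a graph has no 2-cells, H_1 is the group of cycles inside the group of
   1-chains, here Z^3.  If three oriented cycles have classes that add up to 0,
   they run along the three different cycles of the theta curve, since each
   class is a difference of two distinct basis vectors. *)
Definition theta_class (c : 'I_3 * 'I_3) : 'rV[int]_3 :=
  delta_mx 0 c.1 - delta_mx 0 c.2.

Definition theta_rev (b : bool) (c : 'I_3 * 'I_3) : 'I_3 * 'I_3 :=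
  if b then (c.2, c.1) else c.

(** Complete graphs.  [v] gives the vertices and [a i j], for [i != j], the edge
    between them traversed from [v i] to [v j]; the values [a i i] are irrelevant. *)

Record complete_embedding (R : realType) (n : nat)
    (v : 'I_n -> 'rV[R]_3) (a : 'I_n -> 'I_n -> R -> 'rV[R]_3) : Prop := {
  complete_cont : forall i j, i != j -> {within unit_itv, continuous (a i j)}%classic ;
  complete_src : forall i j, i != j -> a i j 0 = v i ;
  complete_tgt : forall i j, i != j -> a i j 1 = v j ;
  complete_rev : forall i j t, i != j -> unit_itv t ->
    a j i t = rev_path (a i j) t ;
  complete_vinj : injective v ;
  complete_inj : forall i j k l s t, i != j -> k != l ->
    unit_itv s -> unit_itv t -> a i j s = a k l t ->
    [\/ [/\ i = k, j = l & s = t], [/\ i = l, j = k & s = 1 - t] |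
        (s = 0 \/ s = 1) /\ (t = 0 \/ t = 1)]
}.

Definition is_complete_cycle (n : nat) (s : seq 'I_n) : bool :=
  uniq s && (2 < size s)%N.

Definition complete_curve (R : realType) (n : nat)
    (a : 'I_n -> 'I_n -> R -> 'rV[R]_3) (s : seq 'I_n) : R -> 'rV[R]_3 :=
  concat_paths [seq a p.1 p.2 | p <- cyclic_pairs s].

Definition disjointly_embedded (R : realType) (n : nat)
    (e : 'I_3 -> R -> 'rV[R]_3) (a : 'I_n -> 'I_n -> R -> 'rV[R]_3) : Prop :=
  forall i j k s t, j != k -> unit_itv s -> unit_itv t -> e i s <> a j k t.

(** Linking of the two graphs. *)

Definition linked (R : realType) (c d : R -> 'rV[R]_3) : Prop := Lk c d != 0.

Definition strongly_linked (R : realType) (c d : R -> 'rV[R]_3) : Prop :=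
  2 <= `|Lk c d|.

Definition weakly_linked (R : realType) (n : nat)
    (e : 'I_3 -> R -> 'rV[R]_3) (a : 'I_n -> 'I_n -> R -> 'rV[R]_3) : Prop :=
  (exists c s, [/\ is_theta_cycle c, is_complete_cycle s &
     linked (theta_curve e c) (complete_curve a s)]) /\
  (forall c s, is_theta_cycle c -> is_complete_cycle s ->
     ~ strongly_linked (theta_curve e c) (complete_curve a s)).

(* {p}, O, I is a partition of the vertices in which O or I may be empty. *)
Definition star_partition (n : nat) (p : 'I_n) (O I : {set 'I_n}) : Prop :=
  [disjoint O & I] /\ O :|: I = [set~ p].

(* Whether the oriented triangle xyz, up to rotation, is pqr with q in O and
   r in I. *)
Definition in_star (n : nat) (p : 'I_n) (O I : {set 'I_n}) (x y z : 'I_n) : bool :=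
  [|| [&& x == p, y \in O & z \in I],
      [&& y == p, z \in O & x \in I] |
      [&& z == p, x \in O & y \in I]].

Definition links_in_star (R : realType) (n : nat)
    (a : 'I_n -> 'I_n -> R -> 'rV[R]_3) (c : R -> 'rV[R]_3)
    (p : 'I_n) (O I : {set 'I_n}) : Prop :=
  star_partition p O I /\
  forall x y z, uniq [:: x; y; z] ->
    Lk c (complete_curve a [:: x; y; z]) =
      if in_star p O I x y z then 1
      else if in_star p O I z y x then -1
      else 0.

Definition common_vertex (R : realType) (n : nat)
    (e : 'I_3 -> R -> 'rV[R]_3) (a : 'I_n -> 'I_n -> R -> 'rV[R]_3)
    (p : 'I_n) : Prop :=
  forall x y z c, uniq [:: x; y; z] -> is_theta_cycle c ->
    linked (theta_curve e c) (complete_curve a [:: x; y; z]) ->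
    p \in [:: x; y; z].

(** In both cases one boolean [b] for all [i] says whether the orientation of the
    theta curve is reversed. *)

Definition case_A1 (R : realType) (n : nat)
    (e : 'I_3 -> R -> 'rV[R]_3) (a : 'I_n -> 'I_n -> R -> 'rV[R]_3)
    (C : 'I_3 -> 'I_3 * 'I_3) : Prop :=
  (exists p, common_vertex e a p) /\
  forall p, common_vertex e a p ->
    exists I : 'I_3 -> {set 'I_n},
      [/\ forall i j, i != j -> [disjoint I i & I j],
          forall i j, I i = finset.set0 -> I j = finset.set0 -> i = j,
          (\bigcup_i I i) = [set~ p] &
          exists b : bool, forall i,
            links_in_star a (theta_curve e (theta_rev b (C i)))
              p (\bigcup_(j | j != i) I j) (I i)].

Definition case_A2 (R : realType) (n : nat)
    (e : 'I_3 -> R -> 'rV[R]_3) (a : 'I_n -> 'I_n -> R -> 'rV[R]_3)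
    (C : 'I_3 -> 'I_3 * 'I_3) : Prop :=
  [/\ ~ (exists p, common_vertex e a p),
      (5 <= n)%N &
      exists p : 'I_3 -> 'I_n,
        injective p /\
        exists b : bool, forall i,
          links_in_star a (theta_curve e (theta_rev b (C i)))
            (p i) [set p j | j in [set~ i]]
            (~: [set p j | j in [set: 'I_3]])].

(* Main.v *)
From mathcomp Require Import ring lra zify.
Require Import Defs.
Set Implicit Arguments.
Unset Strict Implicit.
Unset Printing Implicit Defensive.
Import Order.TTheory GRing.Theory Num.Theory.
Import numFieldNormedType.Exports.
Local Open Scope ring_scope.

(** The crossing number of a closed polygon with the boundary of a solid triangle that it misses
    vanishes: it telescopes along the polygon, because the number of times the triangle covers a
    point from above is a primitive of it.  Hence crossing numbers of polygons do not change under
    small homotopies of either polygon, [Lk] can be computed by sampling the curves finely in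
    general position, and it is additive over the edges of both graphs: each oriented cycle [C_i]
    yields an antisymmetric integer function [y_i] on the oriented edges of [K_n] whose sums along
    the cycles of [K_n] are the linking numbers, with [y_1 + y_2 + y_3 = 0].

    Weak linking says that these sums lie in [{-1, 0, 1}].  Cycles of length at most 6 then show
    that for each [i] the triangles with nonzero value have a common vertex [p_i]: no two of them
    are disjoint, and none shares each of its three edges with a further one.  If one [p] serves
    for all [i], then [y_i] is described by a potential with at most two values, the three
    potentials add up to a constant, and (A1) follows.  Otherwise no vertex is common to two of
    the stars, every triangle of a star contains two of the centers [p_1, p_2, p_3], since its
    value is cancelled by that of another [y_j], and (A2) follows. *)

(** [Lk] picks, by [xget], an integer satisfying [is_lk], so nothing can be computed from it before
    two facts are known: close polygons in general position exist at every distance, and all of them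
    give the same number. The obstacle to the second fact is that a homotopy of polygons meets
    degenerate shadows. It is avoided by never moving anything continuously: the ladder between two
    polygons consists of finitely many triangles, whose corners are fixed first; afterwards one tiny
    shift of one of the two curves makes all pairs of segments between these corners generic, while
    leaving the crossing numbers at both ends unchanged. The same order of choices gives additivity.
    The crossing number of two open arcs is not an invariant, but as the graphs are finite, one
    sampling density and one shift serve for all their cycles simultaneously, and the linking
    numbers become sums of one fixed function of pairs of edges. From there on only integers remain:
    1-cochains on [K_n], of which only the sums round cycles matter and whose bounds on short cycles
    are left to linear arithmetic. *)

Lemma segment_coord (R : realType) (e : 'rV[R]_3 * 'rV[R]_3) (s : R) (k : 'I_3) :
  segment e s 0 k = (1 - s) * e.1 0 k + s * e.2 0 k.
Proof. by rewrite /segment !mxE. Qed.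

Lemma shadow_detE (R : realType) (e f : 'rV[R]_3 * 'rV[R]_3) :
  shadow_det e f = (e.2 0 0 - e.1 0 0) * (f.2 0 1 - f.1 0 1)
    - (e.2 0 1 - e.1 0 1) * (f.2 0 0 - f.1 0 0).
Proof. by rewrite /shadow_det /= !mxE. Qed.

Definition orient (R : realType) (a b p : 'rV[R]_3) : R := shadow_det (a, b) (a, p).

(* Stronger than general position, and algebraic in the endpoints; distinct first coordinates
   make the vertical rays used below transverse to all edges. *)
Definition generic_pair (R : realType) (e f : 'rV[R]_3 * 'rV[R]_3) : Prop :=
  [/\ [/\ e.1 0 0 != f.1 0 0, e.1 0 0 != f.2 0 0, e.2 0 0 != f.1 0 0 &
          e.2 0 0 != f.2 0 0],
      ~ same_shadow e.1 e.2 -> orient e.1 e.2 f.1 != 0 /\ orient e.1 e.2 f.2 != 0 &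
      ~ same_shadow f.1 f.2 -> orient f.1 f.2 e.1 != 0 /\ orient f.1 f.2 e.2 != 0].

Definition shadows_meet (R : realType) (e f : 'rV[R]_3 * 'rV[R]_3) : Prop :=
  exists s t : R, [/\ unit_itv s, unit_itv t & same_shadow (segment e s) (segment f t)].

Lemma unit_itvE (R : realType) (s : R) : unit_itv s <-> 0 <= s <= 1.
Proof. by rewrite /unit_itv /= in_itv. Qed.

Lemma unit_itv_interior (R : realType) (s : R) :
  0 <= s <= 1 -> s != 0 -> s != 1 -> 0 < s < 1.
Proof.
by move=> /andP[s0 s1] n0 n1; rewrite !lt_neqAle eq_sym n0 n1 s0.
Qed.

(** Parallel shadows that meet lie on one line, which puts an endpoint of one edge on the line of
    the other, or makes two point shadows coincide. Once the shadows are transverse, a parameter 0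
    or 1 would again put an endpoint on the other line. *)
Lemma generic_pair_position (R : realType) (e f : 'rV[R]_3 * 'rV[R]_3) (s t : R) :
  generic_pair e f -> unit_itv s -> unit_itv t ->
  same_shadow (segment e s) (segment f t) ->
  [/\ 0 < s < 1, 0 < t < 1 & shadow_det e f != 0].
Proof.
case: e f => [a b] [p q] [/= [hap haq hbp hbq] he hf] /unit_itvE hs /unit_itvE ht.
move=> [h0 h1]; rewrite !segment_coord /= in h0 h1.
have hd : shadow_det (a, b) (p, q) != 0.
  apply/eqP; rewrite /shadow_det /= !mxE => hd.
  case: (pselect (same_shadow a b)) => [[a0 a1]|nab].
    case: (pselect (same_shadow p q)) => [[p0 p1]|npq]; first by move/eqP: hap; nra.
    have [/eqP + _] := hf npq; apply.
    rewrite /orient /shadow_det /= !mxE.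
    have -> : a 0 0 = (1 - s) * a 0 0 + s * b 0 0 by rewrite a0; ring.
    have -> : a 0 1 = (1 - s) * a 0 1 + s * b 0 1 by rewrite a1; ring.
    rewrite h0 h1; ring.
  have [/eqP + _] := he nab; apply.
  rewrite /orient /shadow_det /= !mxE.
  transitivity ((b 0 0 - a 0 0) * ((1 - t) * p 0 1 + t * q 0 1 - a 0 1)
       - (b 0 1 - a 0 1) * ((1 - t) * p 0 0 + t * q 0 0 - a 0 0)
    - t * ((b 0 0 - a 0 0) * (q 0 1 - p 0 1) - (b 0 1 - a 0 1) * (q 0 0 - p 0 0))); first by ring.
  rewrite hd -h0 -h1; ring.
have nab : ~ same_shadow a b.
  by move=> [a0 a1]; move/eqP: hd; apply; rewrite /shadow_det /= !mxE a0 a1; ring.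
have npq : ~ same_shadow p q.
  by move=> [a0 a1]; move/eqP: hd; apply; rewrite /shadow_det /= !mxE a0 a1; ring.
have [/eqP eap /eqP eaq] := he nab.
have [/eqP epa /eqP epb] := hf npq.
move: eap eaq epa epb; rewrite /orient /shadow_det /= !mxE => eap eaq epa epb.
have s0 : s != 0.
  apply/eqP => s0; apply: epa; rewrite s0 in h0 h1.
  have -> : a 0 0 = (1 - t) * p 0 0 + t * q 0 0 by lra.
  have -> : a 0 1 = (1 - t) * p 0 1 + t * q 0 1 by lra.
  ring.
have s1 : s != 1.
  apply/eqP => s1; apply: epb; rewrite s1 in h0 h1.
  have -> : b 0 0 = (1 - t) * p 0 0 + t * q 0 0 by lra.
  have -> : b 0 1 = (1 - t) * p 0 1 + t * q 0 1 by lra.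
  ring.
have t0 : t != 0.
  apply/eqP => t0; apply: eap; rewrite t0 in h0 h1.
  have -> : p 0 0 = (1 - s) * a 0 0 + s * b 0 0 by lra.
  have -> : p 0 1 = (1 - s) * a 0 1 + s * b 0 1 by lra.
  ring.
have t1 : t != 1.
  apply/eqP => t1; apply: eaq; rewrite t1 in h0 h1.
  have -> : q 0 0 = (1 - s) * a 0 0 + s * b 0 0 by lra.
  have -> : q 0 1 = (1 - s) * a 0 1 + s * b 0 1 by lra.
  ring.
split.
- exact: unit_itv_interior.
- exact: unit_itv_interior.
- by move: hd; rewrite /shadow_det /= !mxE.
Qed.

(** * Crossings in the plane *)

Definition shadow_over (R : realType) (e f : 'rV[R]_3 * 'rV[R]_3) : Prop :=
  exists s t : R, [/\ unit_itv s, unit_itv t,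
    segment e s 0 0 = segment f t 0 0 & segment f t 0 1 < segment e s 0 1].

(** Equal to 1 if [a < x <= b], to -1 if [b < x <= a], and to 0 otherwise. Being a coboundary in [a]
    and [b], it adds up to 0 round every closed polygon, even if [x] is the coordinate of a
    corner. *)
Definition between (R : realType) (a b x : R) : int := (a < x)%R%:Z - (b < x)%R%:Z.

(* Signed crossing of the shadow of [e] with the ray going up from [p] in the shadow plane;
   [coray_sign] is the same with the ray going down from [a] and the edge [f]. *)
Definition ray_sign (R : realType) (e : 'rV[R]_3 * 'rV[R]_3) (p : 'rV[R]_3) : int :=
  between (e.1 0 0) (e.2 0 0) (p 0 0) *+ `[< shadow_over e (p, p) >].

Definition coray_sign (R : realType) (a : 'rV[R]_3) (f : 'rV[R]_3 * 'rV[R]_3) : int :=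
  between (f.1 0 0) (f.2 0 0) (a 0 0) *+ `[< shadow_over (a, a) f >].

Definition shadow_sign (R : realType) (e f : 'rV[R]_3 * 'rV[R]_3) : int :=
  sgz (shadow_det e f) *+ `[< shadows_meet e f >].

Lemma segment_affine (R : realType) (e : 'rV[R]_3 * 'rV[R]_3) (s s' l : R) k :
  segment e ((1 - l) * s + l * s') 0 k =
  (1 - l) * segment e s 0 k + l * segment e s' 0 k.
Proof. by rewrite !segment_coord; ring. Qed.

Lemma unit_itv_convex (R : realType) (s s' l : R) :
  unit_itv s -> unit_itv s' -> unit_itv l -> unit_itv ((1 - l) * s + l * s').
Proof. by rewrite !unit_itvE => *; nra. Qed.

Lemma affine_zero (R : realType) (x y : R) : x < 0 -> 0 < y ->
  exists2 l, unit_itv l & (1 - l) * x + l * y = 0.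
Proof.
move=> x0 y0; have d0 : y - x != 0 by lra.
exists (- x / (y - x)); last by field.
by rewrite unit_itvE ler_pdivlMr ?ler_pdivrMr; lra.
Qed.

(** Convexity: move linearly from a pair of points with [e] over [f] to a pair with [f] over [e].
    The first coordinates stay equal, and the second ones agree at some moment, where the shadows
    meet. *)
Lemma shadows_disjoint (R : realType) (e f : 'rV[R]_3 * 'rV[R]_3) :
  ~ shadows_meet e f -> shadow_over e f -> ~ shadow_over f e.
Proof.
move=> nm [s [t [hs ht h0 h1]]] [t' [s' [ht' hs' h0' h1']]]; apply: nm.
have [l hl hz] := @affine_zero _ (segment f t 0 1 - segment e s 0 1)
  (segment f t' 0 1 - segment e s' 0 1) ltac:(lra) ltac:(lra).
exists ((1 - l) * s + l * s'), ((1 - l) * t + l * t').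
split; [exact: unit_itv_convex..|].
by split; rewrite !segment_affine ?h0 ?h0' //; lra.
Qed.

Lemma segment_at (R : realType) (a b : 'rV[R]_3) (x : R) :
  between (a 0 0) (b 0 0) x != 0 -> exists2 s, unit_itv s & segment (a, b) s 0 0 = x.
Proof.
rewrite /between => h.
have nab : b 0 0 - a 0 0 != 0.
  by apply: contraNneq h => /eqP; rewrite subr_eq0 => /eqP ->; rewrite subrr.
exists ((x - a 0 0) / (b 0 0 - a 0 0)); last by rewrite segment_coord /=; field.
move: h; rewrite unit_itvE.
case: (ltrP (a 0 0) x) => h1; case: (ltrP (b 0 0) x) => h2 // _.
  have d : 0 < b 0 0 - a 0 0 by lra.
  by rewrite ler_pdivlMr ?ler_pdivrMr; lra.
have d : b 0 0 - a 0 0 < 0 by lra.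
by rewrite ler_ndivlMr ?ler_ndivrMr; lra.
Qed.

Lemma segment_const (R : realType) (p : 'rV[R]_3) (t : R) : segment (p, p) t = p.
Proof. by rewrite /segment /= -scalerDl subrK scale1r. Qed.

Lemma segment0 (R : realType) (e : 'rV[R]_3 * 'rV[R]_3) : segment e 0 = e.1.
Proof. by rewrite /segment subr0 scale1r scale0r addr0. Qed.

Lemma segment1 (R : realType) (e : 'rV[R]_3 * 'rV[R]_3) : segment e 1 = e.2.
Proof. by rewrite /segment subrr scale1r scale0r add0r. Qed.

Lemma unit_itv0 (R : realType) : unit_itv (0 : R).
Proof. by rewrite unit_itvE lexx ler01. Qed.

Lemma unit_itv1 (R : realType) : unit_itv (1 : R).
Proof. by rewrite unit_itvE lexx ler01. Qed.

Lemma between_over (R : realType) (e : 'rV[R]_3 * 'rV[R]_3) (p : 'rV[R]_3) :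
  between (e.1 0 0) (e.2 0 0) (p 0 0) != 0 ->
  [\/ shadow_over e (p, p), shadow_over (p, p) e | shadows_meet e (p, p)].
Proof.
case: e => a b /segment_at [s hs hx].
have h0 := @unit_itv0 R.
case: (ltrgtP (segment (a, b) s 0 1) (p 0 1)) => h.
- by apply: Or32; exists 0, s; split; rewrite // ?segment_const.
- by apply: Or31; exists s, 0; split; rewrite // ?segment_const.
- by apply: Or33; exists s, 0; split => //; split; rewrite // ?segment_const.
Qed.

Lemma shadow_over_sub (R : realType) (e e' f f' : 'rV[R]_3 * 'rV[R]_3) :
  (forall s, unit_itv s -> exists2 s', unit_itv s' & segment e s = segment e' s') ->
  (forall s, unit_itv s -> exists2 s', unit_itv s' & segment f s = segment f' s') ->
  shadow_over e f -> shadow_over e' f'.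
Proof.
move=> he hf [s [t [/he [s' hs' ->] /hf [t' ht' ->] h0 h1]]].
by exists s', t'.
Qed.

Lemma shadows_meet_sub (R : realType) (e e' f f' : 'rV[R]_3 * 'rV[R]_3) :
  (forall s, unit_itv s -> exists2 s', unit_itv s' & segment e s = segment e' s') ->
  (forall s, unit_itv s -> exists2 s', unit_itv s' & segment f s = segment f' s') ->
  shadows_meet e f -> shadows_meet e' f'.
Proof.
move=> he hf [s [t [/he [s' hs' ->] /hf [t' ht' ->] h]]].
by exists s', t'.
Qed.

Lemma endpoint_sub (R : realType) (e : 'rV[R]_3 * 'rV[R]_3) (p : 'rV[R]_3) :
  p = e.1 \/ p = e.2 ->
  forall s, unit_itv s -> exists2 s', unit_itv s' & segment (p, p) s = segment e s'.
Proof.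
move=> h s _; rewrite segment_const; case: h => ->.
  by exists 0; [exact: unit_itv0 | rewrite segment0].
by exists 1; [exact: unit_itv1 | rewrite segment1].
Qed.

Lemma self_sub (R : realType) (e : 'rV[R]_3 * 'rV[R]_3) :
  forall s, unit_itv s -> exists2 s', unit_itv s' & segment e s = segment e s'.
Proof. by move=> s hs; exists s. Qed.

Lemma ray_sign_over (R : realType) (e f : 'rV[R]_3 * 'rV[R]_3) (p : 'rV[R]_3) :
  p = f.1 \/ p = f.2 -> ~ shadows_meet e f -> ~ shadow_over f e ->
  ray_sign e p = between (e.1 0 0) (e.2 0 0) (p 0 0).
Proof.
move=> hp nm no; rewrite /ray_sign.
have [->|/eqP h] := eqVneq (between (e.1 0 0) (e.2 0 0) (p 0 0)) 0; first by rewrite mul0rn.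
case: asboolP => // h1; case: (between_over (introN eqP h)) => // h2.
  by case: no; move: h2; apply: shadow_over_sub; [exact: endpoint_sub | exact: self_sub].
by case: nm; move: h2; apply: shadows_meet_sub; [exact: self_sub | exact: endpoint_sub].
Qed.

Lemma ray_sign_under (R : realType) (e f : 'rV[R]_3 * 'rV[R]_3) (p : 'rV[R]_3) :
  p = f.1 \/ p = f.2 -> ~ shadow_over e f -> ray_sign e p = 0.
Proof.
move=> hp no; rewrite /ray_sign; case: asboolP => // h; case: no; move: h.
by apply: shadow_over_sub; [exact: self_sub | exact: endpoint_sub].
Qed.

Lemma shadows_meet_sym (R : realType) (e f : 'rV[R]_3 * 'rV[R]_3) :
  shadows_meet e f -> shadows_meet f e.
Proof. by move=> [s [t [hs ht [h0 h1]]]]; exists t, s. Qed.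

Lemma coray_sign_over (R : realType) (e f : 'rV[R]_3 * 'rV[R]_3) (a : 'rV[R]_3) :
  a = e.1 \/ a = e.2 -> ~ shadows_meet e f -> ~ shadow_over f e ->
  coray_sign a f = between (f.1 0 0) (f.2 0 0) (a 0 0).
Proof.
move=> ha nm no; rewrite /coray_sign.
have [->|/eqP h] := eqVneq (between (f.1 0 0) (f.2 0 0) (a 0 0)) 0; first by rewrite mul0rn.
case: asboolP => // h1; case: (between_over (introN eqP h)) => // h2.
  by case: no; move: h2; apply: shadow_over_sub; [exact: self_sub | exact: endpoint_sub].
case: nm; apply: shadows_meet_sym; move: h2.
by apply: shadows_meet_sub; [exact: self_sub | exact: endpoint_sub].
Qed.

Lemma coray_sign_under (R : realType) (e f : 'rV[R]_3 * 'rV[R]_3) (a : 'rV[R]_3) :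
  a = e.1 \/ a = e.2 -> ~ shadow_over e f -> coray_sign a f = 0.
Proof.
move=> hp no; rewrite /coray_sign; case: asboolP => // h; case: no; move: h.
by apply: shadow_over_sub; [exact: endpoint_sub | exact: self_sub].
Qed.

Lemma orientE (R : realType) (a b p : 'rV[R]_3) :
  orient a b p = (b 0 0 - a 0 0) * (p 0 1 - a 0 1) - (b 0 1 - a 0 1) * (p 0 0 - a 0 0).
Proof. by rewrite /orient /shadow_det /= !mxE. Qed.

Lemma orient_at (R : realType) (a b p : 'rV[R]_3) (s : R) :
  segment (a, b) s 0 0 = p 0 0 ->
  orient a b p = (b 0 0 - a 0 0) * (p 0 1 - segment (a, b) s 0 1).
Proof. by rewrite orientE !segment_coord /= => <-; ring. Qed.

(** Where [between] is nonzero, [orient_at] shows that the product with [b 0 0 - a 0 0] has the sign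
    of the second coordinate of [p] minus that of the point of the edge on the vertical through [p].
    This trades the existential in [ray_sign] for a determinant that can be compared with
    [shadow_det]. *)
Lemma ray_signE (R : realType) (a b p : 'rV[R]_3) :
  a 0 0 != p 0 0 -> b 0 0 != p 0 0 ->
  ray_sign (a, b) p =
  between (a 0 0) (b 0 0) (p 0 0) *+ (orient a b p * (b 0 0 - a 0 0) < 0)%R.
Proof.
move=> hap hbp; rewrite /ray_sign /=.
have [->|h] := eqVneq (between (a 0 0) (b 0 0) (p 0 0)) 0; first by rewrite !mul0rn.
have [s hs hx] := segment_at h; rewrite (orient_at hx).
have d2 : 0 < (b 0 0 - a 0 0) ^+ 2.
  rewrite exprn_even_gt0 //= subr_eq0; apply: contraNneq h => ->.
  by rewrite /between subrr.
have -> : ((b 0 0 - a 0 0) * (p 0 1 - segment (a, b) s 0 1) * (b 0 0 - a 0 0) < 0)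
   = (p 0 1 < segment (a, b) s 0 1).
  by rewrite mulrAC -expr2 pmulr_rlt0 // subr_lt0.
congr (_ *+ nat_of_bool _); apply/asboolP/idP => [[s' [t [hs' ht h0 h1]]]|h1].
  rewrite segment_const in h0 h1.
  have := orient_at hx; rewrite (orient_at h0) => /mulfI.
  by move: d2; rewrite exprn_even_gt0 //= => d2 /(_ d2); lra.
by exists s, 0; split; rewrite ?segment_const //; exact: unit_itv0.
Qed.

Lemma coray_signE (R : realType) (p q a : 'rV[R]_3) :
  p 0 0 != a 0 0 -> q 0 0 != a 0 0 ->
  coray_sign a (p, q) =
  between (p 0 0) (q 0 0) (a 0 0) *+ (0 < orient p q a * (q 0 0 - p 0 0))%R.
Proof.
move=> hap hbp; rewrite /coray_sign /=.
have [->|h] := eqVneq (between (p 0 0) (q 0 0) (a 0 0)) 0; first by rewrite !mul0rn.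
have [s hs hx] := segment_at h; rewrite (orient_at hx).
have d2 : 0 < (q 0 0 - p 0 0) ^+ 2.
  rewrite exprn_even_gt0 //= subr_eq0; apply: contraNneq h => ->.
  by rewrite /between subrr.
have -> : (0 < (q 0 0 - p 0 0) * (a 0 1 - segment (p, q) s 0 1) * (q 0 0 - p 0 0))
   = (segment (p, q) s 0 1 < a 0 1).
  by rewrite mulrAC -expr2 pmulr_rgt0 // subr_gt0.
congr (_ *+ nat_of_bool _); apply/asboolP/idP => [[t [s' [ht hs' h0 h1]]]|h1].
  rewrite segment_const in h0 h1.
  have := orient_at hx; rewrite (orient_at (esym h0)) => /mulfI.
  by move: d2; rewrite exprn_even_gt0 //= => d2 /(_ d2); lra.
by exists 0, s; split; rewrite ?segment_const //; exact: unit_itv0.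
Qed.

Lemma interior_between (R : realType) (s x y m : R) :
  0 < s < 1 -> (1 - s) * x + s * y = m ->
  [\/ x < m /\ m < y, y < m /\ m < x | x = m /\ y = m].
Proof.
move=> hs <-.
case: (ltrgtP x y) => h; [apply: Or31 | apply: Or32 | apply: Or33]; split; nra.
Qed.

Ltac rewrite_lt x y :=
  let f := fresh in (have f : x < y by lra); rewrite ?f ?(lt_gtF f); clear f.

(* The shadow of [f] and the vertical rays over its endpoints bound the region above [f]; the
   crossings of [e] with this boundary are balanced by the endpoints of [e] inside. *)
Lemma shadow_sign_boundary (R : realType) (a b p q : 'rV[R]_3) :
  generic_pair (a, b) (p, q) ->
  shadow_sign (a, b) (p, q) =
  ray_sign (a, b) p - ray_sign (a, b) q + coray_sign a (p, q) - coray_sign b (p, q).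
Proof.
move=> gen; have [[hap haq hbp hbq] _ _] := gen.
rewrite /= in hap haq hbp hbq.
rewrite /shadow_sign; case: asboolP => [[s [t [hs ht hst]]]|nm]; last first.
  rewrite mulr0n.
  case: (pselect (shadow_over (a, b) (p, q))) => ho; last first.
    rewrite !(@ray_sign_under _ _ (p, q)) //= ?(@coray_sign_under _ (a, b)) //=;
    by [left|right].
  have no := shadows_disjoint nm ho.
  rewrite !(@ray_sign_over _ _ (p, q)) //= ?(@coray_sign_over _ (a, b)) //=;
    try by [left|right].
  (* For distinct reals exactly one of [x < y] and [y < x] holds, so the four pairs of endpoints
     contribute 1 - 1 - 1 + 1 = 0. *)
  rewrite /between; move: hap haq hbp hbq.
  by do 4![case: ltrgtP => ? //=].
have [hs' ht' hd] := generic_pair_position gen hs ht hst.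
rewrite mulr1n.
rewrite shadow_detE /= in hd *.
rewrite !ray_signE ?coray_signE //; try by rewrite eq_sym.
case: hst => h0 h1; rewrite !segment_coord /= in h0 h1.
set d := (X in sgz X); rewrite -/d in hd.
(* The crossing point lies on the line of [a] and [b], and [p] is that point minus [t] times
   [q - p]. The other three endpoints are treated alike, so all four orientations have the sign of
   [d] or of [- d]. *)
have -> : orient a b p = - t * d.
  rewrite orientE; have -> : p 0 0 = (1 - s) * a 0 0 + s * b 0 0 - t * (q 0 0 - p 0 0).
    by rewrite h0; ring.
  have -> : p 0 1 = (1 - s) * a 0 1 + s * b 0 1 - t * (q 0 1 - p 0 1).
    by rewrite h1; ring.
  by rewrite /d; ring.
have -> : orient a b q = (1 - t) * d.
  rewrite orientE; have -> : q 0 0 = (1 - s) * a 0 0 + s * b 0 0 + (1 - t) * (q 0 0 - p 0 0).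
    by rewrite h0; ring.
  have -> : q 0 1 = (1 - s) * a 0 1 + s * b 0 1 + (1 - t) * (q 0 1 - p 0 1).
    by rewrite h1; ring.
  by rewrite /d; ring.
have -> : orient p q a = s * d.
  rewrite orientE; have -> : a 0 0 = (1 - t) * p 0 0 + t * q 0 0 - s * (b 0 0 - a 0 0).
    by rewrite -h0; ring.
  have -> : a 0 1 = (1 - t) * p 0 1 + t * q 0 1 - s * (b 0 1 - a 0 1).
    by rewrite -h1; ring.
  by rewrite /d; ring.
have -> : orient p q b = - (1 - s) * d.
  rewrite orientE; have -> : b 0 0 = (1 - t) * p 0 0 + t * q 0 0 + (1 - s) * (b 0 0 - a 0 0).
    by rewrite -h0; ring.
  have -> : b 0 1 = (1 - t) * p 0 1 + t * q 0 1 + (1 - s) * (b 0 1 - a 0 1).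
    by rewrite -h1; ring.
  by rewrite /d; ring.
have hm1 := interior_between hs' h0.
have hm2 := interior_between ht' (erefl ((1 - t) * p 0 0 + t * q 0 0)).
set m := (1 - t) * p 0 0 + t * q 0 0 in hm1 hm2.
have ts : (0 < t) * (0 < 1 - t) * (0 < s) * (0 < 1 - s).
  by rewrite !subr_gt0; case/andP: hs' => -> ->; case/andP: ht' => -> ->.
rewrite -!mulrA !mulNr !oppr_lt0 !oppr_gt0.
rewrite (pmulr_rgt0 _ ts.1.1.1) (pmulr_rlt0 _ ts.1.1.2) (pmulr_rgt0 _ ts.1.2)
  (pmulr_rlt0 _ ts.2).
clearbody d m; clear hs ht hs' ht' h0 h1 gen ts.
have -> : (d * (b 0 0 - a 0 0) < 0) = if 0 < d then b 0 0 < a 0 0 else a 0 0 < b 0 0.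
  by case: (ltrgtP 0 d) hd => // hd _; [rewrite pmulr_rlt0 | rewrite nmulr_rlt0];
    rewrite // ?subr_lt0 ?subr_gt0.
have -> : (0 < d * (b 0 0 - a 0 0)) = if 0 < d then a 0 0 < b 0 0 else b 0 0 < a 0 0.
  by case: (ltrgtP 0 d) hd => // hd _; [rewrite pmulr_rgt0 | rewrite nmulr_rgt0];
    rewrite // ?subr_lt0 ?subr_gt0.
have -> : (d * (q 0 0 - p 0 0) < 0) = if 0 < d then q 0 0 < p 0 0 else p 0 0 < q 0 0.
  by case: (ltrgtP 0 d) hd => // hd _; [rewrite pmulr_rlt0 | rewrite nmulr_rlt0];
    rewrite // ?subr_lt0 ?subr_gt0.
have -> : (0 < d * (q 0 0 - p 0 0)) = if 0 < d then p 0 0 < q 0 0 else q 0 0 < p 0 0.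
  by case: (ltrgtP 0 d) hd => // hd _; [rewrite pmulr_rgt0 | rewrite nmulr_rgt0];
    rewrite // ?subr_lt0 ?subr_gt0.
have -> : sgz d = if 0 < d then 1 else -1.
  by case: (ltrgtP 0 d) hd => // hd _; [rewrite gtr0_sgz | rewrite ltr0_sgz].
move: hap haq hbp hbq; rewrite /between; clear hd.
move: (0 < d) (a 0 0) (b 0 0) (p 0 0) (q 0 0) hm1 hm2 => {}d xa xb xp xq hm1 hm2.
(* Only the order of the first coordinates and the sign of the determinant are left. The third
   alternatives are vertical shadows; both cannot be vertical, as [a] and [p] would then share their
   first coordinate. *)
case: hm1 => [[h1 h2]|[h1 h2]|[h1 h2]]; case: hm2 => [[h3 h4]|[h3 h4]|[h3 h4]].
- rewrite_lt xa xb.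
  rewrite_lt xp xq.
  rewrite_lt xa xq.
  rewrite_lt xp xb.
  by case: (ltrgtP xa xp) => ?; case: (ltrgtP xb xq) => ?; case: d.
- rewrite_lt xa xb.
  rewrite_lt xq xp.
  rewrite_lt xa xp.
  rewrite_lt xq xb.
  by case: (ltrgtP xa xq) => ?; case: (ltrgtP xb xp) => ?; case: d.
- rewrite_lt xa xb.
  rewrite_lt xa xp.
  rewrite_lt xa xq.
  rewrite_lt xp xb.
  rewrite_lt xq xb.
  have -> : xq = xp by lra.
  rewrite ltxx.
  by  case: d.
- rewrite_lt xb xa.
  rewrite_lt xp xq.
  rewrite_lt xb xq.
  rewrite_lt xp xa.
  by case: (ltrgtP xa xq) => ?; case: (ltrgtP xb xp) => ?; case: d.
- rewrite_lt xb xa.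
  rewrite_lt xq xp.
  rewrite_lt xb xp.
  rewrite_lt xq xa.
  by case: (ltrgtP xa xp) => ?; case: (ltrgtP xb xq) => ?; case: d.
- rewrite_lt xb xa.
  rewrite_lt xb xp.
  rewrite_lt xb xq.
  rewrite_lt xp xa.
  rewrite_lt xq xa.
  have -> : xq = xp by lra.
  rewrite ltxx.
  by  case: d.
- rewrite_lt xp xq.
  rewrite_lt xa xq.
  rewrite_lt xb xq.
  rewrite_lt xp xa.
  rewrite_lt xp xb.
  have -> : xb = xa by lra.
  rewrite ltxx.
  by  case: d.
- rewrite_lt xq xp.
  rewrite_lt xa xp.
  rewrite_lt xb xp.
  rewrite_lt xq xa.
  rewrite_lt xq xb.
  have -> : xb = xa by lra.
  rewrite ltxx.
  by  case: d.
- by rewrite h1 h3 eqxx.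
Qed.

(** * Crossings with the boundary of a triangle *)

Lemma rV3_eq (R : realType) (x y : 'rV[R]_3) :
  same_shadow x y -> x 0 2 = y 0 2 -> x = y.
Proof.
move=> [h0 h1] h2; apply/rowP => -[[|[|[|//]]] hi].
- by rewrite (_ : Ordinal hi = 0) //; apply: val_inj.
- by rewrite (_ : Ordinal hi = 1) //; apply: val_inj.
- by rewrite (_ : Ordinal hi = 2) //; apply: val_inj.
Qed.

Lemma combo_coord (R : realType) (x y : 'rV[R]_3) (l : R) (k : 'I_3) :
  ((1 - l) *: x + l *: y) 0 k = (1 - l) * x 0 k + l * y 0 k.
Proof. by rewrite !mxE. Qed.

Definition cross_sign (R : realType) (e f : 'rV[R]_3 * 'rV[R]_3) : int :=
  if `[< crosses_over e f >] then sgz (shadow_det e f) else 0.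

Definition in_triangle (R : realType) (a b c x : 'rV[R]_3) : Prop :=
  exists u v w : R, [/\ [/\ 0 <= u, 0 <= v & 0 <= w], u + v + w = 1 &
    x = u *: a + v *: b + w *: c].

Lemma in_triangle_rot (R : realType) (a b c x : 'rV[R]_3) :
  in_triangle a b c x -> in_triangle b c a x.
Proof.
move=> [u [v [w [[hu hv hw] h ->]]]]; exists v, w, u; split; first by split.
  by rewrite -h; ring.
by rewrite -addrA addrC.
Qed.

Lemma in_triangle_edge (R : realType) (a b c : 'rV[R]_3) (s : R) :
  unit_itv s -> in_triangle a b c (segment (a, b) s).
Proof.
rewrite unit_itvE => hs; exists (1 - s), s, 0; split; first by split; lra.
  by ring.
by rewrite scale0r addr0.
Qed.

Lemma in_triangle_convex (R : realType) (a b c x y : 'rV[R]_3) (l : R) :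
  unit_itv l -> in_triangle a b c x -> in_triangle a b c y ->
  in_triangle a b c ((1 - l) *: x + l *: y).
Proof.
rewrite unit_itvE => hl [u [v [w [[hu hv hw] h ->]]]] [u' [v' [w' [[hu' hv' hw'] h' ->]]]].
exists ((1 - l) * u + l * u'), ((1 - l) * v + l * v'), ((1 - l) * w + l * w'); split.
- by split; nra.
- transitivity ((1 - l) * (u + v + w) + l * (u' + v' + w')); first by ring.
  by rewrite h h'; ring.
- by apply/rowP => i; rewrite !mxE; ring.
Qed.

Section Triangle.
Variables (R : realType) (a b c : 'rV[R]_3).
Local Notation T := (in_triangle a b c).

Definition winding_sign (p : 'rV[R]_3) : int :=
  ray_sign (a, b) p + ray_sign (b, c) p + ray_sign (c, a) p.

(* The signed number of times the triangle covers [p] from above; a primitive of the crossing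
   number with the boundary of the triangle. *)
Definition below_sign (p : 'rV[R]_3) : int :=
  winding_sign p *+ `[< exists2 x, T x & same_shadow x p /\ p 0 2 < x 0 2 >].

Lemma edge_in_triangle (e : 'rV[R]_3 * 'rV[R]_3) (s : R) :
  e \in [:: (a, b); (b, c); (c, a)] -> unit_itv s -> T (segment e s).
Proof.
rewrite !inE => /or3P[] /eqP -> hs; first exact: in_triangle_edge.
  by do 2 apply: in_triangle_rot; apply: in_triangle_edge.
by apply: in_triangle_rot; apply: in_triangle_edge.
Qed.

(** The shadow of the triangle is convex. If it misses [p], its part on the vertical through [p]
    lies wholly above or wholly below [p]: in the first case the ray signs are the three [between],
    which cancel round the triangle, in the second one they all vanish. *)
Lemma winding_sign_shadow (p : 'rV[R]_3) :
  winding_sign p != 0 -> exists2 x, T x & same_shadow x p.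
Proof.
apply: contraNP => /forall2NP no.
have {}no x : T x -> x 0 0 = p 0 0 -> x 0 1 != p 0 1.
  by move=> hx h0; apply/eqP => h1; case: (no x) => // -[].
case: (pselect (exists2 x, T x & x 0 0 = p 0 0 /\ p 0 1 < x 0 1)) => hup; last first.
  have z e : e \in [:: (a, b); (b, c); (c, a)] -> ray_sign e p = 0.
    move=> he; rewrite /ray_sign; case: asboolP => // -[s [t [hs _ h0 h1]]].
    case: hup; rewrite segment_const in h0 h1.
    by exists (segment e s); [exact: edge_in_triangle | split].
  by rewrite /winding_sign !z ?inE ?eqxx ?orbT.
have z e : e \in [:: (a, b); (b, c); (c, a)] ->
    ray_sign e p = between (e.1 0 0) (e.2 0 0) (p 0 0).
  move=> he; rewrite /ray_sign.
  have [->|h] := eqVneq (between (e.1 0 0) (e.2 0 0) (p 0 0)) 0; first by rewrite mul0rn.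
  case: asboolP => // nover; exfalso.
  have [s hs hx] : exists2 s, unit_itv s & segment e s 0 0 = p 0 0.
    by case: e h {he nover} => ? ?; exact: segment_at.
  have he' := edge_in_triangle he hs.
  have hlt : segment e s 0 1 < p 0 1.
    have := no _ he' hx; rewrite neq_lt => /orP[//|hgt]; case: nover.
    by exists s, 0; split; rewrite ?segment_const //; exact: unit_itv0.
  case: hup => x hx' [h0 h1].
  have [l hl hz] := @affine_zero _ (segment e s 0 1 - p 0 1) (x 0 1 - p 0 1)
    ltac:(lra) ltac:(lra).
  have /negP := no _ (in_triangle_convex hl he' hx') ltac:(rewrite combo_coord hx h0; ring).
  by apply; apply/eqP; rewrite combo_coord; lra.
rewrite /winding_sign !z ?inE ?eqxx ?orbT // /between /=.
by apply/eqP; ring.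
Qed.

(* As [f] misses the convex triangle, it is nowhere below it or nowhere above it.  In the first
   case both sides vanish; in the second one all crossings of the shadows count. *)
Lemma triangle_cross_sign (f : 'rV[R]_3 * 'rV[R]_3) :
  generic_pair (a, b) f -> generic_pair (b, c) f -> generic_pair (c, a) f ->
  (forall t, unit_itv t -> ~ T (segment f t)) ->
  cross_sign (a, b) f + cross_sign (b, c) f + cross_sign (c, a) f =
  below_sign f.1 - below_sign f.2.
Proof.
move=> gab gbc gca dis.
case: (pselect (exists2 x, T x & exists2 t, unit_itv t &
   same_shadow x (segment f t) /\ segment f t 0 2 < x 0 2)) => hup; last first.
  have z e : e \in [:: (a, b); (b, c); (c, a)] -> cross_sign e f = 0.
    move=> he; rewrite /cross_sign; case: asboolP => // -[s [t [hs ht h0 h1]]].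
    case: hup; exists (segment e s); first exact: edge_in_triangle.
    by exists t.
  have z' p t : unit_itv t -> p = segment f t -> below_sign p = 0.
    move=> ht ->; rewrite /below_sign; case: asboolP => // -[x hx hxp].
    by case: hup; exists x => //; exists t.
  rewrite !z ?inE ?eqxx ?orbT // (z' _ 0) ?segment0 ?(z' _ 1) ?segment1 //.
    exact: unit_itv1.
  exact: unit_itv0.
have up x t : T x -> unit_itv t -> same_shadow x (segment f t) -> segment f t 0 2 < x 0 2.
  move=> hx ht hs; case: hup => x' hx' [t' ht' [hs' hlt]].
  rewrite ltNge; apply/negP; rewrite le_eqVlt => /orP[/eqP heq|hgt].
    by apply: (dis t ht); rewrite -(rV3_eq hs heq).
  have [l hl hz] := @affine_zero _ (x 0 2 - segment f t 0 2) (x' 0 2 - segment f t' 0 2)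
    ltac:(lra) ltac:(lra).
  apply: (dis ((1 - l) * t + l * t')); first exact: unit_itv_convex.
  have -> : segment f ((1 - l) * t + l * t') = (1 - l) *: x + l *: x'.
    case: hs hs' => [h0 h1] [h0' h1'].
    apply: rV3_eq; first by split; rewrite segment_affine (combo_coord x x') ?h0 ?h0' ?h1 ?h1'.
    by rewrite segment_affine (combo_coord x x'); lra.
  exact: in_triangle_convex.
have z e : e \in [:: (a, b); (b, c); (c, a)] -> cross_sign e f = shadow_sign e f.
  move=> he; rewrite /cross_sign /shadow_sign.
  have -> : `[< crosses_over e f >] = `[< shadows_meet e f >].
    apply: asbool_equiv_eq; split => -[s [t]]; first by move=> [hs ht h _]; exists s, t.
    move=> [hs ht h]; exists s, t; split => //.
    by apply: up => //; exact: edge_in_triangle.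
  by case: asboolP.
have z' p t : unit_itv t -> p = segment f t -> below_sign p = winding_sign p.
  move=> ht hp; rewrite /below_sign.
  have [->|h] := eqVneq (winding_sign p) 0; first by rewrite mul0rn.
  case: asboolP => // -[]; have [x hx hxp] := winding_sign_shadow h.
  exists x => //; split => //.
  by rewrite hp; apply: up => //; rewrite -hp.
rewrite !z ?inE ?eqxx ?orbT // (z' _ 0) ?segment0 ?(z' _ 1) ?segment1 //;
  try exact: unit_itv1; try exact: unit_itv0.
case: f gab gbc gca {dis hup up z z'} => p q gab gbc gca.
(* The [coray_sign] terms telescope round the triangle, and the [ray_sign] terms collect into the
   winding signs of the two endpoints. *)
by rewrite !shadow_sign_boundary // /winding_sign; ring.
Qed.

End Triangle.

(** * Reversal, reflection, and sums round closed polygons *)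

Definition swap (T : Type) (e : T * T) : T * T := (e.2, e.1).

Lemma segment_swap (R : realType) (e : 'rV[R]_3 * 'rV[R]_3) (s : R) :
  segment (swap e) s = segment e (1 - s).
Proof. by rewrite /segment /= subKr addrC. Qed.

Lemma unit_itv_rev (R : realType) (s : R) : unit_itv s -> unit_itv (1 - s).
Proof. by rewrite !unit_itvE; lra. Qed.

Lemma shadow_det_swapl (R : realType) (e f : 'rV[R]_3 * 'rV[R]_3) :
  shadow_det (swap e) f = - shadow_det e f.
Proof. by rewrite /shadow_det /= !mxE; ring. Qed.

Lemma shadow_det_sym (R : realType) (e f : 'rV[R]_3 * 'rV[R]_3) :
  shadow_det f e = - shadow_det e f.
Proof. by rewrite /shadow_det /= !mxE; ring. Qed.

Lemma cross_sign_swapl (R : realType) (e f : 'rV[R]_3 * 'rV[R]_3) :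
  cross_sign (swap e) f = - cross_sign e f.
Proof.
rewrite /cross_sign shadow_det_swapl sgzN.
have sub e' : crosses_over e' f -> crosses_over (swap e') f.
  move=> [s [t [hs ht h0 h1]]]; exists (1 - s), t.
  by split; rewrite ?segment_swap ?subKr //; exact: unit_itv_rev.
have -> : `[< crosses_over (swap e) f >] = `[< crosses_over e f >].
  apply: asbool_equiv_eq; split => /sub //.
by case: asboolP; rewrite ?oppr0.
Qed.

(* The reflection exchanges over- and undercrossings, hence the two arguments of [cross_sign]. *)
Definition mirror (R : realType) (x : 'rV[R]_3) : 'rV[R]_3 :=
  \row_k (if k == 2 then - x 0 k else x 0 k).

Definition mirror_edge (R : realType) (e : 'rV[R]_3 * 'rV[R]_3) :=
  (mirror e.1, mirror e.2).

Lemma mirrorE (R : realType) (x : 'rV[R]_3) :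
  (mirror x 0 0 = x 0 0) * (mirror x 0 1 = x 0 1) * (mirror x 0 2 = - x 0 2).
Proof. by rewrite !mxE. Qed.

Lemma mirror_linear (R : realType) (x y : 'rV[R]_3) (s t : R) :
  mirror (s *: x + t *: y) = s *: mirror x + t *: mirror y.
Proof. by apply/rowP => k; rewrite !mxE; case: ifP => _; ring. Qed.

Lemma mirrorK (R : realType) : involutive (@mirror R).
Proof. by move=> x; apply/rowP => k; rewrite !mxE; case: (k == 2); rewrite ?opprK. Qed.

Lemma segment_mirror (R : realType) (e : 'rV[R]_3 * 'rV[R]_3) (s : R) :
  segment (mirror_edge e) s = mirror (segment e s).
Proof. by rewrite /segment mirror_linear. Qed.

Lemma shadow_det_mirror (R : realType) (e f : 'rV[R]_3 * 'rV[R]_3) :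
  shadow_det (mirror_edge e) (mirror_edge f) = shadow_det e f.
Proof. by rewrite /shadow_det /= !mxE. Qed.

Lemma same_shadow_mirror (R : realType) (x y : 'rV[R]_3) :
  same_shadow (mirror x) (mirror y) = same_shadow x y.
Proof. by rewrite /same_shadow !mirrorE. Qed.

Lemma generic_pair_mirror (R : realType) (e f : 'rV[R]_3 * 'rV[R]_3) :
  generic_pair e f -> generic_pair (mirror_edge e) (mirror_edge f).
Proof.
by rewrite /generic_pair /= !orientE !mirrorE !same_shadow_mirror.
Qed.

Lemma generic_pair_sym (R : realType) (e f : 'rV[R]_3 * 'rV[R]_3) :
  generic_pair e f -> generic_pair f e.
Proof. by move=> [[h1 h2 h3 h4] he hf]; split => //; split; rewrite eq_sym. Qed.

Lemma cross_sign_mirror (R : realType) (e f : 'rV[R]_3 * 'rV[R]_3) :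
  cross_sign (mirror_edge f) (mirror_edge e) = - cross_sign e f.
Proof.
rewrite /cross_sign shadow_det_mirror shadow_det_sym sgzN.
have -> : `[< crosses_over (mirror_edge f) (mirror_edge e) >] = `[< crosses_over e f >].
  apply: asbool_equiv_eq; split => -[s [t [hs ht hh h]]]; exists t, s; split => //;
    move: hh h; rewrite !segment_mirror ?same_shadow_mirror ?mirrorE ?ltrN2 //;
    by move=> [h0 h1]; split.
by case: asboolP; rewrite ?oppr0.
Qed.

Lemma cross_sign_swapr (R : realType) (e f : 'rV[R]_3 * 'rV[R]_3) :
  cross_sign e (swap f) = - cross_sign e f.
Proof.
apply: oppr_inj; rewrite -[LHS]cross_sign_mirror -(cross_sign_mirror e f).
exact: (cross_sign_swapl (mirror_edge f)).
Qed.

Lemma size_cyclic_pairs (T : Type) (s : seq T) : size (cyclic_pairs s) = size s.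
Proof. by rewrite size_zip size_rot minnn. Qed.

Lemma nth_cyclic_pairs (T : Type) (x0 : T) (s : seq T) (k : nat) : (k < size s)%N ->
  nth (x0, x0) (cyclic_pairs s) k = (nth x0 s k, nth x0 s (k.+1 %% size s)).
Proof.
move=> hk; rewrite /cyclic_pairs nth_zip ?size_rot //; congr pair.
rewrite /rot nth_cat size_drop.
case: s hk => [|x s] //= hk; rewrite subn1 /= drop0 take0.
case: ltnP => h; first by rewrite modn_small.
by have -> : k = size s by [lia]; rewrite subnn modnn.
Qed.

Lemma mem_cyclic_pairs (T : eqType) (s : seq T) (e : T * T) :
  e \in cyclic_pairs s -> (e.1 \in s) && (e.2 \in s).
Proof.
case: s => // x0 s; set s' := x0 :: s => /(nthP (x0, x0)) [k]; rewrite size_cyclic_pairs => hk <-.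
by rewrite nth_cyclic_pairs //= !mem_nth // ltn_mod.
Qed.

Lemma cyclic_pairs_map (T U : Type) (g : T -> U) (s : seq T) :
  cyclic_pairs (map g s) = [seq (g e.1, g e.2) | e <- cyclic_pairs s].
Proof.
rewrite /cyclic_pairs -map_rot.
by elim: s (rot 1 s) => [|x s IH] [|y s'] //=; rewrite IH.
Qed.

Lemma sum_cyclic_pairs (T : Type) (x0 : T) (s : seq T) (F : T * T -> int) :
  \sum_(e <- cyclic_pairs s) F e =
  \sum_(0 <= k < size s) F (nth x0 s k, nth x0 s (k.+1 %% size s)).
Proof.
rewrite (big_nth (x0, x0)) size_cyclic_pairs.
by apply: eq_big_nat => k /andP[_ hk]; rewrite nth_cyclic_pairs.
Qed.

Lemma sum_cyclic_coboundary (T : Type) (s : seq T) (g : T -> int) :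
  \sum_(e <- cyclic_pairs s) (g e.1 - g e.2) = 0.
Proof.
rewrite sumrB -(big_map fst predT g) -(big_map snd predT g).
rewrite -/(unzip1 _) -/(unzip2 _) unzip1_zip ?unzip2_zip ?size_rot //.
rewrite /rot big_cat /= addrC -big_cat /= cat_take_drop.
exact: subrr.
Qed.

Lemma sum_triangle_left (R : realType) (a b c : 'rV[R]_3) (Q : seq 'rV[R]_3) :
  (forall f, f \in cyclic_pairs Q ->
     [/\ generic_pair (a, b) f, generic_pair (b, c) f & generic_pair (c, a) f]) ->
  (forall f t, f \in cyclic_pairs Q -> unit_itv t -> ~ in_triangle a b c (segment f t)) ->
  \sum_(f <- cyclic_pairs Q) cross_sign (a, b) f +
  \sum_(f <- cyclic_pairs Q) cross_sign (b, c) f +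
  \sum_(f <- cyclic_pairs Q) cross_sign (c, a) f = 0.
Proof.
move=> gen dis; rewrite -!big_split /= -[RHS](sum_cyclic_coboundary Q (below_sign a b c)).
apply: eq_big_seq => f hf; have [g1 g2 g3] := gen f hf.
by apply: triangle_cross_sign => // t; exact: dis.
Qed.

Lemma in_triangle_mirror (R : realType) (a b c x : 'rV[R]_3) :
  in_triangle (mirror a) (mirror b) (mirror c) (mirror x) -> in_triangle a b c x.
Proof.
move=> [u [v [w [huvw h hx]]]]; exists u, v, w; split => //.
apply: (can_inj (@mirrorK R)); rewrite hx.
by rewrite -[u *: a + _]scale1r mirror_linear mirror_linear scale1r.
Qed.

(** The reflection moves the triangle to the left argument of [cross_sign], where
    [sum_triangle_left] applies. *)
Lemma sum_triangle_right (R : realType) (a b c : 'rV[R]_3) (P : seq 'rV[R]_3) :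
  (forall e, e \in cyclic_pairs P ->
     [/\ generic_pair e (a, b), generic_pair e (b, c) & generic_pair e (c, a)]) ->
  (forall e t, e \in cyclic_pairs P -> unit_itv t -> ~ in_triangle a b c (segment e t)) ->
  \sum_(e <- cyclic_pairs P) cross_sign e (a, b) +
  \sum_(e <- cyclic_pairs P) cross_sign e (b, c) +
  \sum_(e <- cyclic_pairs P) cross_sign e (c, a) = 0.
Proof.
move=> gen dis; apply: oppr_inj; rewrite oppr0 !opprD -!sumrN.
have mir : cyclic_pairs (map (@mirror R) P) = map (@mirror_edge R) (cyclic_pairs P).
  exact: cyclic_pairs_map.
have hf f : f \in cyclic_pairs (map (@mirror R) P) ->
    exists2 e, e \in cyclic_pairs P & f = mirror_edge e.
  by rewrite mir => /mapP.
rewrite -[RHS](@sum_triangle_left R (mirror a) (mirror b) (mirror c) (map (@mirror R) P)).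
- by rewrite mir !big_map; congr (_ + _ + _); apply: eq_bigr => e _;
    rewrite -cross_sign_mirror.
- move=> f /hf[e he ->]; have [g1 g2 g3] := gen e he.
  by split; apply: generic_pair_sym; [move: g1|move: g2|move: g3]; move/generic_pair_mirror.
- move=> f t /hf[e he ->] ht; rewrite segment_mirror => /in_triangle_mirror.
  exact: dis.
Qed.

(** * Compactness and small shifts *)

Section UnitInterval.
Local Open Scope classical_set_scope.

(** The form in which compactness of the interval is used: a property that holds near each point for
    some [d], and persists for smaller [d], holds everywhere for a single [d]. *)
Lemma unit_itv_uniform (R : realType) (P : R -> R -> Prop) :
  (forall d d' x, 0 < d -> d <= d' -> P d' x -> P d x) ->
  (forall x, unit_itv x -> exists2 d : R, 0 < d &
     forall x', unit_itv x' -> `|x - x'| < d -> P d x') ->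
  exists2 d : R, 0 < d & forall x, unit_itv x -> P d x.
Proof.
move=> mono loc.
have /compact_near_coveringP cov := @segment_compact R 0 1.
have := @cov R (0^'+) (fun d x => unit_itv x -> P d x) _.
case.
  move=> x hx; have [d d0 hd] := loc x hx.
  exists ([set x' | `|x - x'| < d], [set e | 0 < e /\ e <= d]).
    split => /=.
      by apply/nbhs_ballP; exists d => // y; rewrite /ball /=.
    by near=> e; split; near: e; [exact: nbhs_right_gt | exact: nbhs_right_le].
  move=> [x' e] /= [hx' [e0 ed]] ux'.
  by apply: (mono e d) => //; exact: hd.
move=> d /= d0 hd.
have d20 : 0 < d / 2 by rewrite divr_gt0.
exists (d / 2) => // x hx; apply: (hd (d / 2)) => //=.
by rewrite sub0r normrN gtr0_norm // ltr_pdivrMr // ltr_pMr // ltr1n.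
Unshelve. all: by end_near.
Qed.

End UnitInterval.

Lemma within_unit_itv_cont (R : realType) (f : R -> 'rV[R]_3) (x : R) (eps : R) :
  {within unit_itv, continuous f}%classic -> unit_itv x -> 0 < eps ->
  exists2 d : R, 0 < d & forall y, unit_itv y -> `|x - y| < d -> `|f x - f y| < eps.
Proof.
move=> /subspace_continuousP /(_ x) h hx e0.
have /cvgrPdist_lt /(_ eps e0) := h hx.
rewrite near_withinE => /nbhs_ballP [d /= d0 hd].
by exists d => // y hy hxy; apply: hd.
Qed.

Lemma within_unit_itv_unif (R : realType) (f : R -> 'rV[R]_3) (eps : R) :
  {within unit_itv, continuous f}%classic -> 0 < eps ->
  exists2 d : R, 0 < d & forall x y, unit_itv x -> unit_itv y -> `|x - y| < d ->
    `|f x - f y| < eps.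
Proof.
move=> cf e0.
have [||d d0 hd] := @unit_itv_uniform R (fun d x => forall y, unit_itv y ->
   `|x - y| < d -> `|f x - f y| < eps); last by exists d => // x y hx; exact: hd.
  by move=> d d' x d0 dd' h y hy hxy; apply: h => //; exact: lt_le_trans dd'.
move=> x hx; have e20 : 0 < eps / 2 by rewrite divr_gt0.
have [d d0 hd] := within_unit_itv_cont cf hx e20.
have d20 : 0 < d / 2 by rewrite divr_gt0.
exists (d / 2) => // x' hx' hxx' y hy hxy.
have h1 : `|f x - f x'| < eps / 2 by apply: hd => //; lra.
have h2 : `|f x - f y| < eps / 2.
  by apply: hd => //; have := ler_distD x' x y; lra.
by have := ler_distD (f x) (f x') (f y); rewrite (distrC (f x') (f x)); lra.
Qed.

Lemma unit_itv_dist_pos (R : realType) (f g : R -> 'rV[R]_3) :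
  {within unit_itv, continuous f}%classic -> {within unit_itv, continuous g}%classic ->
  (forall s t, unit_itv s -> unit_itv t -> f s <> g t) ->
  exists2 d : R, 0 < d & forall s t, unit_itv s -> unit_itv t -> d <= `|f s - g t|.
Proof.
move=> cf cg dis.
have pt s : unit_itv s -> exists2 d : R, 0 < d & forall t, unit_itv t -> d <= `|f s - g t|.
  move=> hs; apply: (@unit_itv_uniform R (fun d t => d <= `|f s - g t|)).
    by move=> d d' t _; exact: le_trans.
  move=> t ht.
  have r0 : 0 < `|f s - g t| / 2.
    by rewrite divr_gt0 // normr_gt0 subr_eq0; apply/eqP; exact: dis.
  have [d d0 hd] := within_unit_itv_cont cg ht r0.
  exists (Num.min d (`|f s - g t| / 2)); first by rewrite lt_min d0.
  move=> t' ht'; rewrite lt_min => /andP[h _].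
  rewrite ge_min; apply/orP; right.
  by have := hd t' ht' h; have := ler_distD (g t') (f s) (g t); rewrite (distrC (g t') (g t)); lra.
have [||d d0 hd] := @unit_itv_uniform R
    (fun d s => forall t, unit_itv t -> d <= `|f s - g t|);
  last by exists d => // s t hs; exact: hd.
  by move=> d d' s _ h h' t ht; apply: le_trans h _; exact: h'.
move=> s hs; have [d d0 hd] := pt s hs.
have r0 : 0 < d / 2 by rewrite divr_gt0.
have [d' d'0 hd'] := within_unit_itv_cont cf hs r0.
exists (Num.min d' (d / 2)); first by rewrite lt_min d'0.
move=> s' hs'; rewrite lt_min => /andP[h _] t ht.
rewrite ge_min; apply/orP; right.
have := hd t ht; have := hd' s' hs' h.
by have := ler_distD (f s') (f s) (g t); lra.
Qed.

Lemma coord_norm (R : realType) (x : 'rV[R]_3) (k : 'I_3) : `|x 0 k| <= `|x|.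
Proof.
by rewrite {2}/Num.norm /= mx_normrE;
  apply: (le_bigmax _ (fun ij : 'I_1 * 'I_3 => `|x ij.1 ij.2|) (0, k)).
Qed.

Lemma continuous_segment (R : realType) (e : 'rV[R]_3 * 'rV[R]_3) :
  {within unit_itv, continuous (segment e)}%classic.
Proof.
apply: continuous_subspaceT => t; apply: cvgD; apply: cvgZr_tmp; last exact: cvg_id.
by apply: cvgB; [exact: cvg_cst | exact: cvg_id].
Qed.

Lemma seq_eventually (R : realType) (T : eqType) (s : seq T) (P : T -> 'rV[R]_3 -> Prop) :
  (forall x, x \in s -> exists2 eps : R, 0 < eps & forall w, `|w| < eps -> P x w) ->
  exists2 eps : R, 0 < eps & forall w, `|w| < eps -> forall x, x \in s -> P x w.
Proof.
elim: s => [_|x s IH h]; first by exists 1.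
have [|e e0 he] := IH; first by move=> y hy; apply: h; rewrite inE hy orbT.
have [|e' e'0 he'] := h x; first by rewrite inE eqxx.
exists (Num.min e e'); first by rewrite lt_min e0.
move=> w; rewrite lt_min => /andP[h1 h2] y; rewrite inE => /orP[/eqP ->|hy].
  exact: he'.
exact: he.
Qed.

Definition shift_edge (R : realType) (w : 'rV[R]_3) (e : 'rV[R]_3 * 'rV[R]_3) :=
  (e.1 + w, e.2 + w).

Lemma segment_shift (R : realType) (w : 'rV[R]_3) (e : 'rV[R]_3 * 'rV[R]_3) (s : R) :
  segment (shift_edge w e) s = segment e s + w.
Proof.
by rewrite /segment /= !scalerDr addrACA -scalerDl subrK scale1r.
Qed.

Lemma shadow_det_shift (R : realType) (w : 'rV[R]_3) (e f : 'rV[R]_3 * 'rV[R]_3) :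
  shadow_det (shift_edge w e) f = shadow_det e f.
Proof. by rewrite /shadow_det /= !mxE; ring. Qed.

(** Transverse lines in the plane meet only once, so by Cramer's rule the parameters in the
    existential are the given ones, and heights need to be compared only there. *)
Lemma crosses_over_at (R : realType) (e f : 'rV[R]_3 * 'rV[R]_3) (s t : R) :
  shadow_det e f != 0 -> unit_itv s -> unit_itv t ->
  same_shadow (segment e s) (segment f t) ->
  crosses_over e f <-> segment f t 0 2 < segment e s 0 2.
Proof.
move=> hd hs ht hst; split; last by exists s, t.
move=> [s' [t' [hs' ht' hst']]].
case: hst hst' => [h0 h1] [h0' h1'].
rewrite !segment_coord in h0 h1 h0' h1'.
rewrite shadow_detE in hd.
move: (e.1 0 0) (e.1 0 1) (e.2 0 0) (e.2 0 1) (f.1 0 0) (f.1 0 1) (f.2 0 0) (f.2 0 1)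
  hd h0 h1 h0' h1' => a0 a1 b0 b1 p0 p1 q0 q1 hd h0 h1 h0' h1'.
have -> : s' = s.
  apply: (mulIf hd); apply/eqP; rewrite -subr_eq0 -mulrBl; apply/eqP.
  transitivity (((1 - s') * a0 + s' * b0 - ((1 - t') * p0 + t' * q0)
   - ((1 - s) * a0 + s * b0 - ((1 - t) * p0 + t * q0))) * (q1 - p1)
   - ((1 - s') * a1 + s' * b1 - ((1 - t') * p1 + t' * q1)
   - ((1 - s) * a1 + s * b1 - ((1 - t) * p1 + t * q1))) * (q0 - p0)); first by ring.
  by rewrite h0 h1 h0' h1'; ring.
have -> // : t' = t.
apply: (mulIf hd); apply/eqP; rewrite -subr_eq0 -mulrBl; apply/eqP.
transitivity (((1 - s') * a0 + s' * b0 - ((1 - t') * p0 + t' * q0)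
   - ((1 - s) * a0 + s * b0 - ((1 - t) * p0 + t * q0))) * (b1 - a1)
   - ((1 - s') * a1 + s' * b1 - ((1 - t') * p1 + t' * q1)
   - ((1 - s) * a1 + s * b1 - ((1 - t) * p1 + t * q1))) * (b0 - a0)); first by ring.
by rewrite h0 h1 h0' h1'; ring.
Qed.

(** The shadow, kept as a point of the space so that [unit_itv_dist_pos] applies to shadows as
    well. *)
Definition flatten_point (R : realType) (x : 'rV[R]_3) : 'rV[R]_3 :=
  \row_k (if k == 2 then 0 else x 0 k).

Lemma flatten_pointE (R : realType) (x : 'rV[R]_3) :
  (flatten_point x 0 0 = x 0 0) * (flatten_point x 0 1 = x 0 1) *
  (flatten_point x 0 2 = 0).
Proof. by rewrite !mxE. Qed.

Lemma shadows_apart_stable (R : realType) (e f : 'rV[R]_3 * 'rV[R]_3) :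
  ~ shadows_meet e f ->
  exists2 eps : R, 0 < eps & forall w, `|w| < eps -> ~ shadows_meet (shift_edge w e) f.
Proof.
move=> nm.
pose fe (e : 'rV[R]_3 * 'rV[R]_3) := (flatten_point e.1, flatten_point e.2).
have seg_fe e' s : segment (fe e') s = flatten_point (segment e' s).
  by apply: rV3_eq; [split|]; rewrite segment_coord !flatten_pointE ?segment_coord //=; ring.
have [||s t hs ht heq|d d0 hd] := @unit_itv_dist_pos R (segment (fe e)) (segment (fe f)).
- exact: continuous_segment.
- exact: continuous_segment.
- apply: nm; exists s, t; split => //.
  by move: heq; rewrite !seg_fe => /rowP h; split; [have := h 0|have := h 1];
    rewrite !flatten_pointE.
exists d => // w hw [s [t [hs ht [h0 h1]]]].
have := hd s t hs ht; rewrite leNgt => /negP; apply.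
apply: le_lt_trans hw; rewrite -normrN.
rewrite segment_shift mxE in h0; rewrite segment_shift mxE in h1.
suff -> : - (segment (fe e) s - segment (fe f) t) = flatten_point w.
  rewrite {1}/Num.norm /= mx_normrE; apply: bigmax_le => // -[i k] _ /=.
  rewrite mxE; case: ifP => _; first by rewrite normr0.
  exact: coord_norm.
rewrite !seg_fe; apply: rV3_eq; [split|].
- by rewrite mxE mxE [X in _ + X]mxE !flatten_pointE; lra.
- by rewrite mxE mxE [X in _ + X]mxE !flatten_pointE; lra.
- by rewrite mxE mxE [X in _ + X]mxE !flatten_pointE; lra.
Qed.

(** Cramer's rule gives the crossing after the shift: it sits at the parameters [s + al] and
    [t + be], with [al] and [be] linear in [w]. For small [w] they stay in the unit interval, and
    the difference of the heights keeps its sign. *)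
Lemma crossing_stable (R : realType) (e f : 'rV[R]_3 * 'rV[R]_3) (s t : R) :
  shadow_det e f != 0 -> 0 < s < 1 -> 0 < t < 1 ->
  same_shadow (segment e s) (segment f t) ->
  segment e s 0 2 != segment f t 0 2 ->
  exists2 eps : R, 0 < eps & forall w, `|w| < eps ->
    crosses_over (shift_edge w e) f <-> crosses_over e f.
Proof.
move=> hd hs ht hst hz.
have us : unit_itv s by rewrite unit_itvE; lra.
have ut : unit_itv t by rewrite unit_itvE; lra.
pose d := shadow_det e f.
pose u k := e.2 0 k - e.1 0 k; pose v k := f.2 0 k - f.1 0 k.
pose h := segment e s 0 2 - segment f t 0 2.
(* [K] bounds the displacement of either parameter per unit of [w]; [m] is the room left to the
   parameters and to the height difference [h]. *)
pose K := (`|u 0| + `|u 1| + `|v 0| + `|v 1|) / `|d|.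
have K0 : 0 <= K by rewrite divr_ge0 // !addr_ge0.
pose m := Num.min (Num.min s (1 - s)) (Num.min (Num.min t (1 - t)) `|h|).
have m0 : 0 < m by rewrite !lt_min normr_gt0 subr_eq0 hz; lra.
(* [L] is at least [K] and also bounds the change of the height difference per unit of [w], so one
   inequality controls both. *)
pose L := K * (`|u 2| + `|v 2| + 1) + 1.
have L0 : 0 < L by rewrite ltr_wpDl // mulr_ge0 // !addr_ge0.
exists (m / L); first by rewrite divr_gt0.
move=> w; rewrite ltr_pdivlMr // => hw.
pose al := (w 0 1 * v 0 - w 0 0 * v 1) / d.
pose be := (u 0 * w 0 1 - u 1 * w 0 0) / d.
have cw k : `|w 0 k| <= `|w| := coord_norm w k.
have hal : `|al| <= K * `|w|.
  rewrite /al normrM normfV /K mulrAC ler_pM2r ?invr_gt0 ?normr_gt0 //.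
  apply: (le_trans (ler_normB _ _)); rewrite !normrM.
  have := cw 0; have := cw 1; have := normr_ge0 (u 0); have := normr_ge0 (u 1).
  have := normr_ge0 (v 0); have := normr_ge0 (v 1); have := normr_ge0 w.
  by have := normr_ge0 (w 0 0); have := normr_ge0 (w 0 1); nra.
have hbe : `|be| <= K * `|w|.
  rewrite /be normrM normfV /K mulrAC ler_pM2r ?invr_gt0 ?normr_gt0 //.
  apply: (le_trans (ler_normB _ _)); rewrite !normrM.
  have := cw 0; have := cw 1; have := normr_ge0 (u 0); have := normr_ge0 (u 1).
  have := normr_ge0 (v 0); have := normr_ge0 (v 1); have := normr_ge0 w.
  by have := normr_ge0 (w 0 0); have := normr_ge0 (w 0 1); nra.
have hKw : K * `|w| < m.
  apply: le_lt_trans hw; rewrite mulrC ler_wpM2l // /L.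
  have := normr_ge0 (u 2); have := normr_ge0 (v 2); nra.
have [hms hms1 hmt hmt1 hmh] : [/\ m <= s, m <= 1 - s, m <= t, m <= 1 - t & m <= `|h|].
  by split; rewrite /m !ge_min lexx ?orbT.
have hs' : unit_itv (s + al).
  by rewrite unit_itvE; move: hal; rewrite ler_norml; lra.
have ht' : unit_itv (t + be).
  by rewrite unit_itvE; move: hbe; rewrite ler_norml; lra.
have hde : d = u 0 * v 1 - u 1 * v 0 by rewrite /d shadow_detE.
have hst' : same_shadow (segment (shift_edge w e) (s + al)) (segment f (t + be)).
  case: hst => h0 h1; rewrite !segment_coord in h0 h1.
  have hal2 : al * d = w 0 1 * v 0 - w 0 0 * v 1 by rewrite /al mulfVK.
  have hbe2 : be * d = u 0 * w 0 1 - u 1 * w 0 0 by rewrite /be mulfVK.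
  have e0 : al * u 0 + w 0 0 = be * v 0.
    apply: (mulIf hd); rewrite -/d mulrDl -mulrA (mulrC (u 0)) mulrA hal2.
    by rewrite -[be * _ * _]mulrA (mulrC (v 0)) mulrA hbe2 hde; ring.
  have e1 : al * u 1 + w 0 1 = be * v 1.
    apply: (mulIf hd); rewrite -/d mulrDl -mulrA (mulrC (u 1)) mulrA hal2.
    by rewrite -[be * _ * _]mulrA (mulrC (v 1)) mulrA hbe2 hde; ring.
  split; rewrite segment_shift mxE !segment_coord.
    move: e0 h0; rewrite /u /v; lra.
  move: e1 h1; rewrite /u /v; lra.
rewrite (crosses_over_at _ hs' ht' hst') ?shadow_det_shift //.
rewrite (crosses_over_at hd us ut hst).
rewrite -subr_gt0 -[X in _ <-> is_true X]subr_gt0 -/h.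
have -> : segment (shift_edge w e) (s + al) 0 2 - segment f (t + be) 0 2 =
  h + (al * u 2 + w 0 2 - be * v 2).
  by rewrite segment_shift mxE /h !segment_coord /u /v; ring.
clearbody al be.
have hr : `|al * u 2 + w 0 2 - be * v 2| < `|h|.
  apply: lt_le_trans hmh; apply: le_lt_trans hw.
  apply: (le_trans (ler_normB _ _)); rewrite -lerBrDr.
  apply: (le_trans (ler_normD _ _)); rewrite !normrM.
  have := ler_wpM2r (normr_ge0 (u 2)) hal; have := ler_wpM2r (normr_ge0 (v 2)) hbe.
  have : 0 <= K * `|w| by rewrite mulr_ge0.
  by have := cw 2; rewrite /L; lra.
move: hr; rewrite ltr_norml; case: (ltrgtP h 0) => hh.
- by rewrite (ltr0_norm hh); split; lra.
- by rewrite (gtr0_norm hh); split; lra.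
- by rewrite hh normr0; lra.
Qed.

Lemma cross_sign_stable (R : realType) (e f : 'rV[R]_3 * 'rV[R]_3) :
  (forall s t : R, unit_itv s -> unit_itv t ->
     same_shadow (segment e s) (segment f t) ->
     [/\ 0 < s < 1, 0 < t < 1 & shadow_det e f != 0]) ->
  (forall s t : R, unit_itv s -> unit_itv t -> segment e s <> segment f t) ->
  exists2 eps : R, 0 < eps & forall w, `|w| < eps ->
    cross_sign (shift_edge w e) f = cross_sign e f.
Proof.
move=> gp dis; case: (pselect (shadows_meet e f)) => [[s [t [hs ht hst]]]|nm].
  have [hs' ht' hd] := gp s t hs ht hst.
  have hz : segment e s 0 2 != segment f t 0 2.
    by apply/eqP => hz; apply: (dis s t hs ht); exact: rV3_eq.
  have [eps e0 he] := crossing_stable hd hs' ht' hst hz.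
  exists eps => // w hw; rewrite /cross_sign shadow_det_shift.
  by rewrite (asbool_equiv_eq (he w hw)).
have [eps e0 he] := shadows_apart_stable nm.
have z e' : ~ shadows_meet e' f -> cross_sign e' f = 0.
  move=> nm'; rewrite /cross_sign; case: asboolP => // -[s [t [hs ht h _]]].
  by case: nm'; exists s, t.
by exists eps => // w hw; rewrite !z //; exact: he.
Qed.

(** * Generic shifts *)

Lemma small_nonroot (R : realFieldType) (L : seq {poly R}) (eps : R) : 0 < eps ->
  exists2 t : R, 0 < t < eps & forall p, p \in L -> p != 0 -> p.[t] != 0.
Proof.
move=> e0; pose q := \prod_(p <- L | p != 0) p.
have q0 : q != 0 by rewrite prodf_seq_neq0; apply/allP => p _; apply/implyP.
(* These are [size q] distinct points, one more than the degree of [q]; denominators from 2 on keep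
   them strictly below [eps]. *)
pose rs := [seq eps / k.+2%:R | k <- iota 0 (size q)] : seq R.
have : ~~ all (root q) rs.
  apply/negP => /(max_poly_roots q0); rewrite size_map size_iota ltnn => h.
  suff : false by []. apply: h; rewrite map_inj_uniq ?iota_uniq // => i j.
  move/(mulfI (lt0r_neq0 e0))/invr_inj/eqP; rewrite eqr_nat => /eqP.
  by case.
move=> /allPn[t /mapP[k _ ht] nroot]; exists t.
  rewrite ht divr_gt0 ?ltr0n //= ltr_pdivrMr ?ltr0n // ltr_pMr // ltr1n.
  by [].
move=> p hp pn0; apply: contra nroot => /eqP hpt.
by rewrite /root /q (big_rem p) //= pn0 hornerM hpt mul0r.
Qed.

Definition tiny_shift (R : realType) (t : R) : 'rV[R]_3 :=
  \row_k (if k == 0 then t else if k == 1 then t ^+ 2 else 0).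

Lemma tiny_shiftE (R : realType) (t : R) :
  (tiny_shift t 0 0 = t) * (tiny_shift t 0 1 = t ^+ 2) * (tiny_shift t 0 2 = 0).
Proof. by rewrite !mxE. Qed.

Lemma tiny_shift_norm (R : realType) (t : R) : 0 < t < 1 -> `|tiny_shift t| <= t.
Proof.
move=> /andP[t0 t1]; rewrite {1}/Num.norm /= mx_normrE; apply: bigmax_le => [|[i k] _ /=].
  exact: ltW.
rewrite mxE; case: ifP => _; first by rewrite gtr0_norm.
case: ifP => _; last by rewrite normr0 ltW.
by rewrite ger0_norm ?sqr_ge0 // expr2 ler_piMr // ltW.
Qed.

Lemma quadratic_neq0 (R : realFieldType) (c0 c1 c2 : R) :
  (c1 != 0) || (c2 != 0) -> c0%:P + c1 *: 'X + c2 *: 'X^2 != 0.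
Proof.
apply: contraTneq => /polyP h; have := h 1%N; have := h 2%N.
by rewrite !coefE /= !(mulr0, mulr1, addr0, add0r) => -> ->; rewrite eqxx.
Qed.

(* Along the moment curve [(t, t^2)], each line that the shadow of the shift has to avoid is
   the zero set of a nonzero polynomial in [t]. *)
Lemma exists_generic_shift (R : realType) (A B : seq 'rV[R]_3) (eps : R) : 0 < eps ->
  exists2 w : 'rV[R]_3, `|w| < eps & forall a b p q, a \in A -> b \in A ->
    p \in B -> q \in B -> generic_pair (a + w, b + w) (p, q).
Proof.
move=> e0.
pose lin (a p : 'rV[R]_3) : {poly R} := (a 0 0 - p 0 0)%:P + 1 *: 'X + 0 *: 'X^2.
pose pol1 (a b p : 'rV[R]_3) : {poly R} :=
  (orient a b p)%:P + (b 0 1 - a 0 1) *: 'X + (- (b 0 0 - a 0 0)) *: 'X^2.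
pose pol2 (p q a : 'rV[R]_3) : {poly R} :=
  (orient p q a)%:P + (- (q 0 1 - p 0 1)) *: 'X + (q 0 0 - p 0 0) *: 'X^2.
pose L := [seq lin a p | a <- A, p <- B] ++
  [seq pol1 ab.1 ab.2 p | ab <- [seq (a, b) | a <- A, b <- A], p <- B] ++
  [seq pol2 pq.1 pq.2 a | pq <- [seq (p, q) | p <- B, q <- B], a <- A].
have m0 : 0 < Num.min eps 1 by rewrite lt_min e0 ltr01.
have [t /andP[t0]] := small_nonroot L m0; rewrite lt_min => /andP[te t1] hL.
exists (tiny_shift t); first by apply: le_lt_trans te; apply: tiny_shift_norm; rewrite t0.
have hlin a p : a \in A -> p \in B -> (a + tiny_shift t) 0 0 != p 0 0.
  move=> ha hp; have := hL (lin a p); rewrite mem_cat allpairs_f // => /(_ isT).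
  rewrite quadratic_neq0 ?oner_eq0 // => /(_ isT).
  rewrite /lin !hornerE mxE tiny_shiftE; apply: contra => /eqP h; apply/eqP; lra.
have hp1 a b p : a \in A -> b \in A -> p \in B -> ~ same_shadow a b ->
    orient (a + tiny_shift t) (b + tiny_shift t) p != 0.
  move=> ha hb hp nab; have := hL (pol1 a b p).
  rewrite !mem_cat (@allpairs_f _ _ _ (fun ab : _ * _ => pol1 ab.1 ab.2) _ _ (a, b) p) ?allpairs_f //.
  rewrite orbT => /(_ isT).
  rewrite quadratic_neq0 => [/(_ isT)|].
    apply: contra => /eqP h; apply/eqP; move: h.
    rewrite /pol1 !hornerE !orientE !mxE /=; lra.
  rewrite oppr_eq0 !subr_eq0; apply/negPn/negP; rewrite negb_or !negbK => /andP[/eqP h1 /eqP h0].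
  by apply: nab; split.
have hp2 p q a : p \in B -> q \in B -> a \in A -> ~ same_shadow p q ->
    orient p q (a + tiny_shift t) != 0.
  move=> hp hq ha npq; have := hL (pol2 p q a).
  rewrite !mem_cat (@allpairs_f _ _ _ (fun ab : _ * _ => pol2 ab.1 ab.2) _ _ (p, q) a) ?allpairs_f //.
  rewrite !orbT => /(_ isT).
  rewrite quadratic_neq0 => [/(_ isT)|].
    apply: contra => /eqP h; apply/eqP; move: h.
    rewrite /pol2 !hornerE !orientE !mxE /=; lra.
  rewrite oppr_eq0 !subr_eq0; apply/negPn/negP; rewrite negb_or !negbK => /andP[/eqP h1 /eqP h0].
  by apply: npq; split.
move=> a b p q ha hb hp hq; split => /=.
- by split; exact: hlin.
- move=> nab; have {}nab : ~ same_shadow a b.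
    by move=> [h0 h1]; apply: nab; split; rewrite mxE [RHS]mxE ?h0 ?h1.
  by split; exact: hp1.
- by move=> npq; split; exact: hp2.
Qed.

(** * Concatenated paths and polygons *)

Definition closed_chain (R : realType) (s : seq (R -> 'rV[R]_3)) : Prop :=
  forall i, (i < size s)%N ->
    nth (fun=> 0) s i 1 = nth (fun=> 0) s (i.+1 %% size s)%N 0.

(** At [t = 1] the truncation has already moved on to the next path at 0, which agrees by
    [closed_chain]; after the last path [minn] keeps the index and the parameter is 1. *)
Lemma concat_pathsE (R : realType) (s : seq (R -> 'rV[R]_3)) (i : nat) (t : R) :
  closed_chain s -> (i < size s)%N -> unit_itv t ->
  concat_paths s ((i%:R + t) / (size s)%:R) = nth (fun=> 0) s i t.
Proof.
move=> cl hi /unit_itvE /andP[t0 t1].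
have m0 : (size s)%:R != 0 :> R by rewrite pnatr_eq0 -lt0n (leq_ltn_trans _ hi).
rewrite /concat_paths mulfVK //.
have [t1'|t1'] := eqVneq t 1; last first.
  have -> : Num.truncn (i%:R + t) = i.
    apply: truncn_def; rewrite lerDl t0 /= -natr1 ltrD2l lt_neqAle t1'.
    by [].
  have -> : minn i (size s).-1 = i by lia.
  by rewrite addrC addKr.
rewrite t1' natr1.
have -> : Num.truncn (i.+1%:R : R) = i.+1.
  by apply: truncn_def; rewrite lexx /= ltr_nat.
have [hi1|hi1] := ltnP i.+1 (size s).
  have -> : minn i.+1 (size s).-1 = i.+1 by lia.
  by rewrite subrr cl // modn_small.
have -> : minn i.+1 (size s).-1 = i by lia.
by rewrite -natr1 addrC addKr.
Qed.

Lemma unit_itv_split (R : realType) (m : nat) (t : R) : (0 < m)%N -> unit_itv t ->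
  exists (i : nat) (u : R), [/\ (i < m)%N, unit_itv u & t = (i%:R + u) / m%:R].
Proof.
move=> m0 /unit_itvE /andP[t0 t1].
have m0' : m%:R != 0 :> R by rewrite pnatr_eq0 -lt0n.
have tm0 : 0 <= t * m%:R by rewrite mulr_ge0.
have [h1 h2] := andP (truncn_itv tm0).
have [hlt|hge] := ltnP (Num.truncn (t * m%:R)) m.
  exists (Num.truncn (t * m%:R)), (t * m%:R - (Num.truncn (t * m%:R))%:R).
  split=> //; last by field.
  by rewrite unit_itvE; move: h2; rewrite -natr1; lra.
exists m.-1, 1; split; [by lia | exact: unit_itv1 |].
have -> : m.-1%:R + 1 = m%:R :> R by rewrite natr1 prednK.
rewrite divff //; apply/eqP; rewrite eq_le t1 /=.
have : m%:R <= t * m%:R by apply: le_trans h1; rewrite ler_nat.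
by rewrite -{1}[m%:R]mul1r ler_pM2r // ltr0n.
Qed.

Lemma unit_itv_merge (R : realType) (m i : nat) (u : R) :
  (i < m)%N -> unit_itv u -> unit_itv ((i%:R + u) / m%:R).
Proof.
move=> hi /unit_itvE hu; have m0 : 0 < m%:R :> R by rewrite ltr0n (leq_ltn_trans _ hi).
have h : i%:R + 1 <= m%:R :> R by rewrite natr1 ler_nat.
have i0 : 0 <= i%:R :> R by [].
rewrite unit_itvE ler_pdivlMr // ler_pdivrMr //; lra.
Qed.

Lemma polygon_closed (R : realType) (P : seq 'rV[R]_3) :
  closed_chain [seq segment e | e <- cyclic_pairs P].
Proof.
move=> i; rewrite size_map size_cyclic_pairs => hi.
have hi' : (i.+1 %% size P < size P)%N by rewrite ltn_mod (leq_ltn_trans _ hi).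
rewrite !(nth_map (0, 0)) ?size_cyclic_pairs // segment1 segment0.
by rewrite !nth_cyclic_pairs.
Qed.

Lemma polygonE (R : realType) (P : seq 'rV[R]_3) (i : nat) (t : R) :
  (i < size P)%N -> unit_itv t ->
  polygon P ((i%:R + t) / (size P)%:R) = segment (nth 0 P i, nth 0 P (i.+1 %% size P)) t.
Proof.
move=> hi ht; have sz : size [seq segment e | e <- cyclic_pairs P] = size P.
  by rewrite size_map size_cyclic_pairs.
rewrite /polygon -{1}sz concat_pathsE ?sz //; last exact: polygon_closed.
by rewrite (nth_map (0, 0)) ?size_cyclic_pairs // nth_cyclic_pairs.
Qed.

Lemma polygon_edge (R : realType) (P : seq 'rV[R]_3) (e : 'rV[R]_3 * 'rV[R]_3) (t : R) :
  e \in cyclic_pairs P -> unit_itv t ->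
  exists2 t', unit_itv t' & segment e t = polygon P t'.
Proof.
move=> /(nthP (0, 0)) [k]; rewrite size_cyclic_pairs => hk <- ht.
exists ((k%:R + t) / (size P)%:R); first exact: unit_itv_merge.
by rewrite polygonE // nth_cyclic_pairs.
Qed.

Lemma polygon_shift (R : realType) (w : 'rV[R]_3) (P : seq 'rV[R]_3) (t : R) :
  P != [::] -> unit_itv t -> polygon [seq x + w | x <- P] t = polygon P t + w.
Proof.
move=> P0 ht; have m0 : (0 < size P)%N by rewrite lt0n size_eq0.
have [i [u [hi hu ->]]] := unit_itv_split m0 ht.
rewrite -{1}(size_map (+%R^~ w) P) !polygonE ?size_map //.
rewrite !(nth_map 0) // ?ltn_mod //.
exact: (segment_shift w (nth 0 P i, nth 0 P (i.+1 %% size P))).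
Qed.

Lemma in_triangle_ball (R : realType) (a b c x y : 'rV[R]_3) (r : R) :
  in_triangle a b c x -> `|a - y| < r -> `|b - y| < r -> `|c - y| < r -> `|x - y| < r.
Proof.
move=> [u [v [w [[hu hv hw] h ->]]]] ha hb hc.
have -> : u *: a + v *: b + w *: c - y = u *: (a - y) + v *: (b - y) + w *: (c - y).
  by rewrite -[in LHS](scale1r y) -h; apply/rowP => i; rewrite !mxE; ring.
apply: le_lt_trans (ler_normD _ _) _.
apply: le_lt_trans (lerD (ler_normD _ _) (lexx _)) _.
rewrite !normrZ !ger0_norm //.
have -> : r = u * r + v * r + w * r by rewrite -!mulrDl h mul1r.
have [u0|u0] := eqVneq u 0; last first.
  have hu' : 0 < u by rewrite lt_neqAle eq_sym u0.
  have := ltW hb; have := ltW hc; nra.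
have [v0|v0] := eqVneq v 0; last first.
  have hv' : 0 < v by rewrite lt_neqAle eq_sym v0.
  have := ltW hc; nra.
rewrite u0 v0 !mul0r !add0r; have -> : w = 1 by lra.
by rewrite !mul1r.
Qed.

(** A triangle with its corners on one segment is degenerate; this makes the subdivision of an edge
    an instance of the cocycle condition. *)
Lemma in_triangle_segment (R : realType) (e : 'rV[R]_3 * 'rV[R]_3) (s t r : R) x :
  unit_itv s -> unit_itv t -> unit_itv r ->
  in_triangle (segment e s) (segment e t) (segment e r) x ->
  exists2 q, unit_itv q & x = segment e q.
Proof.
rewrite !unit_itvE => hs ht hr [u [v [w [[hu hv hw] h ->]]]].
exists (u * s + v * t + w * r); first by rewrite unit_itvE; nra.
have -> : w = 1 - u - v by lra.
by apply/rowP => i; rewrite /segment !mxE; ring.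
Qed.

(** * Invariance of the linking number of polygons *)

(* [phi] is closed on the triangles with vertices in [A] that stay close to the curve [c]; only
   finitely many points are allowed, since [phi] will be a crossing number that is meaningful
   for points in general position. *)
Definition cocycle_near (R : realType) (c : R -> 'rV[R]_3) (eps : R)
    (A : seq 'rV[R]_3) (phi : 'rV[R]_3 * 'rV[R]_3 -> int) : Prop :=
  (forall e, phi (swap e) = - phi e) /\
  forall x y z, x \in A -> y \in A -> z \in A ->
    (forall q, in_triangle x y z q -> exists2 t, unit_itv t & `|q - c t| < eps) ->
    phi (x, y) + phi (y, z) + phi (z, x) = 0.

(** Points of one edge span degenerate triangles inside that edge, hence close to [c]; the cocycle
    condition on them makes [phi] additive along the subdivided edge. *)
Lemma sum_refined (R : realType) (c : R -> 'rV[R]_3) (eps : R)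
    (A : seq 'rV[R]_3) (phi : 'rV[R]_3 * 'rV[R]_3 -> int) (P : seq 'rV[R]_3) (M : nat) :
  (0 < M)%N -> uniformly_close eps (polygon P) c -> cocycle_near c eps A phi ->
  (forall k, (k <= size P * M)%N -> polygon P (k%:R / (size P * M)%:R) \in A) ->
  \sum_(0 <= k < size P * M) phi (polygon P (k%:R / (size P * M)%:R),
                                  polygon P (k.+1%:R / (size P * M)%:R)) =
  \sum_(e <- cyclic_pairs P) phi e.
Proof.
move=> M0 close [anti tri] hA.
rewrite (sum_cyclic_pairs 0) big_nat_mul; apply: eq_big_nat => i /andP[_ hi].
have m0 : (size P)%:R != 0 :> R by rewrite pnatr_eq0 -lt0n (leq_ltn_trans _ hi).
have M0' : M%:R != 0 :> R by rewrite pnatr_eq0 -lt0n.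
set e := (nth 0 P i, _).
have uM j : (j <= M)%N -> unit_itv (j%:R / M%:R : R).
  move=> hj; rewrite unit_itvE divr_ge0 //= ler_pdivrMr ?ltr0n //.
  by rewrite mul1r ler_nat.
have pt j : (j <= M)%N ->
    polygon P ((j + i * M)%N%:R / (size P * M)%:R) = segment e (j%:R / M%:R).
  move=> hj; rewrite /e -(polygonE hi (uM j hj)); congr (polygon P _).
  by rewrite natrD !natrM; field; rewrite m0.
rewrite -[(i * M)%N]add0n big_addn mulSn addnK.
have -> : \sum_(0 <= j < M) phi (polygon P ((j + i * M)%:R / (size P * M)%:R),
    polygon P ((j + i * M).+1%:R / (size P * M)%:R)) =
  \sum_(0 <= j < M) phi (segment e (j%:R / M%:R), segment e (j.+1%:R / M%:R)).
  by apply: eq_big_nat => j /andP[_ hj]; rewrite -addSn !pt // ltnW.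
have inA j : (j <= M)%N -> segment e (j%:R / M%:R) \in A.
  by move=> hj; rewrite -pt //; apply: hA; nia.
have part J : (J <= M)%N ->
    \sum_(0 <= j < J) phi (segment e (j%:R / M%:R), segment e (j.+1%:R / M%:R)) =
    phi (segment e (0%:R / M%:R), segment e (J%:R / M%:R)).
  elim: J => [_|J IH hJ].
    rewrite big_nil.
    by have := anti (segment e (0%:R / M%:R), segment e (0%:R / M%:R)); rewrite /swap /=; lia.
  rewrite big_nat_recr //= IH 1?ltnW //.
  have := tri _ _ _ (inA 0 isT) (inA J (ltnW hJ)) (inA J.+1 hJ).
  rewrite (anti (_, segment e (J.+1%:R / M%:R))) /= => h.
  apply/eqP; rewrite -subr_eq0; apply/eqP; apply: h => q.
  move=> /in_triangle_segment [|||t ht ->]; try by apply: uM => //; exact: ltnW.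
  exists ((i%:R + t) / (size P)%:R); first exact: unit_itv_merge.
  by rewrite /e -polygonE //; apply: close; exact: unit_itv_merge.
by rewrite part // mul0r divff // segment0 segment1.
Qed.

(* The ladder between the two polygons, subdivided at common times, is triangulated by small
   triangles; [A] consists of its vertices and is chosen before [phi]. *)
Lemma polygon_homotopy (R : realType) (c : R -> 'rV[R]_3) (eps : R) (P P' : seq 'rV[R]_3) :
  0 < eps -> P != [::] -> P' != [::] ->
  uniformly_close eps (polygon P) c -> uniformly_close eps (polygon P') c ->
  exists A : seq 'rV[R]_3, forall phi, cocycle_near c (5 * eps) A phi ->
    \sum_(e <- cyclic_pairs P) phi e = \sum_(e <- cyclic_pairs P') phi e.
Proof.
move=> e0 P0 P'0 hP hP'.
have sP : (0 < size P)%N by rewrite lt0n size_eq0.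
have sP' : (0 < size P')%N by rewrite lt0n size_eq0.
pose len := \sum_(e <- cyclic_pairs P) `|e.2 - e.1|.
(* [len] dominates each edge length, so edges of [P] cut into [K] or more equal parts have parts
   shorter than [eps]. *)
pose K := (Num.truncn (len / eps)).+1.
have hK e : e \in cyclic_pairs P -> `|e.2 - e.1| < eps * K%:R.
  move=> he; apply: (@le_lt_trans _ _ len).
    by rewrite /len (big_rem e) //= lerDl sumr_ge0.
  by rewrite mulrC -ltr_pdivrMr // truncnS_gt.
(* Edges of [P] are cut into [M] parts and edges of [P'] into [size P * K], which gives both
   polygons the same number [N] of equally timed points. *)
pose M := (size P' * K)%N; pose N := (size P * M)%N.
have hN : N = (size P' * (size P * K))%N by rewrite /N /M; ring.
have N0 : (0 < N)%N by rewrite /N /M; nia.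
have N0' : N%:R != 0 :> R by rewrite pnatr_eq0 -lt0n.
pose x k := polygon P (k%:R / N%:R); pose x' k := polygon P' (k%:R / N%:R).
pose A := [seq x k | k <- iota 0 N.+1] ++ [seq x' k | k <- iota 0 N.+1].
have hx k : (k <= N)%N -> x k \in A.
  by move=> hk; rewrite mem_cat map_f // mem_iota.
have hx' k : (k <= N)%N -> x' k \in A.
  by move=> hk; rewrite mem_cat [X in _ || X]map_f ?orbT // mem_iota.
exists A => phi hphi; have [anti tri] := hphi.
have weaken r : uniformly_close eps r c -> uniformly_close (5 * eps) r c.
  by move=> h t ht; apply: (lt_trans (h t ht)); lra.
rewrite -(@sum_refined R c (5 * eps) A phi P M) //; first last.
- exact: weaken.
- by rewrite /M; nia.
rewrite -(@sum_refined R c (5 * eps) A phi P' (size P * K)%N) //; first last.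
- by rewrite -hN.
- exact: weaken.
- nia.
rewrite -hN -/N.
have uN k : (k <= N)%N -> unit_itv (k%:R / N%:R : R).
  move=> hj; rewrite unit_itvE divr_ge0 //= ler_pdivrMr ?ltr0n //.
  by rewrite mul1r ler_nat.
have step k : (k < N)%N -> `|x k.+1 - x k| < eps.
  move=> hk; have M0 : (0 < M)%N by rewrite /M; nia.
  have M0' : 0 < M%:R :> R by rewrite ltr0n.
  have hi : (k %/ M < size P)%N by rewrite ltn_divLR.
  have hj : (k %% M < M)%N by rewrite ltn_mod.
  have m0 : (size P)%:R != 0 :> R by rewrite pnatr_eq0 -lt0n.
  have ht : k%:R / N%:R = ((k %/ M)%:R + (k %% M)%:R / M%:R) / (size P)%:R :> R.
    rewrite {1}(divn_eq k M) /N natrD !natrM; field.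
    by rewrite !pnatr_eq0 -!lt0n sP sP'.
  have ht1 : k.+1%:R / N%:R = ((k %/ M)%:R + (k %% M).+1%:R / M%:R) / (size P)%:R :> R.
    rewrite {1}(divn_eq k M) -addnS /N natrD !natrM; field.
    by rewrite !pnatr_eq0 -!lt0n sP sP'.
  have u1 : unit_itv ((k %% M)%:R / M%:R : R).
    by rewrite unit_itvE divr_ge0 //= ler_pdivrMr // mul1r ler_nat ltnW.
  have u2 : unit_itv ((k %% M).+1%:R / M%:R : R).
    by rewrite unit_itvE divr_ge0 //= ler_pdivrMr // mul1r ler_nat.
  rewrite /x ht ht1 !polygonE //; set e := (_, _).
  have he : e \in cyclic_pairs P.
    by rewrite /e -nth_cyclic_pairs // mem_nth // size_cyclic_pairs.
  have -> : segment e ((k %% M).+1%:R / M%:R) - segment e ((k %% M)%:R / M%:R) =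
      M%:R^-1 *: (e.2 - e.1).
    by rewrite -natr1; apply/rowP => i; rewrite /segment !mxE; field; rewrite lt0r_neq0.
  rewrite normrZ gtr0_norm ?invr_gt0 // mulrC ltr_pdivrMr //.
  apply: (lt_le_trans (hK e he)); rewrite ler_pM2l // ler_nat /M; nia.
(* The quadrilateral between two rungs is cut along the diagonal from [x k] to [x' k.+1]; in the sum
   of the two cocycle relations the diagonal cancels. *)
have quad k : (k < N)%N ->
    phi (x k, x k.+1) - phi (x' k, x' k.+1) = phi (x k, x' k) - phi (x k.+1, x' k.+1).
  move=> hk; have hk' := ltnW hk.
  have c1 := hP _ (uN k hk'); have c2 := hP' _ (uN k hk').
  have c3 := hP _ (uN _ hk); have c4 := hP' _ (uN _ hk).
  rewrite -/(x k) -/(x k.+1) -/(x' k) -/(x' k.+1) in c1 c2 c3 c4.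
  have s1 := step k hk.
  (* All corners are within [4 * eps] of [y]. Short steps are known for [P] only, so [x' k.+1] is
     reached through [x k.+1] and the point of [c] at the later time. *)
  pose y := c (k%:R / N%:R); rewrite -/y in c1 c2.
  have d1 : `|x k - y| < 5 * eps by lra.
  have d2 : `|x' k - y| < 5 * eps by lra.
  have d3 : `|x k.+1 - y| < 5 * eps by have := ler_distD (x k) (x k.+1) y; lra.
  have d4 : `|x' k.+1 - y| < 5 * eps.
    have := ler_distD (c (k.+1%:R / N%:R)) (x' k.+1) (x k.+1).
    have := ler_distD (x k.+1) (x' k.+1) y; have := ler_distD (x k) (x k.+1) y.
    by rewrite (distrC (c (k.+1%:R / N%:R))); lra.
  have near a b d q : `|a - y| < 5 * eps -> `|b - y| < 5 * eps -> `|d - y| < 5 * eps ->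
      in_triangle a b d q -> exists2 t, unit_itv t & `|q - c t| < 5 * eps.
    move=> ha hb hd hq; exists (k%:R / N%:R); first exact: uN.
    exact: in_triangle_ball hq ha hb hd.
  have t1 := tri _ _ _ (hx k hk') (hx k.+1 hk) (hx' k.+1 hk) (fun q => near _ _ _ q d1 d3 d4).
  have t2 := tri _ _ _ (hx k hk') (hx' k.+1 hk) (hx' k hk') (fun q => near _ _ _ q d1 d4 d2).
  have antiC u v : phi (u, v) = - phi (v, u) by exact: anti (v, u).
  rewrite (antiC (x' k.+1)) in t1; rewrite (antiC _ (x' k)) (antiC _ (x k)) in t2.
  move: t1 t2; move: (phi (x k, x k.+1)) (phi (x k.+1, x' k.+1)) (phi (x k, x' k.+1))
    (phi (x' k, x' k.+1)) (phi (x k, x' k)); clear; lia.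
apply/eqP; rewrite -subr_eq0 -sumrB.
have -> : \sum_(0 <= k < N) (phi (x k, x k.+1) - phi (x' k, x' k.+1)) =
  \sum_(0 <= k < N) (phi (x k, x' k) - phi (x k.+1, x' k.+1)).
  by apply: eq_big_nat => k /andP[_ hk]; exact: quad.
rewrite -[X in X == _]opprK -sumrN.
under eq_bigr do rewrite opprB.
rewrite telescope_sumr // oppr_eq0 subr_eq0; apply/eqP.
(* Telescoping leaves the two extreme rungs, which coincide because polygons close up. *)
have wrap Q : Q != [::] -> polygon Q (N%:R / N%:R) = polygon Q (0%:R / N%:R) :> 'rV[R]_3.
  move=> Q0; have q0 : (0 < size Q)%N by rewrite lt0n size_eq0.
  have q0' : (size Q)%:R != 0 :> R by rewrite pnatr_eq0 -lt0n.
  rewrite divff // mul0r.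
  have -> : 1 = ((size Q).-1%:R + 1) / (size Q)%:R :> R.
    by rewrite natr1 prednK // divff.
  have -> : 0 = (0%:R + 0) / (size Q)%:R :> R by rewrite addr0 mul0r.
  rewrite (polygonE _ (unit_itv1 R)) ?ltn_predL // (polygonE _ (unit_itv0 R)) //.
  by rewrite segment1 segment0 /= prednK // modnn.
by rewrite /x /x' !wrap.
Qed.

Definition shifted_lk (R : realType) (w : 'rV[R]_3) (P Q : seq 'rV[R]_3) : int :=
  \sum_(e <- cyclic_pairs P) \sum_(f <- cyclic_pairs Q) cross_sign (shift_edge w e) f.

Lemma polygon_lk_stable (R : realType) (P Q : seq 'rV[R]_3) :
  general_position P Q ->
  (forall s t, unit_itv s -> unit_itv t -> polygon P s <> polygon Q t) ->
  exists2 eps : R, 0 < eps & forall w, `|w| < eps -> shifted_lk w P Q = polygon_lk P Q.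
Proof.
move=> gp dis.
pose prs := [seq (e, f) | e <- cyclic_pairs P, f <- cyclic_pairs Q].
have [|eps e0 he] := @seq_eventually R _ prs
    (fun ef w => cross_sign (shift_edge w ef.1) ef.2 = cross_sign ef.1 ef.2).
  move=> _ /allpairsP[[e f] /= [he hf ->]] /=.
  apply: cross_sign_stable => [s t|s t hs ht]; first exact: gp.
  have [s' hs' ->] := polygon_edge he hs; have [t' ht' ->] := polygon_edge hf ht.
  exact: dis.
exists eps => // w hw; apply: eq_big_seq => e hE; apply: eq_big_seq => f hF.
by apply: (he w hw (e, f)); apply: allpairs_f.
Qed.

(* Replace [P] by [P'], then [Q] by [Q'], after a generic shift that changes neither end. *)
Lemma polygon_lk_invariant (R : realType) (c d : R -> 'rV[R]_3) (eps : R)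
    (P P' Q Q' : seq 'rV[R]_3) :
  0 < eps -> (forall s t, unit_itv s -> unit_itv t -> 8 * eps <= `|c s - d t|) ->
  P != [::] -> P' != [::] -> Q != [::] -> Q' != [::] ->
  uniformly_close eps (polygon P) c -> uniformly_close eps (polygon P') c ->
  uniformly_close eps (polygon Q) d -> uniformly_close eps (polygon Q') d ->
  general_position P Q -> general_position P' Q' ->
  polygon_lk P Q = polygon_lk P' Q'.
Proof.
move=> e0 far P0 P'0 Q0 Q'0 hP hP' hQ hQ' gp gp'.
have dis (U V : seq 'rV[R]_3) : uniformly_close eps (polygon U) c ->
    uniformly_close eps (polygon V) d ->
    forall s t, unit_itv s -> unit_itv t -> polygon U s <> polygon V t.
  move=> hU hV s t hs ht h; have := far s t hs ht; have := hU s hs; have := hV t ht.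
  by rewrite -h; have := ler_distD (polygon U s) (c s) (d t); rewrite (distrC (c s) (polygon U s)); lra.
have [e1 e10 st1] := polygon_lk_stable gp (dis _ _ hP hQ).
have [e2 e20 st2] := polygon_lk_stable gp' (dis _ _ hP' hQ').
have [A hA] := polygon_homotopy e0 P0 P'0 hP hP'.
have [B hB] := polygon_homotopy e0 Q0 Q'0 hQ hQ'.
(* [e1] and [e2] protect the crossing numbers at both ends. [A] and [B] are known before [w] is
   chosen, so one shift is generic for all corners of both ladders. *)
have m0 : 0 < Num.min eps (Num.min e1 e2) by rewrite !lt_min e0 e10.
have [w] := exists_generic_shift (A ++ P ++ P') (B ++ Q ++ Q') m0.
rewrite !lt_min => /and3P[hw hw1 hw2] gen.
rewrite -(st1 w hw1) -(st2 w hw2) /shifted_lk.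
transitivity (shifted_lk w P' Q).
  apply: hA; split=> [e|x y z hx hy hz near].
    rewrite -sumrN; apply: eq_bigr => f _.
    exact: (cross_sign_swapl (shift_edge w e)).
  apply: sum_triangle_left => [f hf|f t hf ht].
    have /andP[h1 h2] := mem_cyclic_pairs hf.
    by case: f h1 h2 {hf} => p q /= h1 h2; split; apply: gen; rewrite !mem_cat ?hx ?hy ?hz ?h1 ?h2 ?orbT.
  (* After undoing the shift, a common point of the triangle and [Q] would be within [5 * eps] of
     [c] and within [2 * eps] of [d], too close for curves at distance [8 * eps]. *)
  move=> [u [v [r [huvr h hseg]]]].
  have [|s hs] := near (u *: x + v *: y + r *: z); first by exists u, v, r.
  have -> : u *: x + v *: y + r *: z = segment f t - w.
    by rewrite hseg (_ : r = 1 - u - v); [apply/rowP => i; rewrite !mxE; ring | lra].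
  have [t' ht' ->] := polygon_edge hf ht.
  have := far s t' hs ht'; have := hQ t' ht'.
  have := ler_distD (polygon Q t' - w) (c s) (d t').
  have := ler_distD (polygon Q t') (polygon Q t' - w) (d t').
  have -> : polygon Q t' - w - polygon Q t' = - w by rewrite addrAC subrr add0r.
  rewrite normrN (distrC (c s) (_ - w)).
  lra.
rewrite /shifted_lk exchange_big [RHS]exchange_big /=.
(* The shift is moved into the vertices, since [sum_triangle_right] speaks of a closed polygon. *)
have mw f : \sum_(e <- cyclic_pairs P') cross_sign (shift_edge w e) f =
    \sum_(e <- cyclic_pairs [seq x + w | x <- P']) cross_sign e f.
  by rewrite cyclic_pairs_map big_map.
apply: hB; split=> [f|x y z hx hy hz near].
  rewrite -sumrN; apply: eq_bigr => e _; exact: cross_sign_swapr.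
rewrite !mw; apply: sum_triangle_right => [e|e t].
  rewrite cyclic_pairs_map => /mapP[[p q] /mem_cyclic_pairs /andP[/= h1 h2] ->].
  by split; apply: gen; rewrite !mem_cat ?hx ?hy ?hz ?h1 ?h2 ?orbT.
move=> he ht htri; have [s hs] := near _ htri.
have [t' ht' ->] := polygon_edge he ht.
rewrite polygon_shift //.
have := far t' s ht' hs; have := hP' t' ht'.
have := ler_distD (polygon P' t') (c t') (d s).
have := ler_distD (polygon P' t' + w) (polygon P' t') (d s).
have -> : polygon P' t' - (polygon P' t' + w) = - w by rewrite opprD addrA subrr add0r.
rewrite normrN (distrC (c t') (polygon P' t')).
lra.
Qed.

(** [is_lk] quantifies universally over close polygons; without such pairs at every distance it
    could hold vacuously of every integer. *)
Definition approximable (R : realType) (c d : R -> 'rV[R]_3) : Prop :=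
  forall eps, 0 < eps -> exists P Q : seq 'rV[R]_3,
    [/\ P != [::], Q != [::], uniformly_close eps (polygon P) c,
        uniformly_close eps (polygon Q) d & general_position P Q].

(** The integer chosen by [xget] comes with a distance [e'] of its own. Polygons closer than both
    [eps] and [e'] have that integer as crossing number, and by invariance also the one of [P] and
    [Q]. *)
Lemma LkE (R : realType) (c d : R -> 'rV[R]_3) (eps : R) (P Q : seq 'rV[R]_3) :
  0 < eps -> (forall s t, unit_itv s -> unit_itv t -> 8 * eps <= `|c s - d t|) ->
  approximable c d ->
  P != [::] -> Q != [::] -> uniformly_close eps (polygon P) c ->
  uniformly_close eps (polygon Q) d -> general_position P Q ->
  Lk c d = polygon_lk P Q.
Proof.
move=> e0 far app P0 Q0 hP hQ gp.
have lkPQ : is_lk c d (polygon_lk P Q).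
  exists eps => // P' Q' P'0 Q'0 hP' hQ' gp'.
  exact: (polygon_lk_invariant e0 far).
have [e' e'0 he'] : is_lk c d (Lk c d) by rewrite /Lk; exact: xgetPex (ex_intro _ _ lkPQ).
have m0 : 0 < Num.min eps e' by rewrite lt_min e0.
have [P' [Q' [P'0 Q'0 hP' hQ' gp']]] := app _ m0.
have cl r1 r2 (c1 c2 : R -> 'rV[R]_3) : r1 <= r2 -> uniformly_close r1 c1 c2 -> uniformly_close r2 c1 c2.
  by move=> h h' t ht; apply: lt_le_trans h; exact: h'.
have l1 : Num.min eps e' <= eps by rewrite ge_min lexx.
have l2 : Num.min eps e' <= e' by rewrite ge_min lexx orbT.
rewrite -(he' P' Q' P'0 Q'0 (cl _ _ _ _ l2 hP') (cl _ _ _ _ l2 hQ') gp').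
apply: (polygon_lk_invariant e0 far) => //; exact: cl l1 _.
Qed.

(** * Linking numbers of sampled curves *)

(** The value of each path at 1 is left out: in a closed chain it is the first sample of the next
    path. *)
Definition sample (R : realType) (N : nat) (s : seq (R -> 'rV[R]_3)) : seq 'rV[R]_3 :=
  mkseq (fun k => nth (fun=> 0) s (k %/ N) ((k %% N)%:R / N%:R)) (size s * N).

Lemma unit_itv_frac (R : realType) (j N : nat) : (j <= N)%N -> unit_itv (j%:R / N%:R : R).
Proof.
move=> hj; rewrite unit_itvE divr_ge0 //=.
have [->|N0] := posnP N; first by rewrite invr0 mulr0.
by rewrite ler_pdivrMr ?ltr0n // mul1r ler_nat.
Qed.

Lemma nth_sample (R : realType) (N : nat) (s : seq (R -> 'rV[R]_3)) (i j : nat) :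
  (i < size s)%N -> (j < N)%N ->
  nth 0 (sample N s) (i * N + j) = nth (fun=> 0) s i (j%:R / N%:R).
Proof.
move=> hi hj; rewrite nth_mkseq; last by nia.
have N0 : (0 < N)%N by lia.
by rewrite divnMDl // divn_small // addn0 modnMDl modn_small.
Qed.

Lemma size_sample (R : realType) (N : nat) (s : seq (R -> 'rV[R]_3)) :
  size (sample N s) = (size s * N)%N.
Proof. by rewrite size_mkseq. Qed.

Lemma nth_sample_next (R : realType) (N : nat) (s : seq (R -> 'rV[R]_3)) (i j : nat) :
  closed_chain s -> (i < size s)%N -> (j < N)%N ->
  nth 0 (sample N s) ((i * N + j).+1 %% size (sample N s)) =
  nth (fun=> 0) s i (j.+1%:R / N%:R).
Proof.
move=> cl hi hj; rewrite size_sample.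
have N0 : (0 < N)%N by lia.
have N0' : N%:R != 0 :> R by rewrite pnatr_eq0 -lt0n.
have [hj1|hj1] := ltnP j.+1 N.
  by rewrite modn_small -?addnS ?nth_sample //; nia.
have -> : j.+1 = N by lia.
rewrite divff // cl // -[RHS](_ : nth (fun=> 0) s (i.+1 %% size s) (0%:R / N%:R) = _).
  rewrite -nth_sample // ?ltn_mod; last by lia.
  congr (nth 0 (sample N s) _); rewrite addn0 -addnS.
  have -> : (i * N + j.+1)%N = (i.+1 * N)%N by nia.
  by rewrite muln_modl.
by rewrite mul0r.
Qed.

Lemma sum_sample (R : realType) (N : nat) (s : seq (R -> 'rV[R]_3))
    (F : 'rV[R]_3 * 'rV[R]_3 -> int) : closed_chain s ->
  \sum_(e <- cyclic_pairs (sample N s)) F e =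
  \sum_(f <- s) \sum_(0 <= j < N) F (f (j%:R / N%:R), f (j.+1%:R / N%:R)).
Proof.
move=> cl; rewrite (sum_cyclic_pairs 0) {1}size_sample big_nat_mul.
rewrite [RHS](big_nth (fun=> 0)); apply: eq_big_nat => i /andP[_ hi].
rewrite -[(i * N)%N]add0n big_addn mulSn addnK.
apply: eq_big_nat => j /andP[_ hj].
by rewrite addnC nth_sample // nth_sample_next.
Qed.

Definition fine_sampling (R : realType) (N : nat) (eps : R) (f : R -> 'rV[R]_3) : Prop :=
  forall x y : R, unit_itv x -> unit_itv y -> `|x - y| <= N%:R^-1 -> `|f x - f y| < eps.

Lemma sample_close (R : realType) (N : nat) (eps : R) (s : seq (R -> 'rV[R]_3)) :
  (0 < N)%N -> closed_chain s -> s != [::] ->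
  (forall i, (i < size s)%N -> fine_sampling N eps (nth (fun=> 0) s i)) ->
  uniformly_close eps (polygon (sample N s)) (concat_paths s).
Proof.
move=> N0 cl s0 fine t ht.
have m0 : (0 < size s)%N by rewrite lt0n size_eq0.
have m0' : (size s)%:R != 0 :> R by rewrite pnatr_eq0 -lt0n.
have N0' : N%:R != 0 :> R by rewrite pnatr_eq0 -lt0n.
have Np : 0 < N%:R :> R by rewrite ltr0n.
have [i [u [hi hu ->]]] := unit_itv_split m0 ht.
rewrite concat_pathsE //.
have [j [r [hj hr ->]]] := unit_itv_split N0 hu.
have -> : (i%:R + (j%:R + r) / N%:R) / (size s)%:R =
    ((i * N + j)%:R + r) / (size (sample N s))%:R.
  by rewrite size_sample natrD !natrM; field; rewrite ?m0' ?N0'.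
rewrite polygonE //; last by rewrite size_sample; nia.
rewrite nth_sample // nth_sample_next //.
have hm := unit_itv_merge hj hr.
have hj1 := @unit_itv_frac R j N (ltnW hj); have hj2 := @unit_itv_frac R j.+1 N hj.
have r01 : 0 <= r <= 1 by rewrite -unit_itvE.
have c1 : `|nth (fun=> 0) s i (j%:R / N%:R) - nth (fun=> 0) s i ((j%:R + r) / N%:R)| < eps.
  apply: fine => //.
  have -> : j%:R / N%:R - (j%:R + r) / N%:R = - (r / N%:R) by field.
  rewrite normrN ger0_norm ?divr_ge0 //; last by lra.
  by rewrite ler_pdivrMr // mulVf //; lra.
have c2 : `|nth (fun=> 0) s i (j.+1%:R / N%:R) - nth (fun=> 0) s i ((j%:R + r) / N%:R)| < eps.
  apply: fine => //.
  have -> : j.+1%:R / N%:R - (j%:R + r) / N%:R = (1 - r) / N%:R by rewrite -natr1; field.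
  rewrite ger0_norm ?divr_ge0 //; last by lra.
  by rewrite ler_pdivrMr // mulVf //; lra.
(* The segment is read as part of a triangle with a repeated corner, so that convexity of balls is
   [in_triangle_ball]. *)
exact: (in_triangle_ball (in_triangle_edge _ _ (nth (fun=> 0) s i (j%:R / N%:R)) hr) c1 c2 c1).
Qed.

Definition finely_sampled (R : realType) (f : R -> 'rV[R]_3) : Prop :=
  forall eps, 0 < eps -> exists M, forall m, (M <= m)%N -> fine_sampling m.+1 eps f.

Lemma continuous_finely_sampled (R : realType) (f : R -> 'rV[R]_3) :
  {within unit_itv, continuous f}%classic -> finely_sampled f.
Proof.
move=> cf eps e0; have [d d0 hd] := within_unit_itv_unif cf e0.
exists (Num.truncn d^-1) => m hm x y hx hy hxy; apply: hd => //.
apply: le_lt_trans hxy _; rewrite invf_plt ?posrE ?ltr0n //.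
by apply: lt_le_trans (truncnS_gt _) _; rewrite ler_nat.
Qed.

Lemma fine_sampling_rev (R : realType) (N : nat) (eps : R) (f : R -> 'rV[R]_3) :
  fine_sampling N eps f -> fine_sampling N eps (rev_path f).
Proof.
move=> h x y hx hy hxy; apply: h; try exact: unit_itv_rev.
by have -> : 1 - x - (1 - y) = y - x by [ring]; rewrite distrC.
Qed.

Lemma finely_sampled_rev (R : realType) (f : R -> 'rV[R]_3) :
  finely_sampled f -> finely_sampled (rev_path f).
Proof.
move=> h eps /h[M hM]; exists M => m hm; apply: fine_sampling_rev; exact: hM.
Qed.

Lemma fin_eventually (I : finType) (P : I -> nat -> Prop) :
  (forall i, exists M, forall m, (M <= m)%N -> P i m) ->
  exists M, forall m i, (M <= m)%N -> P i m.
Proof.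
move=> /fin_all_exists[f hf]; exists (\max_i f i)%N => m i hm.
by apply: hf; apply: leq_trans hm; exact: leq_bigmax.
Qed.

Lemma concat_paths_value (R : realType) (s : seq (R -> 'rV[R]_3)) (t : R) :
  closed_chain s -> s != [::] -> unit_itv t ->
  exists i u, [/\ (i < size s)%N, unit_itv u & concat_paths s t = nth (fun=> 0) s i u].
Proof.
move=> cl s0 ht; have m0 : (0 < size s)%N by rewrite lt0n size_eq0.
have [i [u [hi hu ->]]] := unit_itv_split m0 ht.
by exists i, u; rewrite concat_pathsE.
Qed.

Section SampledChains.
Variables (R : realType) (s s' : seq (R -> 'rV[R]_3)) (N : nat) (eps : R) (w : 'rV[R]_3).
Hypotheses (N0 : (0 < N)%N) (cl : closed_chain s) (cl' : closed_chain s').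
Hypotheses (s0 : s != [::]) (s'0 : s' != [::]).
Hypothesis fine : forall i, (i < size s)%N -> fine_sampling N (eps / 2) (nth (fun=> 0) s i).
Hypothesis fine' : forall i, (i < size s')%N -> fine_sampling N (eps / 2) (nth (fun=> 0) s' i).
Hypothesis e0 : 0 < eps.
Hypothesis hw : `|w| < eps / 2.
Hypothesis gen : forall a b p q, a \in sample N s -> b \in sample N s ->
  p \in sample N s' -> q \in sample N s' -> generic_pair (a + w, b + w) (p, q).

Lemma sample_neq0 (r : seq (R -> 'rV[R]_3)) : r != [::] -> sample N r != [::].
Proof. by rewrite -!size_eq0 size_sample -!lt0n muln_gt0 N0 andbT. Qed.

Lemma shifted_sample_close :
  uniformly_close eps (polygon [seq x + w | x <- sample N s]) (concat_paths s).
Proof.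
move=> t ht; rewrite polygon_shift ?sample_neq0 //.
have := sample_close N0 cl s0 fine ht; rewrite addrAC.
have := ler_normD (polygon (sample N s) t - concat_paths s t) w; have := hw; lra.
Qed.

Lemma shifted_sample_close' : uniformly_close eps (polygon (sample N s')) (concat_paths s').
Proof.
by move=> t ht; have := sample_close N0 cl' s'0 fine' ht; have := e0; lra.
Qed.

Lemma shifted_sample_position :
  general_position [seq x + w | x <- sample N s] (sample N s').
Proof.
move=> e f; rewrite cyclic_pairs_map => /mapP[[a b] /mem_cyclic_pairs /andP[/= ha hb] ->].
case: f => p q /mem_cyclic_pairs /andP[/= hp hq] x y hx hy.
exact: generic_pair_position (gen ha hb hp hq) hx hy.
Qed.

Lemma Lk_shifted_sample :
  (forall x y, unit_itv x -> unit_itv y -> 8 * eps <= `|concat_paths s x - concat_paths s' y|) ->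
  approximable (concat_paths s) (concat_paths s') ->
  Lk (concat_paths s) (concat_paths s') = shifted_lk w (sample N s) (sample N s').
Proof.
move=> far app.
rewrite (@LkE _ _ _ eps [seq x + w | x <- sample N s] (sample N s')) //.
- by rewrite /polygon_lk cyclic_pairs_map big_map.
- by rewrite -size_eq0 size_map size_eq0 sample_neq0.
- exact: sample_neq0.
- exact: shifted_sample_close.
- exact: shifted_sample_close'.
- exact: shifted_sample_position.
Qed.

End SampledChains.

Lemma chain_approximable (R : realType) (s s' : seq (R -> 'rV[R]_3)) :
  closed_chain s -> closed_chain s' -> s != [::] -> s' != [::] ->
  (forall i, (i < size s)%N -> finely_sampled (nth (fun=> 0) s i)) ->
  (forall i, (i < size s')%N -> finely_sampled (nth (fun=> 0) s' i)) ->
  approximable (concat_paths s) (concat_paths s').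
Proof.
move=> cl cl' s0 s'0 cs cs' eps e0; have e20 : 0 < eps / 2 by rewrite divr_gt0.
have [M hM] := @fin_eventually _ (fun (i : 'I_(size s)) m =>
  fine_sampling m.+1 (eps / 2) (nth (fun=> 0) s i))
  (fun i => cs i (ltn_ord i) _ e20).
have [M' hM'] := @fin_eventually _ (fun (i : 'I_(size s')) m =>
  fine_sampling m.+1 (eps / 2) (nth (fun=> 0) s' i))
  (fun i => cs' i (ltn_ord i) _ e20).
pose N := (maxn M M').+1.
have [w hw gen] := exists_generic_shift (sample N s) (sample N s') e20.
exists [seq x + w | x <- sample N s], (sample N s'); split.
- by rewrite -size_eq0 size_map size_eq0 sample_neq0.
- exact: sample_neq0.
- apply: shifted_sample_close => // i hi.
  by apply: (hM _ (Ordinal hi)); rewrite leq_maxl.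
- apply: shifted_sample_close' => // i hi.
  by apply: (hM' _ (Ordinal hi)); rewrite leq_maxr.
- exact: shifted_sample_position.
Qed.

(** The crossing number of two open arcs. It depends on [N] and [w]; only its sums over cycles are
    linking numbers. *)
Definition arc_lk (R : realType) (N : nat) (w : 'rV[R]_3) (f g : R -> 'rV[R]_3) : int :=
  \sum_(0 <= j < N) \sum_(0 <= l < N)
    cross_sign (shift_edge w (f (j%:R / N%:R), f (j.+1%:R / N%:R)))
               (g (l%:R / N%:R), g (l.+1%:R / N%:R)).

Lemma shifted_lk_sample (R : realType) (N : nat) (w : 'rV[R]_3)
    (s s' : seq (R -> 'rV[R]_3)) : closed_chain s -> closed_chain s' ->
  shifted_lk w (sample N s) (sample N s') =
  \sum_(f <- s) \sum_(g <- s') arc_lk N w f g.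
Proof.
move=> cl cl'; rewrite /shifted_lk sum_sample //; apply: eq_bigr => f _.
rewrite /arc_lk [RHS]exchange_big /=; apply: eq_bigr => j _.
by rewrite sum_sample.
Qed.

Lemma frac_rev (R : realType) (j N : nat) : (0 < N)%N -> (j <= N)%N ->
  1 - j%:R / N%:R = (N - j)%:R / N%:R :> R.
Proof.
move=> N0 hj; rewrite natrB // mulrBl divff //.
by rewrite pnatr_eq0 -lt0n.
Qed.

Lemma sum_rev_path (R : realType) (N : nat) (f : R -> 'rV[R]_3)
    (F : 'rV[R]_3 * 'rV[R]_3 -> int) : (forall e, F (swap e) = - F e) ->
  \sum_(0 <= j < N) F (rev_path f (j%:R / N%:R), rev_path f (j.+1%:R / N%:R)) =
  - \sum_(0 <= j < N) F (f (j%:R / N%:R), f (j.+1%:R / N%:R)).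
Proof.
move=> anti; rewrite -sumrN big_nat_rev /= add0n; apply: eq_big_nat => j /andP[_ hj].
have N0 : (0 < N)%N by lia.
rewrite /rev_path !frac_rev //; [|lia|lia].
have -> : (N - (N - j.+1) = j.+1)%N by lia.
have -> : (N - (N - j.+1).+1 = j)%N by lia.
exact: (anti (f (j%:R / N%:R), f (j.+1%:R / N%:R))).
Qed.

Lemma arc_lk_revl (R : realType) (N : nat) (w : 'rV[R]_3) (f g : R -> 'rV[R]_3) :
  arc_lk N w (rev_path f) g = - arc_lk N w f g.
Proof.
rewrite /arc_lk (sum_rev_path N f (F := fun e => \sum_(0 <= l < N)
  cross_sign (shift_edge w e) (g (l%:R / N%:R), g (l.+1%:R / N%:R)))) // => e.
by rewrite -sumrN; apply: eq_bigr => l _; exact: (cross_sign_swapl (shift_edge w e)).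
Qed.

Lemma arc_lk_revr (R : realType) (N : nat) (w : 'rV[R]_3) (f g : R -> 'rV[R]_3) :
  arc_lk N w f (rev_path g) = - arc_lk N w f g.
Proof.
rewrite /arc_lk -sumrN; apply: eq_bigr => j _.
by apply: (sum_rev_path N g (F := cross_sign _)) => e; exact: cross_sign_swapr.
Qed.

Lemma eq_arc_lkr (R : realType) (N : nat) (w : 'rV[R]_3) (f g g' : R -> 'rV[R]_3) :
  (forall t, unit_itv t -> g t = g' t) -> arc_lk N w f g = arc_lk N w f g'.
Proof.
move=> h; apply: eq_bigr => j _; apply: eq_big_nat => l /andP[_ hl].
by rewrite !h //; apply: unit_itv_frac => //; exact: ltnW.
Qed.

(** * The linking numbers of the cycles of the two graphs *)

Definition theta_chain (R : realType) (e : 'I_3 -> R -> 'rV[R]_3) (c : 'I_3 * 'I_3) :=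
  [:: e c.1; rev_path (e c.2)].

Definition complete_chain (R : realType) (n : nat) (a : 'I_n -> 'I_n -> R -> 'rV[R]_3)
    (s : seq 'I_n) := [seq a p.1 p.2 | p <- cyclic_pairs s].

Lemma theta_chain_closed (R : realType) (e : 'I_3 -> R -> 'rV[R]_3) (c : 'I_3 * 'I_3) :
  theta_embedding e -> closed_chain (theta_chain e c).
Proof.
move=> he [|[|//]] _ /=; rewrite /rev_path ?subr0 ?subrr.
  exact: theta_tgt.
exact: theta_src.
Qed.

Lemma cyclic_pairs_neq (T : eqType) (s : seq T) (e : T * T) :
  uniq s -> (1 < size s)%N -> e \in cyclic_pairs s -> e.1 != e.2.
Proof.
case: s => // x0 s; set s' := x0 :: s => us hs /(nthP (x0, x0)) [k].
rewrite size_cyclic_pairs => hk <-; rewrite nth_cyclic_pairs //=.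
rewrite nth_uniq // ?ltn_mod //; have [h|h] := ltnP k.+1 (size s').
  by rewrite modn_small // neq_ltn leqnn.
have -> : k.+1 = size s' by apply/eqP; rewrite eqn_leq hk h.
by rewrite modnn; apply/eqP => k0; rewrite k0 in h; lia.
Qed.

Lemma nth_complete_chain (R : realType) (n : nat) (a : 'I_n -> 'I_n -> R -> 'rV[R]_3)
    (s : seq 'I_n) (i : nat) : is_complete_cycle s -> (i < size s)%N ->
  exists x0 : 'I_n, let j := nth x0 s i in let k := nth x0 s (i.+1 %% size s) in
    j != k /\ nth (fun=> 0) (complete_chain a s) i = a j k.
Proof.
case: s => // x0 s; set s' := x0 :: s => /andP[us hs] hi; exists x0 => /=.
rewrite (nth_map (x0, x0)) ?size_cyclic_pairs // nth_cyclic_pairs //; split => //.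
have := @cyclic_pairs_neq _ s' (nth (x0, x0) (cyclic_pairs s') i) us (ltnW hs).
by rewrite mem_nth ?size_cyclic_pairs // nth_cyclic_pairs //; apply.
Qed.

Lemma size_complete_chain (R : realType) (n : nat) (a : 'I_n -> 'I_n -> R -> 'rV[R]_3)
    (s : seq 'I_n) : size (complete_chain a s) = size s.
Proof. by rewrite size_map size_cyclic_pairs. Qed.

Lemma complete_chain_closed (R : realType) (n : nat) (v : 'I_n -> 'rV[R]_3)
    (a : 'I_n -> 'I_n -> R -> 'rV[R]_3) (s : seq 'I_n) :
  complete_embedding v a -> is_complete_cycle s -> closed_chain (complete_chain a s).
Proof.
move=> ha hs i; rewrite size_complete_chain => hi.
have hi' : (i.+1 %% size s < size s)%N by rewrite ltn_mod (leq_ltn_trans _ hi).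
have [x0 /= [n1 ->]] := nth_complete_chain a hs hi.
have [y0 /= [n2 ->]] := nth_complete_chain a hs hi'.
rewrite (complete_tgt ha) // (complete_src ha) //.
by rewrite (set_nth_default x0).
Qed.

Section GraphLinking.
Variables (R : realType) (n : nat).
Variables (e : 'I_3 -> R -> 'rV[R]_3) (v : 'I_n -> 'rV[R]_3).
Variable a : 'I_n -> 'I_n -> R -> 'rV[R]_3.
Hypotheses (he : theta_embedding e) (ha : complete_embedding v a).
Hypothesis hdisj : disjointly_embedded e a.

Lemma graphs_far :
  exists2 d : R, 0 < d & forall i j k s t, j != k -> unit_itv s -> unit_itv t ->
    d <= `|e i s - a j k t|.
Proof.
have [|M hM] := @fin_eventually ('I_3 * ('I_n * 'I_n))%type (fun ijk m =>
  ijk.2.1 != ijk.2.2 -> forall s t : R, unit_itv s -> unit_itv t ->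
    m.+1%:R^-1 <= `|e ijk.1 s - a ijk.2.1 ijk.2.2 t|).
  move=> [i [j k]] /=; have [->|hjk] := eqVneq j k; first by exists 0%N.
  have [|||d d0 hd] := @unit_itv_dist_pos R (e i) (a j k).
  - exact: theta_cont.
  - exact: (complete_cont ha).
  - by move=> s t hs ht; exact: hdisj.
  exists (Num.truncn d^-1) => m hm _ s t hs ht; apply: le_trans (hd s t hs ht).
  rewrite invf_ple ?posrE ?ltr0n //; apply: ltW.
  by apply: lt_le_trans (truncnS_gt _) _; rewrite ler_nat.
exists M.+1%:R^-1; first by rewrite invr_gt0 ltr0n.
by move=> i j k s t hjk hs ht; apply: (hM M (i, (j, k))).
Qed.

Lemma theta_chain_value (c : 'I_3 * 'I_3) (t : R) : unit_itv t ->
  exists i u, unit_itv u /\ theta_curve e c t = e i u.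
Proof.
move=> ht.
have [i [u [hi hu]]] := concat_paths_value (theta_chain_closed (c := c) he) isT ht.
case: i hi => [|[|//]] _ /= heq.
  by exists c.1, u.
by exists c.2, (1 - u); split; first exact: unit_itv_rev.
Qed.

Lemma complete_chain_value (s : seq 'I_n) (t : R) : is_complete_cycle s -> unit_itv t ->
  exists j k u, [/\ j != k, unit_itv u & complete_curve a s t = a j k u].
Proof.
move=> hs ht.
have s0 : complete_chain a s != [::].
  by rewrite -size_eq0 size_complete_chain; case/andP: hs => _; case: (size s).
have [i [u [hi hu heq]]] := concat_paths_value (complete_chain_closed ha hs) s0 ht.
rewrite size_complete_chain in hi.
have [x0 /= [n1 h]] := nth_complete_chain a hs hi.
by exists (nth x0 s i), (nth x0 s (i.+1 %% size s)), u; rewrite -h.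
Qed.

(** One density [N] and one shift [w] are chosen for the samples of all edges of both graphs. Each
    pair of cycles is then evaluated with these same choices, and its crossing number splits into
    contributions of pairs of edges. *)
Lemma Lk_edges :
  exists Y : 'I_3 -> 'I_n -> 'I_n -> int,
    (forall i j k, j != k -> Y i k j = - Y i j k) /\
    forall c s, is_complete_cycle s ->
      Lk (theta_curve e c) (complete_curve a s) =
      \sum_(p <- cyclic_pairs s) (Y c.1 p.1 p.2 - Y c.2 p.1 p.2).
Proof.
have [d d0 far] := graphs_far.
pose eps := d / 8; have e0 : 0 < eps by rewrite divr_gt0.
have e20 : 0 < eps / 2 by rewrite divr_gt0.
have [M hM] := @fin_eventually _ (fun i m => fine_sampling m.+1 (eps / 2) (e i))
  (fun i => continuous_finely_sampled (@theta_cont _ _ he i) e20).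
have [|M' hM'] := @fin_eventually ('I_n * 'I_n)%type
  (fun jk m => jk.1 != jk.2 -> fine_sampling m.+1 (eps / 2) (a jk.1 jk.2)).
  move=> [j k] /=; have [->|hjk] := eqVneq j k; first by exists 0%N.
  have [M' hM'] := continuous_finely_sampled (complete_cont ha hjk) e20.
  by exists M' => m hm _; exact: hM'.
pose N := (maxn M M').+1.
have fe i : fine_sampling N (eps / 2) (e i) by apply: hM; rewrite leq_maxl.
have fa j k : j != k -> fine_sampling N (eps / 2) (a j k).
  by move=> hjk; apply: (hM' _ (j, k)) => //; rewrite leq_maxr.
have N0 : (0 < N)%N by [].
clearbody N; clear M hM M' hM'.
(* [k] runs up to [N] inclusive, because the reversed edge of a theta cycle is sampled from its
   parameter 1 on. *)
pose A := [seq e i (k%:R / N%:R) | i <- enum 'I_3, k <- iota 0 N.+1].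
pose B := [seq a jk.1 jk.2 (k%:R / N%:R) | jk <- enum {: 'I_n * 'I_n}, k <- iota 0 N.+1].
have [w hw gen] := exists_generic_shift A B e20.
exists (fun i j k => arc_lk N w (e i) (a j k)); split=> [i j k hjk|c s hs].
  rewrite -arc_lk_revr; apply: eq_arc_lkr => t; exact: (complete_rev ha).
have cl := theta_chain_closed (c := c) he; have cl' := complete_chain_closed ha hs.
have s0 : complete_chain a s != [::].
  by rewrite -size_eq0 size_complete_chain; case/andP: hs => _; case: (size s).
have inA x : x \in sample N (theta_chain e c) -> x \in A.
  move=> /mapP[k]; rewrite mem_iota /= => hk ->.
  have hkN : (k %/ N < 2)%N by rewrite ltn_divLR.
  have hj : (k %% N < N)%N by rewrite ltn_mod.
  case: (k %/ N)%N hkN => [|[|//]] _ /=.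
    apply: (allpairs_f (fun i (k : nat) => e i (k%:R / N%:R))); first exact: mem_enum.
    by rewrite mem_iota add0n ltnS (ltnW hj).
  rewrite /rev_path (frac_rev R N0 (ltnW hj)).
  apply: (allpairs_f (fun i (k : nat) => e i (k%:R / N%:R))); first exact: mem_enum.
  by rewrite mem_iota add0n ltnS leq_subr.
have inB x : x \in sample N (complete_chain a s) -> x \in B.
  move=> /mapP[k]; rewrite mem_iota /= size_complete_chain => hk ->.
  have hkN : (k %/ N < size s)%N by rewrite ltn_divLR.
  have [x0 /= [_ ->]] := nth_complete_chain a hs hkN.
  apply: (allpairs_f (fun jk (k : nat) => a jk.1 jk.2 (k%:R / N%:R)) (x := (_, _))).
    exact: mem_enum.
  by rewrite mem_iota add0n ltnS [(_ <= N)%N]ltnW // ltn_mod.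
rewrite (@Lk_shifted_sample R (theta_chain e c) (complete_chain a s) N eps w) //.
- rewrite shifted_lk_sample // big_cons big_seq1.
  rewrite /complete_chain !big_map -big_split /=; apply: eq_bigr => p _.
  by rewrite arc_lk_revl.
- by move=> [|[|//]] _ /=; [|apply: fine_sampling_rev]; exact: fe.
- move=> i; rewrite size_complete_chain => hi.
  by have [x0 /= [hn ->]] := nth_complete_chain a hs hi; exact: fa.
- by move=> x y p q hx hy hp hq; apply: gen; [exact: inA|exact: inA|exact: inB|exact: inB].
- move=> x y hx hy.
  have [i [u [hu]]] := theta_chain_value c hx; rewrite /theta_curve => ->.
  have [j [k [r [hjk hr]]]] := complete_chain_value hs hy; rewrite /complete_curve => ->.
  by have -> : 8 * eps = d by [rewrite /eps; field]; exact: far.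
- apply: chain_approximable => //.
    by move=> [|[|//]] _ /=; [|apply: finely_sampled_rev];
      apply: continuous_finely_sampled; exact: (theta_cont he).
  move=> i; rewrite size_complete_chain => hi.
  have [x0 /= [hn ->]] := nth_complete_chain a hs hi.
  by apply: continuous_finely_sampled; exact: (complete_cont ha).
Qed.

End GraphLinking.

(** * Weakly linked cochains on a complete graph *)

Ltac split_uniq :=
  rewrite /= ?inE ?negb_or -?andbA => ?;
  repeat match goal with H : is_true (_ && _) |- _ => case/andP: H => ? ? end.

Ltac prove_uniq :=
  rewrite /= ?inE ?negb_or -?andbA;
  repeat (apply/andP; split); first [done | assumption | rewrite eq_sym; assumption].

Section WeakCochain.
Variables (n : nat) (y : 'I_n -> 'I_n -> int).
Hypothesis anti : forall k l, y l k = - y k l.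
Hypothesis weak : forall s, is_complete_cycle s ->
  `|\sum_(p <- cyclic_pairs s) y p.1 p.2| <= 1.

(** The coboundary of the cochain [y]. Its values on the four faces of a tetrahedron satisfy the
    cocycle relation, which drives the computations below. *)
Definition triangle_value (a b c : 'I_n) : int := y a b + y b c + y c a.
Local Notation F := triangle_value.

Lemma weak3 a b c : uniq [:: a; b; c] -> -1 <= F a b c <= 1.
Proof.
move=> h; have := weak (s := [:: a; b; c]).
rewrite /is_complete_cycle h /cyclic_pairs /= !big_cons big_nil /F /=.
by move=> /(_ isT); lia.
Qed.

Lemma weak4 a b c d : uniq [:: a; b; c; d] -> -1 <= y a b + y b c + y c d + y d a <= 1.
Proof.
move=> h; have := weak (s := [:: a; b; c; d]).
rewrite /is_complete_cycle h /cyclic_pairs /= !big_cons big_nil /=.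
by move=> /(_ isT); lia.
Qed.

Lemma weak5 a b c d e : uniq [:: a; b; c; d; e] ->
  -1 <= y a b + y b c + y c d + y d e + y e a <= 1.
Proof.
move=> h; have := weak (s := [:: a; b; c; d; e]).
rewrite /is_complete_cycle h /cyclic_pairs /= !big_cons big_nil /=.
by move=> /(_ isT); lia.
Qed.

Lemma weak6 a b c d e f : uniq [:: a; b; c; d; e; f] ->
  -1 <= y a b + y b c + y c d + y d e + y e f + y f a <= 1.
Proof.
move=> h; have := weak (s := [:: a; b; c; d; e; f]).
rewrite /is_complete_cycle h /cyclic_pairs /= !big_cons big_nil /=.
by move=> /(_ isT); lia.
Qed.


Lemma triangle_value_rot a b c : F a b c = F b c a.
Proof. by rewrite /F; lia. Qed.

Lemma triangle_value_swap a b c : F a c b = - F a b c.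
Proof. by rewrite /F (anti a c) (anti c b) (anti b a); lia. Qed.

(* Together the three 6-cycles run twice along each edge of the two triangles, and the edges
   between the triangles cancel; so their values add up to [2 (F a b c + F d e f) = 4]. *)
Lemma no_disjoint_triangles a b c d e f : uniq [:: a; b; c; d; e; f] ->
  F a b c = 1 -> F d e f = 1 -> False.
Proof.
move=> u; rewrite /F => h1 h2; move: (u); split_uniq.
have := weak6 u.
have /weak6 : uniq [:: b; c; a; f; d; e] by prove_uniq.
have /weak6 : uniq [:: c; a; b; e; f; d] by prove_uniq.
rewrite (anti a f) (anti c d) (anti b e).
move: h1 h2; clear; lia.
Qed.

Lemma triangles_meet a b c d e f : uniq [:: a; b; c] -> uniq [:: d; e; f] ->
  F a b c != 0 -> F d e f != 0 -> ~~ uniq [:: a; b; c; d; e; f].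
Proof.
move=> u1 u2 h1 h2; apply/negP => u; move: (u); split_uniq.
have s1 : F a b c = 1 \/ F a c b = 1.
  by rewrite (triangle_value_swap a b c); have := weak3 u1; move: h1; move: (F a b c); clear; lia.
have s2 : F d e f = 1 \/ F d f e = 1.
  by rewrite (triangle_value_swap d e f); have := weak3 u2; move: h2; move: (F d e f); clear; lia.
by case: s1 => g1; case: s2 => g2; apply: (no_disjoint_triangles _ g1 g2); prove_uniq.
Qed.

(** The 4-cycle [a b x c] has the value [F a b c - F b c x], which would be 2 if the second triangle
    had the value -1. *)
Lemma shared_edge_sign a b c x : uniq [:: a; b; c; x] -> F a b c = 1 -> F b c x != 0 ->
  F b c x = 1.
Proof.
move=> u h1 h2; move: (u); split_uniq.
have /weak3 : uniq [:: b; c; x] by prove_uniq.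
have /weak4 : uniq [:: a; b; x; c] by prove_uniq.
move: h1 h2; rewrite /F (anti x c) (anti x b); clear; lia.
Qed.

(** The faces of the tetrahedron give [F a b x + F c a x = F a b c - F b c x = 0], while the
    4-cycles [a x b c] and [a b c x], of values [1 - F a b x] and [1 - F c a x], make both terms
    nonnegative. *)
Lemma shared_edge_unique a b c x : uniq [:: a; b; c; x] -> F a b c = 1 -> F b c x != 0 ->
  F c a x = 0.
Proof.
move=> u h1 h2; move: (u); split_uniq.
have := shared_edge_sign u h1 h2.
have /weak4 : uniq [:: a; x; b; c] by prove_uniq.
have /weak4 : uniq [:: a; b; x; c] by prove_uniq.
have /weak4 : uniq [:: a; b; c; x] by prove_uniq.
have /weak3 : uniq [:: b; c; x] by prove_uniq.
have /weak3 : uniq [:: a; b; x] by prove_uniq.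
have /weak3 : uniq [:: c; a; x] by prove_uniq.
move: h1 h2; rewrite /F (anti x a) (anti x b) (anti x c); clear; lia.
Qed.

(* The value of the 6-cycle [a z b x c y0] is [F a b c] minus the three other values. *)
Lemma no_three_neighbours a b c x y0 z : uniq [:: a; b; c; x; y0; z] ->
  F a b c = 1 -> F b c x = 1 -> F c a y0 = 1 -> F a b z = 1 -> False.
Proof.
move=> u; move: (u); split_uniq.
have /weak6 : uniq [:: a; z; b; x; c; y0] by prove_uniq.
rewrite /F (anti z a) (anti z b) (anti x b) (anti x c) (anti y0 c) (anti y0 a); clear; lia.
Qed.

(** As [b c x] and [b c z] have the value 0, the 5-cycles [a b x z c] and [a b z x c] have the
    values [1 + F b x z] and [1 - F b x z], both at most 1. The tetrahedron [b c x z] then transfers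
    the result to [F c x z]. *)
Lemma pentagon_vanish a b c x z : uniq [:: a; b; c; x; z] ->
  F a b c = 1 -> F b c x = 0 -> F b c z = 0 -> F b x z = 0 /\ F c x z = 0.
Proof.
move=> u h h1 h2; move: (u); split_uniq.
suff : F b x z = 0.
  move: h h1 h2; rewrite /F (anti b z) (anti c z) (anti c b) (anti x b) (anti x c).
  by clear; lia.
apply/eqP/negPn/negP => /eqP h3.
have /weak4 : uniq [:: a; b; c; x] by prove_uniq.
have /weak4 : uniq [:: a; b; x; c] by prove_uniq.
have /weak4 : uniq [:: a; c; b; x] by prove_uniq.
have /weak4 : uniq [:: a; b; c; z] by prove_uniq.
have /weak4 : uniq [:: a; b; z; c] by prove_uniq.
have /weak4 : uniq [:: a; c; b; z] by prove_uniq.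
have /weak4 : uniq [:: a; b; x; z] by prove_uniq.
have /weak4 : uniq [:: a; b; z; x] by prove_uniq.
have /weak4 : uniq [:: a; x; b; z] by prove_uniq.
have /weak4 : uniq [:: a; c; x; z] by prove_uniq.
have /weak4 : uniq [:: a; c; z; x] by prove_uniq.
have /weak4 : uniq [:: a; x; c; z] by prove_uniq.
have /weak3 : uniq [:: a; b; c] by prove_uniq.
have /weak3 : uniq [:: a; b; x] by prove_uniq.
have /weak3 : uniq [:: a; b; z] by prove_uniq.
have /weak3 : uniq [:: a; c; x] by prove_uniq.
have /weak3 : uniq [:: a; c; z] by prove_uniq.
have /weak3 : uniq [:: a; x; z] by prove_uniq.
have /weak3 : uniq [:: b; x; z] by prove_uniq.
have /weak5 : uniq [:: a; b; x; z; c] by prove_uniq.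
have /weak5 : uniq [:: a; b; z; x; c] by prove_uniq.
move: h h1 h2 h3; rewrite /F ?(anti a b) ?(anti a c) ?(anti a x) ?(anti a z)
  ?(anti b c) ?(anti b x) ?(anti b z) ?(anti c x) ?(anti c z) ?(anti x z).
clear; lia.
Qed.

(** By [pentagon_vanish], a linked triangle that avoids [a] avoids [b] and [c] too. It would be
    disjoint from the linked triangle [a b c], against [triangles_meet]. *)
Lemma no_neighbour_common a b c : uniq [:: a; b; c] -> F a b c = 1 ->
  (forall x, x \notin [:: a; b; c] -> F b c x = 0) ->
  forall u v w, uniq [:: u; v; w] -> F u v w != 0 -> a \in [:: u; v; w].
Proof.
move=> uabc h nb u v w uuvw hF; apply: contraT => na; exfalso.
have through s t : uniq [:: b; s; t] -> a != s -> a != t -> F b s t = 0.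
  move=> u3 as_ at_; move: (uabc) (u3); do 2 split_uniq.
  have [es|ns] := eqVneq s c.
    by subst s; apply: nb; prove_uniq.
  have [et|nt] := eqVneq t c.
    by subst t; rewrite triangle_value_swap nb ?oppr0 //; prove_uniq.
  have u5 : uniq [:: a; b; c; s; t] by prove_uniq.
  by have [] := pentagon_vanish u5 h; try apply: nb; prove_uniq.
have through' s t : uniq [:: c; s; t] -> a != s -> a != t -> F c s t = 0.
  move=> u3 as_ at_; move: (uabc) (u3); do 2 split_uniq.
  have [es|ns] := eqVneq s b.
    by subst s; rewrite triangle_value_swap -triangle_value_rot through ?oppr0 //; prove_uniq.
  have [et|nt] := eqVneq t b.
    by subst t; rewrite -triangle_value_rot through //; prove_uniq.
  have u5 : uniq [:: a; b; c; s; t] by prove_uniq.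
  by have [] := pentagon_vanish u5 h; try apply: nb; prove_uniq.
(* The corners of [u v w] are shown to differ from [b] and [c] one at a time, rotating the triangle
   to bring the corner in question to the front. *)
have := triangles_meet uabc uuvw _ hF; rewrite h => /(_ isT) /negP; apply.
move: na (uuvw) (uabc); do 3 split_uniq.
have nz s t r : F s t r = 0 -> F s t r != 0 -> False by move=> ->; rewrite eqxx.
have b_u : b != u.
  by apply/eqP => E; subst u; apply: nz hF; apply: through; prove_uniq.
have c_u : c != u.
  by apply/eqP => E; subst u; apply: nz hF; apply: through'; prove_uniq.
rewrite triangle_value_rot in hF.
have b_v : b != v.
  by apply/eqP => E; subst v; apply: nz hF; apply: through; prove_uniq.
have c_v : c != v.
  by apply/eqP => E; subst v; apply: nz hF; apply: through'; prove_uniq.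
rewrite triangle_value_rot in hF.
have b_w : b != w.
  by apply/eqP => E; subst w; apply: nz hF; apply: through; prove_uniq.
have c_w : c != w.
  by apply/eqP => E; subst w; apply: nz hF; apply: through'; prove_uniq.
prove_uniq.
Qed.

Definition common_to (p : 'I_n) : Prop :=
  forall u v w, uniq [:: u; v; w] -> F u v w != 0 -> p \in [:: u; v; w].

(** If some edge of a linked triangle carries no other linked triangle, the opposite corner is
    common by [no_neighbour_common]. Otherwise three neighbours exist, and [no_three_neighbours]
    excludes them. *)
Lemma star_center : (0 < n)%N -> exists p, common_to p.
Proof.
move=> n0.
have [[a [b [c [u h]]]]|none] :=
    pselect (exists a b c, uniq [:: a; b; c] /\ F a b c = 1); last first.
  exists (Ordinal n0) => u v w uuvw /eqP h; exfalso; apply: none.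
  have := weak3 uuvw => hw; have [h1|h1] := eqVneq (F u v w) 1; first by exists u, v, w.
  exists u, w, v; split; first by move: uuvw; split_uniq; prove_uniq.
  by rewrite triangle_value_swap; move: h h1 hw; move: (F u v w); clear; lia.
move: (u); split_uniq.
have [h1|/existsNP[x]] :=
  pselect (forall x, x \notin [:: a; b; c] -> F b c x = 0).
  by exists a; exact: (no_neighbour_common u h h1).
have [h2|/existsNP[z]] :=
  pselect (forall x, x \notin [:: b; c; a] -> F c a x = 0).
  exists b; apply: (@no_neighbour_common b c a) => //; first by prove_uniq.
  by rewrite -triangle_value_rot.
have [h3|/existsNP[t]] :=
  pselect (forall x, x \notin [:: c; a; b] -> F a b x = 0).
  exists c; apply: (@no_neighbour_common c a b) => //; first by prove_uniq.
  by rewrite triangle_value_rot.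
move=> /not_implyP[nt /eqP ht] /not_implyP[nz /eqP hz] /not_implyP[nx /eqP hx].
exfalso; move: nt nz nx; do 3 split_uniq.
have ux : uniq [:: a; b; c; x] by prove_uniq.
have uz : uniq [:: b; c; a; z] by prove_uniq.
have ut : uniq [:: c; a; b; t] by prove_uniq.
have hb : F b c a = 1 by rewrite -triangle_value_rot.
have hc : F c a b = 1 by rewrite triangle_value_rot.
have sx := shared_edge_sign ux h hx; have sz := shared_edge_sign uz hb hz.
have st := shared_edge_sign ut hc ht.
have nx := shared_edge_unique ux h hx; have nz := shared_edge_unique uz hb hz.
have nt := shared_edge_unique ut hc ht.
apply: (@no_three_neighbours a b c x z t) => //.
(* The apexes differ because [shared_edge_unique] allows a given vertex to span a linked triangle
   with only one edge of [a b c]. *)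
have x_z : x != z by apply: contraNneq hz => <-; rewrite nx.
have z_t : z != t by apply: contraNneq ht => <-; rewrite nz.
have t_x : t != x by apply: contraNneq hx => <-; rewrite nt.
prove_uniq.
Qed.

End WeakCochain.

(** * The three stars of a theta curve *)

Lemma ord3_third (i j : 'I_3) : i != j -> exists k, [/\ k != i, k != j,
  (forall l, [\/ l = i, l = j | l = k]) &
  forall f : 'I_3 -> int, \sum_l f l = f i + f j + f k].
Proof.
move=> hij; pose k := \sum_(l : 'I_3 | (l != i) && (l != j)) l.
have [k' hk1 hk2] : exists2 k', k' != i & k' != j.
  by case: i j hij {k} => [[|[|[|//]]] hi] [[|[|[|//]]] hj] // _;
  [exists 2|exists 1|exists 2|exists 0|exists 1|exists 0].
have cover l : [\/ l = i, l = j | l = k'].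
  move: hij hk1 hk2; rewrite -!val_eqE => h1 h2 h3.
  have [e|n1] := eqVneq l i; first exact: Or31.
  have [e|n2] := eqVneq l j; first exact: Or32.
  apply: Or33; apply: val_inj; move: n1 n2 h1 h2 h3; rewrite -!val_eqE /=.
  by case: i j k' l {k} => [i hi] [j hj] [k hk] [l hl] /=; lia.
exists k'; split => // f.
rewrite (bigD1 i) //= (bigD1 j) 1?eq_sym //= addrA (big_pred1 k') // => l /=.
have [->|->|->] := cover l.
- by rewrite eqxx /= eq_sym (negPf hk1).
- by rewrite eqxx andbF eq_sym (negPf hk2).
- by rewrite hk1 hk2 eqxx.
Qed.

Section StarFormula.
Variables (n : nat) (y : 'I_n -> 'I_n -> int).
Hypothesis anti : forall k l, y l k = - y k l.
Local Notation F := (triangle_value y).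

(** Only triangles that start at [p] have to be checked: those avoiding [p] have the value 0 by
    [common_to], and both sides are invariant under rotation. *)
Lemma star_formula (p : 'I_n) (O I : {set 'I_n}) :
  star_partition p O I -> common_to y p ->
  (forall z w, z != p -> w != p -> z != w ->
     F p z w = ((z \in O) && (w \in I))%:Z - ((w \in O) && (z \in I))%:Z) ->
  forall x z w, uniq [:: x; z; w] ->
    F x z w = if in_star p O I x z w then 1 else if in_star p O I w z x then -1 else 0.
Proof.
move=> [dis cov] com form.
have pO : p \in O = false.
  by apply/negbTE/negP => h; have := finset.in_setU p O I; rewrite cov h !inE eqxx.
have pI : p \in I = false.
  by apply/negbTE/negP => h; have := finset.in_setU p O I; rewrite cov h !inE eqxx orbT.
have nOI x : x \in O -> x \in I = false.
  by move=> hx; exact: (disjointFr dis hx).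
have base z w : z != p -> w != p -> z != w ->
    F p z w = if in_star p O I p z w then 1 else if in_star p O I w z p then -1 else 0.
  move=> hz hw hzw; rewrite form // /in_star (negPf hz) (negPf hw) eqxx /= ?orbF.
  have := nOI z; have := nOI w.
  by case: (z \in O); case: (z \in I); case: (w \in O); case: (w \in I) => //= h1 h2;
    rewrite ?(h1 isT) ?(h2 isT) //; first [move: (h1 isT) | move: (h2 isT)].
have rot x z w : in_star p O I x z w = in_star p O I z w x.
  by rewrite /in_star orbC -orbA.
move=> x z w u.
have [|np] := boolP (p \in [:: x; z; w]); last first.
  have [->|hF] := eqVneq (F x z w) 0; last by rewrite (com _ _ _ u hF) in np.
  move: np; rewrite !inE !negb_or ![p == _]eq_sym => /and3P[hx hz hw].
  by rewrite /in_star (negPf hx) (negPf hz) (negPf hw).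
move: (u); rewrite !inE => + /or3P[] /eqP E; subst p; split_uniq.
- by apply: base; rewrite // eq_sym.
- rewrite triangle_value_rot [in_star _ _ _ x z w]rot -[in_star _ _ _ w z x]rot.
  by apply: base; rewrite // eq_sym.
- rewrite -triangle_value_rot -[in_star _ _ _ x z w]rot [in_star _ _ _ w z x]rot.
  by apply: base; rewrite // eq_sym.
Qed.

End StarFormula.

(** * Stars with a known center *)

Lemma ord3_other (i : 'I_3) : exists j : 'I_3, i != j.
Proof. by exists (if i == 0 then 1 else 0); have [->|] := eqVneq i 0. Qed.

Lemma triangle_value_degenerate (n : nat) (y : 'I_n -> 'I_n -> int) (a b c : 'I_n) :
  (forall k l, y l k = - y k l) -> ~~ uniq [:: a; b; c] -> triangle_value y a b c = 0.
Proof.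
move=> anti; have zero k : y k k = 0 by have := anti k k; clear; lia.
rewrite /triangle_value; have [->|ab] := eqVneq a b.
  by rewrite zero (anti b c); clear; lia.
have [->|ac] := eqVneq a c; first by rewrite zero (anti c b); clear; lia.
have [->|bc] := eqVneq b c; first by rewrite zero (anti a c); clear; lia.
by rewrite /= !inE negb_or ab ac bc.
Qed.

Section StarCenter.
Variables (n : nat) (y : 'I_n -> 'I_n -> int).
Hypothesis anti : forall k l, y l k = - y k l.
Hypothesis weak : forall s, is_complete_cycle s ->
  `|\sum_(p <- cyclic_pairs s) y p.1 p.2| <= 1.
Variables (p q : 'I_n).
Hypotheses (com : common_to y p) (pq : q != p).
Local Notation F := (triangle_value y).

(* If [p] is common to all linked triangles, [y] is exact off [p] and this is its potential along
   the edges from [p]; it takes at most two values, which are the sides of the star. *)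
Definition star_height (x : 'I_n) : int := F p x q.

Lemma star_height_base : star_height q = 0.
Proof. by apply: triangle_value_degenerate => //=; rewrite !inE eqxx andbF. Qed.

(** The triangle [x w q] avoids [p] and has the value 0; the other three faces of the tetrahedron
    [p x w q] give the formula. *)
Lemma star_heightB (x w : 'I_n) : x != p -> w != p ->
  F p x w = star_height x - star_height w.
Proof.
move=> hx hw; have : F x w q = 0.
  have [u|nu] := boolP (uniq [:: x; w; q]); last exact: triangle_value_degenerate.
  have [//|h] := eqVneq (F x w q) 0; have := com u h.
  by rewrite !inE ![p == _]eq_sym (negPf hx) (negPf hw) (negPf pq).
rewrite /star_height /F (anti p w) (anti x q); clear; lia.
Qed.

Lemma star_height_bound (x w : 'I_n) : x != p -> w != p ->
  -1 <= star_height x - star_height w <= 1.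
Proof.
move=> hx hw; rewrite -star_heightB //.
have [u|nu] := boolP (uniq [:: p; x; w]); first exact: weak3.
by rewrite triangle_value_degenerate.
Qed.

End StarCenter.

Section ThetaTriple.
Variables (n : nat) (y : 'I_3 -> 'I_n -> 'I_n -> int).
Hypothesis anti : forall i k l, y i l k = - y i k l.
Hypothesis weak : forall i s, is_complete_cycle s ->
  `|\sum_(p <- cyclic_pairs s) y i p.1 p.2| <= 1.
Hypothesis sum0 : forall k l, \sum_i y i k l = 0.
Local Notation F i := (triangle_value (y i)).

Lemma triangle_value_sum0 (a b c : 'I_n) : \sum_i F i a b c = 0.
Proof. by rewrite /triangle_value !big_split /= !sum0. Qed.

Definition stars_share_center (p : 'I_n) (I : 'I_3 -> {set 'I_n}) (b : bool) : Prop :=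
  [/\ forall i j, i != j -> [disjoint I i & I j],
      forall i j, I i = finset.set0 -> I j = finset.set0 -> i = j,
      \bigcup_i I i = [set~ p] &
      forall i, star_partition p (\bigcup_(j | j != i) I j) (I i) /\
        forall x z w, uniq [:: x; z; w] -> F i x z w *~ (-1) ^+ b =
          if in_star p (\bigcup_(j | j != i) I j) (I i) x z w then 1
          else if in_star p (\bigcup_(j | j != i) I j) (I i) w z x then -1 else 0].

(* [I i] is the lower level set of the height of [i]; it is empty if the height is constant. *)
Lemma shared_center_plus (p q : 'I_n) : (forall i, common_to (y i) p) -> q != p ->
  (exists i x, x != p /\ star_height (y i) p q x != 0) ->
  (forall i j x w, x != p -> w != p -> star_height (y i) p q x = 1 ->
     star_height (y j) p q w = 1 -> i = j) ->
  exists I, stars_share_center p I false.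
Proof.
move=> com pq nz atmost; pose g i x := star_height (y i) p q x.
have gq i : g i q = 0 by exact: star_height_base.
have gb i x w : x != p -> w != p -> -1 <= g i x - g i w <= 1.
  by move=> hx hw; apply: (star_height_bound (anti i) (@weak i) (com i) pq).
have gs x : \sum_i g i x = 0 by exact: triangle_value_sum0.
have g1 i x : x != p -> [\/ g i x = -1, g i x = 0 | g i x = 1].
  move=> hx; have := gb i x q hx pq; rewrite gq subr0 => h.
  have : g i x = -1 \/ g i x = 0 \/ g i x = 1 by move: h; clear; lia.
  by move=> [|[]]; [exact: Or31 | exact: Or32 | exact: Or33].
pose plus i := [exists x, (x != p) && (g i x == 1)].
have plusP i x : x != p -> g i x = 1 -> plus i.
  by move=> hx h; apply/existsP; exists x; rewrite hx h eqxx.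
have plus_uniq i j : plus i -> plus j -> i = j.
  move=> /existsP[x /andP[hx /eqP h]] /existsP[w /andP[hw /eqP h']].
  exact: (atmost i j x w hx hw h h').
have plus_min i x : x != p -> plus i -> 0 <= g i x.
  move=> hx /existsP[w /andP[hw /eqP h]]; have := gb i x w hx hw; rewrite h; clear; lia.
have notplus i x : x != p -> ~~ plus i -> g i x != 1.
  by move=> hx; apply: contra => /eqP; exact: plusP.
(* As [q] has height 0 and heights differ by at most 1, they range in [{0, 1}] if 1 occurs and in
   [{-1, 0}] otherwise; the lower end is selected. *)
pose I i := [set x | (x != p) && (g i x == if plus i then 0 else -1)].
have third i j x : i != j -> exists k, [/\ k != i, k != j & g i x + g j x + g k x = 0].
  by move=> /ord3_third[k [h1 h2 _ h3]]; exists k; have := h3 (g^~ x); rewrite /= gs => <-.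
(* Since the heights add up to 0, a point of two lower level sets has third height 1 or 2. The value
   2 is impossible, and 1 would give [plus] to a second index. *)
have dis i j x : i != j -> x \in I i -> x \notin I j.
  move=> hij; rewrite !inE => /andP[hx /eqP hi]; rewrite hx /=; apply/negP => /eqP hj.
  have [k [ki kj hk]] := third i j x hij.
  have := g1 k x hx; move: hi hj hk.
  case: ifP => pi; case: ifP => pj.
  - by move: hij; rewrite (plus_uniq i j pi pj) eqxx.
  - move=> -> -> hk [|h|h]; [by move: hk; clear; lia | by move: hk h; clear; lia |].
    by move: ki; rewrite (plus_uniq k i (plusP _ _ hx h) pi) eqxx.
  - move=> -> -> hk [|h|h]; [by move: hk; clear; lia | by move: hk h; clear; lia |].
    by move: kj; rewrite (plus_uniq k j (plusP _ _ hx h) pj) eqxx.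
  - by move=> -> -> hk [|h|h]; move: hk; rewrite ?h; clear; lia.
(* If no height is -1 at [x], all are 0 there, and [x] lies in the lower level set of an index with
   [plus]. Such an index exists, as some height is nonzero somewhere and the sum is 0. *)
have cover x : x != p -> exists i, x \in I i.
  move=> hx; have [/existsP[i /eqP hi]|none] := boolP [exists i, g i x == -1].
    exists i; rewrite !inE hx hi; case: ifP => // pi.
    by have := plus_min i x hx pi; rewrite hi.
  have none' i : g i x != -1 by move: none; rewrite negb_exists => /forallP.
  have gx i : g i x = 0.
    have [j hj] := ord3_other i.
    have [k [_ _ hk]] := third i j x hj.
    move: (none' i) (none' j) (none' k) (g1 i x hx) (g1 j x hx) (g1 k x hx) hk.
    by move=> /eqP ? /eqP ? /eqP ? [|h1|h1] // [|h2|h2] // [|h3|h3] //; lia.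
  have [i pi] : exists i, plus i.
    have [i [w [hw hi]]] := nz; rewrite -/(g i w) in hi.
    have [j hj] := ord3_other i.
    have [k [_ _ hk]] := third i j w hj.
    case: (g1 i w hw) => h1; [|by rewrite h1 eqxx in hi|by exists i; exact: plusP h1].
    case: (g1 j w hw) => h2; [|  |by exists j; exact: plusP h2].
      by case: (g1 k w hw) => h3; [| |exists k; exact: plusP h3]; lia.
    by case: (g1 k w hw) => h3; [| |exists k; exact: plusP h3]; lia.
  by exists i; rewrite !inE hx gx pi.
have inO i x : (x \in \bigcup_(j | j != i) I j) = (x != p) && (x \notin I i).
  apply/bigcupP/andP => [[j hj hx]|[hx nx]].
    split; first by move: hx; rewrite inE => /andP[].
    by apply: (dis j i).
  have [j hj] := cover x hx; exists j => //.
  by apply: contraNneq nx => <-.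
exists I; split.
- move=> i j hij; rewrite disjoint_subset; apply/fintype.subsetP => x hx.
  by rewrite inE; exact: dis hij hx.
(* An empty [I l] forces height 0 everywhere: [q] rules out [plus l], and -1 does not occur. Two
   such indices make the third height vanish as well, against [nz]. *)
- move=> i j hi hj; apply/eqP/negPn/negP => hij.
  have nop l : I l = finset.set0 -> ~~ plus l.
    move=> hl; apply/negP => pl; have : q \in I l by rewrite !inE pq gq pl.
    by rewrite hl inE.
  have z l x : x != p -> I l = finset.set0 -> g l x = 0.
    move=> hx hl; have pl := nop l hl; case: (g1 l x hx) => // h.
      have : x \in I l by rewrite !inE hx h (negPf pl) eqxx.
      by rewrite hl inE.
    by have := notplus l x hx pl; rewrite h eqxx.
  have [k [_ _ cov sm]] := ord3_third hij.
  have [l [x [hx hl]]] := nz; rewrite -/(g l x) in hl.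
  have := gs x; rewrite sm (z i) // (z j) // !add0r => hk.
  move: hl; case: (cov l) => ->; first by rewrite (z i).
    by rewrite (z j).
  by rewrite hk eqxx.
- apply/setP => x; rewrite !inE; apply/bigcupP/idP => [[i _]|hx].
    by rewrite !inE => /andP[].
  by have [i hi] := cover x hx; exists i.
- move=> i; have part : star_partition p (\bigcup_(j | j != i) I j) (I i).
    split.
      rewrite disjoint_subset; apply/fintype.subsetP => x; rewrite inO => /andP[_ h].
      by rewrite inE.
    apply/setP => x; rewrite finset.in_setU inO [in X in _ || X]inE !inE.
    by case: (x != p) => //=; case: (_ == _).
  split=> // x z w u; rewrite expr0 mulr1z.
  apply: star_formula => // {x z w u} z w hz hw hzw.
  rewrite (star_heightB (anti i) (com i) pq) // -/(g i z) -/(g i w) !inO !inE hz hw /=.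
  have := gb i z w hz hw; case: ifP => pi.
    have := plus_min i z hz pi; have := plus_min i w hw pi.
    by case: (g1 i z hz) => ->; case: (g1 i w hw) => ->.
  have := notplus i z hz (negbT pi); have := notplus i w hw (negbT pi).
  by case: (g1 i z hz) => ->; case: (g1 i w hw) => ->.
Qed.

End ThetaTriple.

Lemma triangle_value_opp (n : nat) (y : 'I_n -> 'I_n -> int) (a b c : 'I_n) :
  triangle_value (fun k l => - y k l) a b c = - triangle_value y a b c.
Proof. by rewrite /triangle_value !opprD. Qed.

Lemma triangle_value_third (n : nat) (y : 'I_n -> 'I_n -> int) (a b u v w : 'I_n) :
  (forall k l, y l k = - y k l) -> uniq [:: u; v; w] -> triangle_value y u v w != 0 ->
  a \in [:: u; v; w] -> b \in [:: u; v; w] -> a != b ->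
  exists x, [/\ x \in [:: u; v; w], x != a, x != b & triangle_value y a b x != 0].
Proof.
move=> anti; split_uniq => hF.
have sw x z t : (triangle_value y x z t != 0) = (triangle_value y x t z != 0).
  by rewrite (triangle_value_swap anti x t z) oppr_eq0.
have [h1 h2 h3] : [/\ v != u, w != u & w != v] by split; rewrite eq_sym.
have rot x z t : triangle_value y x z t = triangle_value y z t x.
  exact: triangle_value_rot.
move=> /or3P[] /eqP -> /or3P[] /eqP ->; rewrite ?eqxx // => _.
- by exists w; rewrite !inE eqxx !orbT.
- by exists v; rewrite !inE eqxx !orbT; split=> //; rewrite sw.
- by exists w; rewrite !inE eqxx !orbT; split=> //; rewrite sw -rot.
- by exists u; rewrite !inE eqxx; split=> //; rewrite -rot.
- by exists v; rewrite !inE eqxx !orbT; split=> //; rewrite rot.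
- by exists u; rewrite !inE eqxx; split=> //; rewrite sw rot.
Qed.

Section ThetaTriple.
Variables (n : nat) (y : 'I_3 -> 'I_n -> 'I_n -> int).
Hypothesis anti : forall i k l, y i l k = - y i k l.
Hypothesis weak : forall i s, is_complete_cycle s ->
  `|\sum_(p <- cyclic_pairs s) y i p.1 p.2| <= 1.
Hypothesis sum0 : forall k l, \sum_i y i k l = 0.
Local Notation F i := (triangle_value (y i)).

(* Heights taking the value 1 range in [{0, 1}], the others in [{-1, 0}], and the three heights
   add up to 0; so if two of them take the value 1, at most one takes the value -1, and the
   orientation has to be reversed. *)
Lemma shared_center (p q : 'I_n) : (forall i, common_to (y i) p) -> q != p ->
  (exists i x, x != p /\ star_height (y i) p q x != 0) ->
  exists I b, stars_share_center y p I b.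
Proof.
move=> com pq nz.
have [atmost|] := pselect (forall i j x w, x != p -> w != p ->
    star_height (y i) p q x = 1 -> star_height (y j) p q w = 1 -> i = j).
  by have [I hI] := shared_center_plus anti weak sum0 com pq nz atmost; exists I, false.
move=> /existsNP[i /existsNP[j /existsNP[x /existsNP[w]]]].
move=> /not_implyP[hx /not_implyP[hw /not_implyP[gi /not_implyP[gj /eqP hij]]]].
have [k [_ _ cov _]] := ord3_third hij.
pose y' l (a b : 'I_n) : int := - y l a b.
have anti' l a b : y' l b a = - y' l a b by rewrite /y' (anti l).
have weak' l s : is_complete_cycle s -> `|\sum_(e <- cyclic_pairs s) y' l e.1 e.2| <= 1.
  by move=> hs; rewrite /y' sumrN normrN; exact: weak.
have sum0' a b : \sum_l y' l a b = 0 by rewrite /y' sumrN sum0 oppr0.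
have F' l a b c : triangle_value (y' l) a b c = - F l a b c := triangle_value_opp _ _ _ _.
have com' l : common_to (y' l) p.
  by move=> a b c u; rewrite F' oppr_eq0; exact: com.
(* Heights of one index differ by at most 1. As [i] and [j] take the value 1 before the reversal,
   they do not take -1, so after it only [k] can take the value 1. *)
have only l z : z != p -> star_height (y' l) p q z = 1 -> l = k.
  rewrite /star_height F' => hz h.
  have bd m := star_height_bound (anti m) (@weak m) (com m) pq.
  case: (cov l) => E //; subst l; exfalso.
    by have := bd i x z hx hz; rewrite gi /star_height; move: h; clear; lia.
  by have := bd j w z hw hz; rewrite gj /star_height; move: h; clear; lia.
have [||I [h1 h2 h3 h4]] := shared_center_plus anti' weak' sum0' com' pq.
- by have [l [z [hz hl]]] := nz; exists l, z; split; rewrite // /star_height F' oppr_eq0.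
- by move=> l m z t hz ht /(only l z hz) -> /(only m t ht) ->.
exists I, true; split=> // l; have [h5 h6] := h4 l; split=> // a b c u.
by rewrite -h6 // F' expr0 expr1 mulr1z mulrN1z.
Qed.

(** * Three stars without a common vertex *)

Hypothesis none : ~ exists p, forall i, common_to (y i) p.
Variable P : 'I_3 -> 'I_n.
Hypothesis center : forall i, common_to (y i) (P i).

(** The three values on a triangle add up to 0, so a triangle linked for the third index is linked
    for [i] or [j], and [c] would be common to all three stars. *)
Lemma common_to_two (i j : 'I_3) (c : 'I_n) : i != j ->
  common_to (y i) c -> common_to (y j) c -> False.
Proof.
move=> hij ci cj; apply: none; exists c => l u v w uu hl.
have [k [_ _ cov sm]] := ord3_third hij.
have [hi|] := eqVneq (F i u v w) 0; last exact: ci.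
have [hj|] := eqVneq (F j u v w) 0; last exact: cj.
have := triangle_value_sum0 sum0 u v w; rewrite sm hi hj !add0r => hk.
by case: (cov l) hl => ->; rewrite ?hi ?hj ?hk eqxx.
Qed.

Lemma center_inj : injective P.
Proof.
move=> i j hP; apply/eqP/negPn/negP => hij; apply: (@common_to_two i j (P i) hij).
  exact: center.
by rewrite hP; exact: center.
Qed.

Lemma two_centers (i u v w : _) : uniq [:: u; v; w] -> F i u v w != 0 ->
  P i \in [:: u; v; w] /\ exists2 j, j != i & P j \in [:: u; v; w].
Proof.
move=> uu hF; split; first exact: center hF.
have [j hj] := ord3_other i; have [k [ki _ _ sm]] := ord3_third hj.
have := triangle_value_sum0 sum0 u v w; rewrite sm => h0.
have [hFj|hFj] := eqVneq (F j u v w) 0; last first.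
  by exists j; [rewrite eq_sym | exact: center hFj].
exists k => //; apply: (center uu); apply: contraNneq hF => hFk.
by move: h0; rewrite hFj hFk !addr0 => ->.
Qed.

(* Every linked triangle contains two centers, so the height of [i] is constant off the centers;
   it differs there from the heights of the other two centers, since no center is common to two
   of the stars. *)
Lemma center_arms (i : 'I_3) : exists eps : int, [/\ (eps = 1) \/ (eps = -1),
  (exists x, forall j, x != P j),
  (forall j x, j != i -> (forall l, x != P l) -> F i (P i) (P j) x = eps),
  (forall j k, j != i -> k != i -> F i (P i) (P j) (P k) = 0) &
  (forall x z, (forall l, x != P l) -> (forall l, z != P l) -> F i (P i) x z = 0)].
Proof.
have flat x z : (forall l, x != P l) -> (forall l, z != P l) -> F i (P i) x z = 0.
  move=> hx hz; have [u|nu] := boolP (uniq [:: P i; x; z]); last first.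
    exact: triangle_value_degenerate.
  apply/eqP/negPn/negP => h; have [_ [j hj]] := two_centers u h.
  rewrite !inE ![P j == _]eq_sym (negPf (hx j)) (negPf (hz j)) !orbF => /eqP/center_inj.
  by move=> E; rewrite E eqxx in hj.
(* Some triangle linked for [i] avoids [P k], as [P k] is not common to them. It contains [P i] and
   a second center, necessarily [P j], and its third corner is off the centers. *)
have outer j : j != i -> exists x, (forall l, x != P l) /\ F i (P i) (P j) x != 0.
  move=> hj; have hij : i != j by rewrite eq_sym.
  have [k [ki kj cov _]] := ord3_third hij.
  have : ~ common_to (y i) (P k).
    by move=> c; apply: (@common_to_two i k (P k)); rewrite 1?eq_sym //; exact: center.
  move=> /existsNP[u /existsNP[v /existsNP[w /not_implyP[uu /not_implyP[hF /negP nk]]]]].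
  have [hPi [m hm hPm]] := two_centers uu hF.
  have mj : m = j.
    by case: (cov m) => // E; [rewrite E eqxx in hm | rewrite -E hPm in nk].
  subst m; have [|x [hx x1 x2 hF']] := triangle_value_third (anti i) uu hF hPi hPm.
    by apply: contra hij => /eqP /center_inj ->.
  exists x; split => // l; case: (cov l) => -> //.
  by apply: contraNneq nk => <-.
have [j hij] := ord3_other i; have hj : j != i by rewrite eq_sym.
have [k [ki kj cov _]] := ord3_third hij.
have Pij : P j != P i by apply: contra hj => /eqP/center_inj ->.
have Pik : P k != P i by apply: contra ki => /eqP/center_inj ->.
pose h := star_height (y i) (P i) (P j).
have hE x z : x != P i -> z != P i -> F i (P i) x z = h x - h z.
  by move=> hx hz; exact: (star_heightB (anti i) (@center i) Pij hx hz).
have hB x z : x != P i -> z != P i -> -1 <= h x - h z <= 1.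
  by move=> hx hz; exact: (star_height_bound (anti i) (@weak i) (@center i) Pij hx hz).
have hj0 : h (P j) = 0 by exact: star_height_base.
have [x [hx hxj]] := outer j hj; have [z [hz hzk]] := outer k ki.
have const t : (forall l, t != P l) -> h t = h x.
  move=> ht; have := flat t x ht hx; rewrite hE //; move: (h t) (h x); clear; lia.
have hxz := const z hz.
(* [h x] differs by exactly 1 from both [h (P j)] and [h (P k)], and these two differ from each
   other by at most 1, so they are equal. *)
have hk0 : h (P k) = 0 /\ ((h x = 1) \/ (h x = -1)).
  move: hxj hzk; rewrite !hE // hxz hj0.
  have := hB (P j) x Pij (hx i); have := hB (P k) x Pik (hx i); have := hB (P k) (P j) Pik Pij.
  rewrite hj0; move: (h (P k)) (h x); clear; lia.
have [hk1 hx1] := hk0.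
have h0 l : l != i -> h (P l) = 0.
  by move=> hl; case: (cov l) => E; subst l => //; rewrite eqxx in hl.
have Pl l : l != i -> P l != P i by move=> hl; apply: contra hl => /eqP/center_inj ->.
exists (- h x); split=> //.
- by move: hx1; clear; lia.
- by exists x.
- by move=> l t hl ht; rewrite hE ?Pl // h0 // const // sub0r.
- by move=> l m hl hm; rewrite hE ?Pl // !h0.
Qed.

End ThetaTriple.

Section ThetaTriple.
Variables (n : nat) (y : 'I_3 -> 'I_n -> 'I_n -> int).
Hypothesis anti : forall i k l, y i l k = - y i k l.
Hypothesis weak : forall i s, is_complete_cycle s ->
  `|\sum_(p <- cyclic_pairs s) y i p.1 p.2| <= 1.
Hypothesis sum0 : forall k l, \sum_i y i k l = 0.
Local Notation F i := (triangle_value (y i)).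

Lemma three_centers : (0 < n)%N -> ~ (exists p, forall i, common_to (y i) p) ->
  (5 <= n)%N /\ exists P : 'I_3 -> 'I_n, injective P /\ exists b : bool, forall i,
    star_partition (P i) [set P j | j in [set~ i]] (~: [set P j | j in [set: 'I_3]]) /\
    forall x z w, uniq [:: x; z; w] -> F i x z w *~ (-1) ^+ b =
      if in_star (P i) [set P j | j in [set~ i]] (~: [set P j | j in [set: 'I_3]]) x z w
      then 1
      else if in_star (P i) [set P j | j in [set~ i]] (~: [set P j | j in [set: 'I_3]]) w z x
      then -1 else 0.
Proof.
move=> n0 none.
have /fin_all_exists[P center] := fun i => star_center (anti i) (@weak i) n0.
have injP := center_inj sum0 none center.
have /fin_all_exists[eps arms] := center_arms anti weak sum0 none center.
have [_ [x0 hx0] _ _ _] := arms 0.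
have neqP i j : i != j -> P i != P j by apply: contra => /eqP/injP ->.
(* On the triangle [P i], [P j], [x0] the third cochain vanishes, since [P k] is not a corner; the
   other two have the values [eps i] and [- eps j]. *)
have eps_eq i j : i != j -> eps i = eps j.
  move=> hij; have hji : j != i by rewrite eq_sym.
  have [k [ki kj _ sm]] := ord3_third hij.
  have := triangle_value_sum0 sum0 (P i) (P j) x0; rewrite sm.
  have -> : F k (P i) (P j) x0 = 0.
    have [//|h] := eqVneq (F k (P i) (P j) x0) 0.
    have u : uniq [:: P i; P j; x0].
      by rewrite /= !inE negb_or neqP // ![P _ == x0]eq_sym !hx0.
    have := center k _ _ _ u h; rewrite !inE (negPf (neqP k i ki)) (negPf (neqP k j kj)).
    by rewrite eq_sym (negPf (hx0 k)).
  have [_ _ ai _ _] := arms i; have [_ _ aj _ _] := arms j.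
  rewrite (ai j x0 hji hx0).
  have -> : F j (P i) (P j) x0 = - eps j.
    rewrite -(aj i x0 hij hx0) triangle_value_rot.
    exact: (triangle_value_swap (anti j)).
  by rewrite addr0 => /eqP; rewrite subr_eq0 => /eqP.
have epsE i : eps i = eps 0.
  by have [->|/eps_eq] := eqVneq i 0.
pose b := eps 0 == -1.
have sgn i : eps i *~ (-1) ^+ b = 1.
  have [h _ _ _] := arms 0; rewrite epsE /b.
  by case: h => ->.
have memP x : (x \in [set P j | j in [set: 'I_3]]) = ~~ [forall l, x != P l].
  apply/imsetP/forallPn => [[j _ ->]|[j]]; first by exists j; rewrite eqxx.
  by rewrite negbK => /eqP ->; exists j.
split.
  (* If [x0] were the only vertex off the centers, every linked triangle would consist of two
     centers and [x0], because three centers have the value 0; then [x0] would be common to all. *)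
  have [x1 hx1 x1x0] : exists2 x1, (forall l, x1 != P l) & x1 != x0.
    have [//|no] := pselect (exists2 x1, (forall l, x1 != P l) & x1 != x0).
    case: none; exists x0 => i u v w uu hF.
    have [hPi [j hj hPj]] := two_centers sum0 center uu hF.
    have [|x [hx hxi hxj hFx]] := triangle_value_third (anti i) uu hF hPi hPj.
      by rewrite eq_sym neqP.
    suff <- : x = x0 by [].
    apply/eqP/negPn/negP => hxx; apply: no; exists x => // l.
    apply: contraNneq hFx => E; have [_ _ _ flat _] := arms i.
    rewrite E; apply/eqP; apply: flat => //.
    by apply: contraNneq hxi => El; rewrite E El.
  have u : uniq [:: P 0; P 1; P 2; x0; x1].
    rewrite /= !inE !negb_or !neqP // ![P _ == x0]eq_sym ![P _ == x1]eq_sym.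
    by rewrite !hx0 !hx1 eq_sym x1x0.
  by have := max_card (mem [:: P 0; P 1; P 2; x0; x1]); rewrite card_ord (card_uniqP u).
exists P; split=> //; exists b => i.
have part : star_partition (P i) [set P j | j in [set~ i]] (~: [set P j | j in [set: 'I_3]]).
  split.
    rewrite finset.disjoints_subset finset.setCK; apply/fintype.subsetP => x.
    by move=> /imsetP[j _ ->]; apply: imset_f; rewrite inE.
  apply/setP => x; rewrite !inE memP negbK.
  apply/orP/idP => [[/imsetP[j hj ->]|/forallP h]|hx].
  - by move: hj; rewrite !inE; exact: neqP.
  - exact: h.
  - have [h|] := boolP [forall l, x != P l]; first by right.
    rewrite negb_forall => /existsP[j]; rewrite negbK => /eqP E; left.
    rewrite E; apply: imset_f; rewrite !inE; apply: contraNneq hx => <-.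
    by rewrite E.
split=> //.
pose y' (k l : 'I_n) : int := y i k l *~ (-1) ^+ b.
have F' u v w : triangle_value y' u v w = F i u v w *~ (-1) ^+ b.
  by rewrite /triangle_value !mulrzDl.
move=> x z w u; rewrite -F'; move: x z w u.
apply: star_formula => //.
- move=> u v w uu; rewrite F' => h; apply: center uu _.
  by apply: contraNneq h => ->; rewrite mul0rz.
move=> z w hz hw hzw; rewrite F'.
have [_ _ arm base flat] := arms i.
have inO x : x \in [set P j | j in [set~ i]] -> exists2 j, j != i & x = P j.
  by move=> /imsetP[j]; rewrite !inE => hj ->; exists j.
have cases x : x != P i ->
    (x \in [set P j | j in [set~ i]]) /\ (x \in ~: [set P j | j in [set: 'I_3]] = false) \/
    (x \in [set P j | j in [set~ i]] = false) /\ (x \in ~: [set P j | j in [set: 'I_3]]).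
  move=> hx; case: part => dis cov.
  have := finset.in_setU x [set P j | j in [set~ i]] (~: [set P j | j in [set: 'I_3]]).
  rewrite cov !inE hx; case: (boolP (x \in [set P j | j in [set~ i]])) => h.
    by left; split=> //; have := disjointFr dis h; rewrite inE.
  by move=> /= e; right; rewrite -e.
have inI x : x \in ~: [set P j | j in [set: 'I_3]] -> forall l, x != P l.
  by rewrite inE memP negbK => /forallP.
case: (cases z hz) => -[z1 z2]; case: (cases w hw) => -[w1 w2]; rewrite z1 z2 w1 w2 /=.
- have [j hj ->] := inO z z1; have [k hk ->] := inO w w1.
  by rewrite base // mul0rz.
- by have [j hj ->] := inO z z1; rewrite arm ?sgn //; exact: inI.
- have [j hj ->] := inO w w1.
  by rewrite triangle_value_swap // arm ?mulNrz ?sgn //; exact: inI.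
- by rewrite flat ?mul0rz //; exact: inI.
Qed.

End ThetaTriple.

(** * From the cochains back to the two graphs *)

(** [g] extends to a linear form on the chain group [Z^3], which takes [theta_class c] to
    [g c.1 - g c.2]. *)
Lemma theta_class_sum (C : 'I_3 -> 'I_3 * 'I_3) (g : 'I_3 -> int) :
  \sum_i theta_class (C i) = 0 -> \sum_i (g (C i).1 - g (C i).2) = 0.
Proof.
move=> h; have sg (u : 'I_3) : g u = \sum_m (m == u)%:R * g m.
  by rewrite (bigD1 u) //= eqxx mul1r big1 ?addr0 // => m /negPf ->; rewrite mul0r.
under eq_bigr => i _ do rewrite (sg (C i).1) (sg (C i).2) -sumrB.
rewrite exchange_big big1 // => m _.
have := congr1 (fun A : 'rV[int]_3 => A 0 m) h; rewrite summxE mxE => hm.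
under eq_bigr do rewrite -mulrBl.
rewrite -mulr_suml.
have -> : \sum_i ((m == (C i).1)%:R - (m == (C i).2)%:R) = 0 :> int; last by rewrite mul0r.
by rewrite -[RHS]hm; apply: eq_bigr => i _; rewrite /theta_class !mxE.
Qed.

(** Let [w] be the edge off [c]. A cycle [C i] that avoids [w] is [c] or its reverse. Otherwise all
    three [C i] run along [w], and three coefficients 1 or -1 cannot add up to 0. *)
Lemma theta_cycle_cover (C : 'I_3 -> 'I_3 * 'I_3) (c : 'I_3 * 'I_3) :
  (forall i, is_theta_cycle (C i)) -> \sum_i theta_class (C i) = 0 -> is_theta_cycle c ->
  exists i b, c = theta_rev b (C i).
Proof.
move=> hC hC0 hc; have [w [w1 w2 cov _]] := ord3_third hc.
have [[i [h1 h2]]|none] := pselect (exists i, w != (C i).1 /\ w != (C i).2).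
  exists i; have := hC i; rewrite /is_theta_cycle;
  case: c (C i) h1 h2 cov {w1 w2 hc} => c1 c2 [d1 d2] /=.
  move=> h1 h2 cov.
  case: (cov d1) => E1; case: (cov d2) => E2; rewrite ?E1 ?E2 ?eqxx // in h1 h2 *.
    by exists false.
  by move=> _; exists true.
have odd i : (w == (C i).1)%:Z - (w == (C i).2)%:Z = 1 \/
    (w == (C i).1)%:Z - (w == (C i).2)%:Z = -1.
  have := hC i; rewrite /is_theta_cycle.
  have [E1|n1] := eqVneq w (C i).1; have [E2|n2] := eqVneq w (C i).2 => h.
  - by rewrite -E1 -E2 eqxx in h.
  - by left.
  - by right.
  - by case: none; exists i.
have := theta_class_sum (fun m => (w == m)%:Z) hC0.
have [k [_ _ _ ->]] := @ord3_third 0 1 isT.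
by case: (odd 0) => ->; case: (odd 1) => ->; case: (odd k) => ->.
Qed.

Theorem theorem3p1 (R : realType) (n : nat)
    (e : 'I_3 -> R -> 'rV[R]_3)
    (v : 'I_n -> 'rV[R]_3) (a : 'I_n -> 'I_n -> R -> 'rV[R]_3)
    (C : 'I_3 -> 'I_3 * 'I_3)
    (hn : (3 <= n)%N)
    (he : theta_embedding e)
    (ha : complete_embedding v a)
    (hdisj : disjointly_embedded e a)
    (hweak : weakly_linked e a)
    (hC : forall i, is_theta_cycle (C i))
    (hC0 : \sum_i theta_class (C i) = 0) :
  (case_A1 e a C \/ case_A2 e a C) /\ ~ (case_A1 e a C /\ case_A2 e a C).
Proof.
split; last by move=> [[ex _] [nex _ _]].
have [Y [antiY LkY]] := Lk_edges he ha hdisj.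
(* [Lk_edges] gives antisymmetry off the diagonal only. Cycles have no diagonal edges, so the value
   0 there changes no sum and makes antisymmetry hold everywhere. *)
pose y i (k l : 'I_n) : int := if k == l then 0 else Y (C i).1 k l - Y (C i).2 k l.
have anti i k l : y i l k = - y i k l.
  rewrite /y eq_sym; have [_|kl] := eqVneq k l; first by rewrite oppr0.
  by rewrite !(antiY _ _ _ kl); ring.
have LkC b i s : is_complete_cycle s ->
    Lk (theta_curve e (theta_rev b (C i))) (complete_curve a s) =
    (\sum_(p <- cyclic_pairs s) y i p.1 p.2) *~ (-1) ^+ b.
  move=> hs; rewrite LkY //.
  have -> : \sum_(p <- cyclic_pairs s) y i p.1 p.2 =
      \sum_(p <- cyclic_pairs s) (Y (C i).1 p.1 p.2 - Y (C i).2 p.1 p.2).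
    apply: eq_big_seq => p hp; case/andP: hs => us /ltnW hs.
    by rewrite /y (negPf (cyclic_pairs_neq us hs hp)).
  case: b; rewrite /= ?expr0 ?expr1 ?mulr1z // mulrN1z -sumrN.
  by apply: eq_bigr => p _; rewrite opprB.
have weak i s : is_complete_cycle s -> `|\sum_(p <- cyclic_pairs s) y i p.1 p.2| <= 1.
  move=> hs; have := hweak.2 (C i) s (hC i) hs.
  rewrite /strongly_linked (LkC false i s hs) expr0 mulr1z.
  by move/negP; rewrite -ltNge; move: (\sum_(_ <- _) _) => ? ; lia.
have sum0 k l : \sum_i y i k l = 0.
  case E: (k == l); rewrite /y E; first by rewrite big1.
  exact: (theta_class_sum (fun m => Y m k l)).
have LkT b i u x w : uniq [:: u; x; w] ->
    Lk (theta_curve e (theta_rev b (C i))) (complete_curve a [:: u; x; w]) =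
    triangle_value (y i) u x w *~ (-1) ^+ b.
  move=> uu; rewrite LkC; last by rewrite /is_complete_cycle uu.
  by rewrite /cyclic_pairs /= !big_cons big_nil addr0 addrA.
have sign_eq0 (b : bool) (m : int) : (m *~ (-1) ^+ b == 0) = (m == 0).
  by case: b; rewrite ?expr0 ?expr1 ?mulr1z // mulrN1z oppr_eq0.
have comE p : common_vertex e a p <-> forall i, common_to (y i) p.
  split=> [com i u x w uu h | com u x w c uu hc].
    by apply: (com u x w (C i)) => //; rewrite /linked (LkT false i u x w uu) sign_eq0.
  have [i [b ->]] := theta_cycle_cover hC hC0 hc.
  by rewrite /linked LkT // sign_eq0; exact: com.
have n0 : (0 < n)%N by apply: leq_trans hn.
have [ex|nex] := pselect (exists p, common_vertex e a p); [left|right].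
  split=> // p /comE com.
  have [q pq] : exists q, q != p.
    have n1 : (1 < n)%N by apply: leq_trans hn.
    have [E|h] := eqVneq (Ordinal n0) p; last by exists (Ordinal n0).
    by exists (Ordinal n1); rewrite -E.
  (* Here the existence of a linked pair of cycles enters. If all heights vanished, each [y i] would
     be the coboundary of its values on the edges to [p] and would sum to 0 round every cycle, not
     only round triangles. *)
  have nz : exists i x, x != p /\ star_height (y i) p q x != 0.
    have [none|//] := pselect (~ exists i x, x != p /\ star_height (y i) p q x != 0);
      last by move/contrapT.
    exfalso; have [c [s [hc hs]]] := hweak.1.
    have [i [b ->]] := theta_cycle_cover hC hC0 hc.
    rewrite /linked LkC // sign_eq0 => /eqP; apply.
    have h0 x : x != p -> star_height (y i) p q x = 0.
      move=> hx; apply/eqP/negPn/negP => h; apply: none; exists i, x; split=> //.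
    have zero k : y i k k = 0 by rewrite /y eqxx.
    rewrite -[RHS](sum_cyclic_coboundary s (fun x => y i x p)).
    apply: eq_bigr => -[x w] _ /=.
    have [->|hx] := eqVneq x p; first by rewrite zero sub0r anti.
    have [->|hw] := eqVneq w p; first by rewrite zero subr0.
    have := star_heightB (anti i) (com i) pq hx hw; rewrite !h0 // subrr.
    by rewrite /triangle_value (anti i x p); lia.
  have [I [b [h1 h2 h3 h4]]] := shared_center anti weak sum0 com pq nz.
  exists I; split=> //; exists b => i; have [h5 h6] := h4 i.
  by split=> // x z w u; rewrite LkT // h6.
have [|n5 [P [injP [b hb]]]] := three_centers anti weak sum0 n0.
  by move=> [p hp]; apply: nex; exists p; apply/comE.
split=> //; exists P; split=> //; exists b => i; have [h5 h6] := hb i.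
by split=> // x z w u; rewrite LkT // h6.
Qed.
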